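(* Let $\Psi\colon[-1,1]\to\mathbb{R}$ be a function that has a real analytic extension to an open neighbourhood of $[-1,1]$, let $$\Gamma := \{(x,\Psi(x)) : x\in(-1,1)\}\subset\mathbb{R}^2, \qquad \Omega := \{(x,y)\in(-1,1)\times\mathbb{R} : y<\Psi(x)\},$$ and let $\bm{n}$ be the unit normal to $\Gamma$ facing away from $\Omega$. Let $g,h\in C^1([-1,1])$. There exist $U\subset\mathbb{R}^2$, an open connected neighbourhood of $\Gamma$, and $u\in C^2(U\setminus\overline{\Omega})\cap C^1(U\setminus\Omega)$ that solves $$\begin{cases} \Delta u(x,y)=0 & \text{for } (x,y)\in U\setminus\overline{\Omega},\\ u(x,\Psi(x))=g(x) & \text{for } x\in(-1,1),\\ \dfrac{\partial u}{\partial \bm{n}}(x,\Psi(x))=h(x) & \text{for } x\in(-1,1), \end{cases}$$ if and only if the function $$H(x) := g(x)-\frac{1}{\pi}\int_{-1}^1 h(t)\sqrt{1+\Psi'(t)^2}\,\log\sqrt{(x-t)^2+(\Psi(x)-\Psi(t))^2}\,\mathrm{d}t$$ is real analytic on $(-1,1)$.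
   Context: Here $u\in C^1(U\setminus\Omega)$ means that $u$ and its first order partial derivatives are continuous up to $\Gamma$ (i.e. they extend continuously from $U\setminus\overline{\Omega}$ to $\Gamma$), and $\frac{\partial u}{\partial\bm{n}}=\nabla u\cdot\bm{n}$ on $\Gamma$, where $\bm{n}$ at $(x,\Psi(x))$ equals $\frac{1}{\sqrt{1+\Psi'(x)^2}}(-\Psi'(x),1)$. $\Delta$ is the Laplacian in $\mathbb{R}^2$. *)

(* Defs.v *)
From mathcomp Require Import all_boot all_order all_algebra.
From mathcomp Require Import all_classical all_reals all_analysis.

Set Implicit Arguments.
Unset Strict Implicit.
Unset Printing Implicit Defensive.

Import Order.TTheory GRing.Theory Num.Theory.
Import numFieldNormedType.Exports.

Local Open Scope classical_set_scope.
Local Open Scope ring_scope.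

Section Defs.
Context {R : realType}.

Definition real_analytic_on (A : set R) (f : R -> R) : Prop :=
  forall a, A a -> exists (c : nat -> R) (r : R), 0 < r /\
    forall x, `|x - a| < r ->
      pseries c (x - a) @ \oo --> f x.

Definition has_analytic_extension (K : set R) (f : R -> R) : Prop :=
  exists (W : set R) (F : R -> R),
    [/\ open W, K `<=` W, {in K, F =1 f} & real_analytic_on W F].

(* Functions on a subset are represented by total functions, so "f extends
   continuously from A to B" asks for some F equal to f on A, not for
   continuity of f itself, whose values on B `\` A are arbitrary. *)
Definition extends_continuously (X Y : topologicalType) (A B : set X)
    (f : X -> Y) : Prop :=
  exists F : X -> Y, {in A, F =1 f} /\ {within B, continuous F}.

Definition C1_itvcc (a b : R) (f : R -> R) : Prop :=
  [/\ {within `[a, b], continuous f},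
      (forall x, x \in `]a, b[ -> derivable f x 1) &
      extends_continuously `]a, b[ `[a, b] (derive1 f)].

Definition partial1 (u : R * R -> R) (p : R * R) : R := 'D_(1, 0) u p.
Definition partial2 (u : R * R -> R) (p : R * R) : R := 'D_(0, 1) u p.

Definition has_partials_on (A : set (R * R)) (u : R * R -> R) : Prop :=
  forall p, A p -> derivable u p (1, 0) /\ derivable u p (0, 1).

(* Meant for open A: continuity is at p in the plane, not relative to A. *)
Definition C0_on (A : set (R * R)) (u : R * R -> R) : Prop :=
  forall p, A p -> {for p, continuous u}.

Definition C1_on (A : set (R * R)) (u : R * R -> R) : Prop :=
  [/\ C0_on A u, has_partials_on A u, C0_on A (partial1 u)
    & C0_on A (partial2 u)].

Definition C2_on (A : set (R * R)) (u : R * R -> R) : Prop :=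
  [/\ C1_on A u, C1_on A (partial1 u) & C1_on A (partial2 u)].

(* For A = U `\` closure Omega and G = Gamma this is C^1(U `\` Omega): the
   continuous extension is to Gamma only, not to the rest of the boundary of
   Omega, i.e. the vertical half-lines below the end points of Gamma. *)
Definition C1_up_to (A G : set (R * R)) (u : R * R -> R) : Prop :=
  [/\ C1_on A u,
      {within A `|` G, continuous u},
      extends_continuously A (A `|` G) (partial1 u) &
      extends_continuously A (A `|` G) (partial2 u)].

Definition laplacian (u : R * R -> R) (p : R * R) : R :=
  partial1 (partial1 u) p + partial2 (partial2 u) p.

(* The value at a boundary point p of the continuous extension of f from A. *)
Definition boundary_value (A : set (R * R)) (f : R * R -> R) (p : R * R) : R :=
  lim (f @ within A (nbhs p)).

Definition graph_curve (Psi : R -> R) : set (R * R) :=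
  [set p | -1 < p.1 < 1 /\ p.2 = Psi p.1].

Definition subgraph (Psi : R -> R) : set (R * R) :=
  [set p | -1 < p.1 < 1 /\ p.2 < Psi p.1].

Definition unit_normal (Psi : R -> R) (x : R) : R * R :=
  (Num.sqrt (1 + derive1 Psi x ^+ 2))^-1 *: (- derive1 Psi x, 1).

Definition normal_derivative (Psi : R -> R) (A : set (R * R))
    (u : R * R -> R) (x : R) : R :=
  boundary_value A (partial1 u) (x, Psi x) * (unit_normal Psi x).1 +
  boundary_value A (partial2 u) (x, Psi x) * (unit_normal Psi x).2.

Definition cauchy_solution (Psi g h : R -> R) (U : set (R * R))
    (u : R * R -> R) : Prop :=
  let A := U `\` closure (subgraph Psi) in
  [/\ forall p, A p -> laplacian u p = 0,
      forall x, -1 < x < 1 -> u (x, Psi x) = g x &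
      forall x, -1 < x < 1 -> normal_derivative Psi A u x = h x].

(* The integrand takes default values at t = x, where ln 0 = 0, and possibly
   at t = -1 and t = 1, where Psi need not be differentiable as a function
   on the whole line; these points form a null set. *)
Definition H_fun (Psi g h : R -> R) (x : R) : R :=
  g x - pi^-1 *
    \int[lebesgue_measure]_(t in `[-1, 1])
      (h t * Num.sqrt (1 + derive1 Psi t ^+ 2) *
       ln (Num.sqrt ((x - t) ^+ 2 + (Psi x - Psi t) ^+ 2))).

End Defs.

(* Main.v *)
(** Proof. Extend [Psi] holomorphically and put [gamma z = z + i Psi z]. Near
    [[-1, 1]] one has [Re gamma' >= 1/2], so that [gamma] is injective there
    and maps the upper side of the real axis to the points above the graph.
    For [q = h |gamma'|] let [S z] be the integral of
    [q t * log |gamma z - gamma t|] over [-1 < t < 1] and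
    [T z = (S z + S (conj z)) / (2 pi)]. The kernel
    [gamma' z / (gamma z - gamma t)] of the gradient of [S] differs from the
    Cauchy kernel [1 / (z - t)] by a bounded function, and the Lipschitz
    continuity of [q] then shows that [T] is C^1 up to the axis from above,
    with boundary value [g - H] and normal derivative [q], which is also the
    normal derivative of [u o gamma] for a solution [u].
    If [u] is a solution, then [u o gamma - T] is harmonic above the axis and
    has normal derivative zero on it; by Schwarz reflection its complex
    gradient is holomorphic across the axis, hence its boundary value [H] is
    analytic. Conversely, if [H] is analytic, then [Re H + T], transported by
    the inverse of [gamma], is a solution. *)

Require Import Defs.
From mathcomp Require Import all_boot all_order all_algebra.
From mathcomp Require Import all_classical all_reals all_analysis.
From mathcomp Require Import measurable_realfun complex ring lra.

Set Implicit Arguments.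
Unset Strict Implicit.
Unset Printing Implicit Defensive.

Import Order.TTheory GRing.Theory Num.Theory.
Import numFieldNormedType.Exports.

Local Open Scope classical_set_scope.
Local Open Scope ring_scope.

Local Open Scope complex_scope.
Local Notation Re := complex.Re.
Local Notation Im := complex.Im.

(** * Complex derivatives and real gradients *)

Section Modulus.
Context {R : realType}.
Implicit Types (x y : R) (z w : R[i]).

(** The parametrisation [gamma] is conformal, so it preserves harmonicity, turns reflection in the
    curve into conjugation, and multiplies normal derivatives by [|gamma'|]; this is why the weight
    [sqrt (1 + Psi'^2)] appears in the integral. Real functions are handled through the conjugate
    gradient [u_x - i u_y], which is holomorphic when [u] is harmonic and transforms by
    multiplication under holomorphic maps. The normal derivative on the axis is minus its imaginary
    part. The obstacle is that [h] is merely [C^1]: estimating the derivative of the Cauchy integral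
    by its modulus leaves a logarithm. Real and imaginary parts are therefore treated apart. The
    imaginary part is a Poisson integral with a computable limit; the real part is only shown to
    have some limit, because its vertical derivative is bounded. A reflected gradient is known to be
    no more than continuous on the axis, so Cauchy's theorem and the power series expansion are
    proved for functions that are continuous on a square and holomorphic off a horizontal line. All
    boundary limits are taken at interior points of [[-1, 1]], away from the ends of the curve. *)

Definition cm z : R := Normc.normc z.
Definition iC : R[i] := 0 +i* 1.
Definition cj z : R[i] := Re z -i* Im z.

Lemma cReD z w : Re (z + w) = Re z + Re w. Proof. by case: z; case: w. Qed.
Lemma cImD z w : Im (z + w) = Im z + Im w. Proof. by case: z; case: w. Qed.
Lemma cReN z : Re (- z) = - Re z. Proof. by case: z. Qed.
Lemma cImN z : Im (- z) = - Im z. Proof. by case: z. Qed.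
Lemma cReB z w : Re (z - w) = Re z - Re w. Proof. by rewrite cReD cReN. Qed.
Lemma cImB z w : Im (z - w) = Im z - Im w. Proof. by rewrite cImD cImN. Qed.
Lemma cReM z w : Re (z * w) = Re z * Re w - Im z * Im w.
Proof. by case: z; case: w. Qed.
Lemma cImM z w : Im (z * w) = Re z * Im w + Im z * Re w.
Proof. by case: z => a b; case: w => c d. Qed.
Lemma cReJ z : Re (cj z) = Re z. Proof. by []. Qed.
Lemma cImJ z : Im (cj z) = - Im z. Proof. by []. Qed.

Definition cE := (cReD, cImD, cReN, cImN, cReM, cImM, cReJ, cImJ).

Lemma c_eqP z w : Re z = Re w -> Im z = Im w -> z = w.
Proof. by case: z => a b; case: w => c d /= -> ->. Qed.

Lemma cJM z w : cj (z * w) = cj z * cj w.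
Proof. by apply: c_eqP; rewrite !cE /=; ring. Qed.
Lemma cJD z w : cj (z + w) = cj z + cj w.
Proof. by apply: c_eqP; rewrite !cE //; ring. Qed.
Lemma cJN z : cj (- z) = - cj z.
Proof. by apply: c_eqP; rewrite !cE. Qed.
Lemma cJK z : cj (cj z) = z.
Proof. by apply: c_eqP; rewrite !cE ?opprK. Qed.
Lemma cJR x : cj x%:C = x%:C.
Proof. by apply: c_eqP; rewrite !cE /= ?oppr0. Qed.
Lemma cJB z w : cj (z - w) = cj z - cj w. Proof. by rewrite cJD cJN. Qed.

Lemma cmE z : cm z = Num.sqrt (Re z ^+ 2 + Im z ^+ 2).
Proof. by case: z. Qed.
Lemma cm_ge0 z : 0 <= cm z. Proof. by rewrite cmE sqrtr_ge0. Qed.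
Lemma cm0 : cm 0 = 0. Proof. exact: Normc.normc0. Qed.
Lemma cm1 : cm 1 = 1. Proof. exact: Normc.normc1. Qed.
Lemma cmM z w : cm (z * w) = cm z * cm w. Proof. exact: Normc.normcM. Qed.
Lemma cmV z : cm z^-1 = (cm z)^-1. Proof. exact: Normc.normcV. Qed.
Lemma cmX z n : cm (z ^+ n) = cm z ^+ n.
Proof. by elim: n => [|n IH]; rewrite ?expr0 ?cm1// !exprS cmM IH. Qed.
Lemma cmN z : cm (- z) = cm z. Proof. by rewrite /cm /Normc.normc; case: z => a b; rewrite /= !sqrrN. Qed.
Lemma cmD z w : cm (z + w) <= cm z + cm w. Proof. exact: le_normcD. Qed.
Lemma cmB z w : cm (z - w) <= cm z + cm w.
Proof. by rewrite (le_trans (cmD _ _))// cmN. Qed.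
Lemma cm_dist z w : cm (z - w) = cm (w - z). Proof. by rewrite -cmN opprB. Qed.
Lemma cm_eq0 z : (cm z == 0) = (z == 0).
Proof.
apply/idP/idP => [/eqP /Normc.eq0_normc ->//|/eqP ->].
by rewrite cm0.
Qed.
Lemma cm_gt0 z : (0 < cm z) = (z != 0).
Proof. by rewrite lt_def cm_ge0 andbT cm_eq0. Qed.
Lemma cmR x : cm x%:C = `|x|.
Proof. by rewrite cmE /= expr0n /= addr0 sqrtr_sqr. Qed.
Lemma cmJ z : cm (cj z) = cm z.
Proof. by rewrite !cmE cReJ cImJ sqrrN. Qed.
Lemma cm_i : cm iC = 1.
Proof. by rewrite cmE /= expr0n /= add0r expr1n sqrtr1. Qed.
Lemma cm_sqr z : cm z ^+ 2 = Re z ^+ 2 + Im z ^+ 2.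
Proof. by rewrite cmE sqr_sqrtr// addr_ge0// sqr_ge0. Qed.
Lemma Re_le_cm z : `|Re z| <= cm z.
Proof. by rewrite cmE -sqrtr_sqr ler_wsqrtr// lerDl sqr_ge0. Qed.
Lemma Im_le_cm z : `|Im z| <= cm z.
Proof. by rewrite cmE -sqrtr_sqr ler_wsqrtr// lerDr sqr_ge0. Qed.
Lemma cm_split z : z = (Re z)%:C + iC * (Im z)%:C.
Proof. by apply: c_eqP; rewrite !cE /=; ring. Qed.
Lemma cm_le_ReIm z : cm z <= `|Re z| + `|Im z|.
Proof. by rewrite {1}(cm_split z) (le_trans (cmD _ _))// cmM cm_i mul1r !cmR. Qed.
Lemma cm_ge_dist z w : cm z - cm w <= cm (z - w).
Proof. by rewrite lerBlDr (le_trans _ (cmD _ _))// subrK. Qed.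
Lemma mul_cJ z : cj z * z = (cm z ^+ 2)%:C.
Proof. by rewrite cm_sqr; apply: c_eqP; rewrite !cE /=; ring. Qed.
Lemma cRM x y : (x * y)%:C = x%:C * y%:C :> R[i]. 
Proof. by apply: c_eqP; rewrite !cE /=; ring. Qed.
Lemma cRD x y : (x + y)%:C = x%:C + y%:C :> R[i]. 
Proof. by apply: c_eqP; rewrite !cE /=; ring. Qed.
Lemma cRN x : (- x)%:C = - x%:C :> R[i]. 
Proof. by apply: c_eqP; rewrite !cE /=; ring. Qed.
Lemma cRV x : (x^-1)%:C = x%:C^-1 :> R[i]. 
Proof. exact: fmorphV. Qed.
Lemma cR_eq0 x : (x%:C == 0 :> R[i]) = (x == 0).
Proof. by rewrite -cm_eq0 cmR normr_eq0. Qed.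

(* Take [u = cj z], for which [Re (u * z) = cm z ^+ 2]. *)
Lemma cm_le_rot z (k : R) : 0 <= k ->
  (forall u : R[i], Re (u * z) <= cm u * k) -> cm z <= k.
Proof.
move=> k0 /(_ (cj z)); rewrite mul_cJ cmJ /= expr2.
have := cm_ge0 z; rewrite le_eqVlt => /orP[/eqP <-//|z0].
by rewrite ler_pM2l.
Qed.

Lemma cm_RI x y : cm (x +i* y) <= `|x| + `|y|.
Proof. exact: cm_le_ReIm. Qed.
End Modulus.

Opaque cm.
Arguments cm : simpl never.

Section Deriv.
Context {R : realType}.
Local Notation C := R[i].
Implicit Types (z w h : C) (F G : C -> C) (u v : C -> R).

Definition ccont F z := forall e : R, 0 < e -> exists2 d : R, 0 < d &
  forall w, cm (w - z) < d -> cm (F w - F z) < e.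

(** The derivative is an argument and the remainder is bounded by [e * cm h], so that [h = 0] need
    not be excluded. The gradient relation [gd] has the same shape with only the real part of
    [l * h], which lets the two calculi share their proofs. *)
Definition cd F z (l : C) := forall e : R, 0 < e -> exists2 d : R, 0 < d &
  forall h, cm h < d -> cm (F (z + h) - F z - l * h) <= e * cm h.

(* [l] is the conjugate of the gradient, [l = u_x - i u_y]. *)
Definition gd u z (l : C) := forall e : R, 0 < e -> exists2 d : R, 0 < d &
  forall h, cm h < d -> `|u (z + h) - u z - Re (l * h)| <= e * cm h.

Lemma cont_cst (c : C) z : ccont (fun=> c) z.
Proof. by move=> e e0; exists 1 => // w _; rewrite subrr cm0. Qed.

Lemma cont_id z : ccont id z.
Proof. by move=> e e0; exists e. Qed.

Lemma cont_local F z : ccont F z -> exists2 d : R, 0 < d &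
  forall w, cm (w - z) < d -> cm (F w) <= cm (F z) + 1.
Proof.
move=> /(_ _ ltr01)[d d0 H]; exists d => // w /H /ltW.
by move/(le_trans (cm_ge_dist _ _)); rewrite lerBlDl.
Qed.

Lemma cont_ext F G z (d : R) : 0 < d ->
  (forall w, cm (w - z) < d -> F w = G w) -> ccont F z -> ccont G z.
Proof.
move=> d0 FG cF e /cF[d' d'0 H]; exists (Num.min d d'); rewrite ?lt_min ?d0//.
move=> w; rewrite lt_min => /andP[w1 w2].
by rewrite -!FG ?subrr ?cm0// H.
Qed.

Lemma contD F G z : ccont F z -> ccont G z -> ccont (fun w => F w + G w) z.
Proof.
move=> cF cG e e0.
have e2 : 0 < e / 2 by lra.
have [d d0 H] := cF _ e2; have [d' d'0 H'] := cG _ e2.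
exists (Num.min d d'); rewrite ?lt_min ?d0// => w.
rewrite lt_min => /andP[w1 w2].
have -> : F w + G w - (F z + G z) = (F w - F z) + (G w - G z) by ring.
have := H _ w1; have := H' _ w2; have := cmD (F w - F z) (G w - G z); lra.
Qed.

Lemma contM F G z : ccont F z -> ccont G z -> ccont (fun w => F w * G w) z.
Proof.
move=> cF cG e e0.
have [d0 d00 H0] := cont_local cG.
have p1 : 0 < cm (G z) + 1 by have := cm_ge0 (G z); lra.
have p2 : 0 < cm (F z) + 1 by have := cm_ge0 (F z); lra.
have [d d1 H] := cF (e / 2 / (cm (G z) + 1)) ltac:(by rewrite !divr_gt0).
have [d' d'0 H'] := cG (e / 2 / (cm (F z) + 1)) ltac:(by rewrite !divr_gt0).
exists (Num.min d0 (Num.min d d')); rewrite ?lt_min ?d00 ?d1// => w.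
rewrite !lt_min => /and3P[w0 w1 w2].
have -> : F w * G w - F z * G z = (F w - F z) * G w + F z * (G w - G z) by ring.
rewrite (le_lt_trans (cmD _ _))// !cmM.
have h1 := H _ w1; have h2 := H' _ w2.
have h0 := H0 _ w0.
rewrite ltr_pdivlMr // in h1; rewrite ltr_pdivlMr // in h2.
have a1 : cm (F w - F z) * cm (G w) <= cm (F w - F z) * (cm (G z) + 1).
  by rewrite ler_wpM2l ?cm_ge0.
have a2 : cm (F z) * cm (G w - G z) <= (cm (F z) + 1) * cm (G w - G z).
  by rewrite ler_wpM2r ?cm_ge0// lerDl.
lra.
Qed.

Lemma contN F z : ccont F z -> ccont (fun w => - F w) z.
Proof.
move=> cF e /cF[d d0 H]; exists d => // w /H.
by rewrite -opprD cmN.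
Qed.

Lemma contB F G z : ccont F z -> ccont G z -> ccont (fun w => F w - G w) z.
Proof. by move=> cF /contN; exact: contD. Qed.

Lemma cont_comp F G z : ccont G z -> ccont F (G z) -> ccont (fun w => F (G w)) z.
Proof.
by move=> cG cF e /cF[d /cG[d' d'0 H'] H]; exists d' => // w /H' /H.
Qed.

Lemma cont_inv z : z != 0 -> ccont (fun w => w^-1) z.
Proof.
move=> z0 e e0; have cz : 0 < cm z by rewrite cm_gt0.
exists (Num.min (cm z / 2) (e * cm z ^+ 2 / 2)).
  by rewrite lt_min !divr_gt0 // mulr_gt0 // exprn_gt0.
move=> w; rewrite lt_min => /andP[w1 w2].
have cw : cm z / 2 < cm w by have := cm_ge_dist z w; rewrite cm_dist; lra.
have cw0 : 0 < cm w by lra.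
have w0 : w != 0 by rewrite -cm_gt0.
have -> : w^-1 - z^-1 = (z - w) * (w^-1 * z^-1) by field; rewrite w0 z0.
rewrite !cmM !cmV -invfM ltr_pdivrMr ?mulr_gt0// cm_dist.
rewrite (lt_le_trans w2)//.
have : cm z / 2 * cm z <= cm w * cm z by rewrite ler_wpM2r ?ltW.
move=> hh; have := ler_wpM2l (ltW e0) hh; rewrite expr2; lra.
Qed.

Lemma contV F z : F z != 0 -> ccont F z -> ccont (fun w => (F w)^-1) z.
Proof. by move=> F0 cF; apply: (@cont_comp _ F) => //; exact: cont_inv. Qed.

Lemma contX F n z : ccont F z -> ccont (fun w => F w ^+ n) z.
Proof.
move=> cF; elim: n => [|n IH].
  apply: (@cont_ext (fun=> 1) _ _ 1) => //; last exact: cont_cst.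
apply: (@cont_ext (fun w => F w * F w ^+ n) _ _ 1) => //; last exact: contM.
by move=> w _; rewrite exprS.
Qed.

Lemma cd_cont F z l : cd F z l -> ccont F z.
Proof.
move=> /(_ _ ltr01)[d d0 H] e e0.
have l0 : 0 < cm l + 1 by have := cm_ge0 l; lra.
exists (Num.min d (e / (cm l + 1))); first by rewrite lt_min d0 divr_gt0.
move=> w; rewrite lt_min => /andP[/H + w2].
rewrite ltr_pdivlMr // in w2.
have -> : z + (w - z) = w by ring.
rewrite mul1r => h1.
have := cmD (F w - F z - l * (w - z)) (l * (w - z)).
rewrite subrK cmM; nra.
Qed.

Lemma cd_cst (c : C) z : cd (fun=> c) z 0.
Proof.
by move=> e e0; exists 1 => // h _; rewrite mul0r !subrr cm0 mulr_ge0 ?cm_ge0 ?ltW.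
Qed.

Lemma cd_id z : cd id z 1.
Proof.
move=> e e0; exists 1 => // h _.
have -> : z + h - z - 1 * h = 0 by ring.
by rewrite cm0 mulr_ge0 ?cm_ge0 ?ltW.
Qed.

Lemma cd_ext F G z l (d : R) : 0 < d ->
  (forall w, cm (w - z) < d -> F w = G w) -> cd F z l -> cd G z l.
Proof.
move=> d0 FG cF e /cF[d' d'0 H]; exists (Num.min d d'); rewrite ?lt_min ?d0//.
move=> h; rewrite lt_min => /andP[w1 w2].
by rewrite -!FG ?subrr ?cm0// ?[_ + h]addrC ?addrK // addrC; apply: H.
Qed.

Lemma cdD F G z l m : cd F z l -> cd G z m -> cd (fun w => F w + G w) z (l + m).
Proof.
move=> cF cG e e0.
have e2 : 0 < e / 2 by lra.
have [d d0 H] := cF _ e2; have [d' d'0 H'] := cG _ e2.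
exists (Num.min d d'); rewrite ?lt_min ?d0// => h.
rewrite lt_min => /andP[w1 w2].
have -> : F (z + h) + G (z + h) - (F z + G z) - (l + m) * h =
  (F (z + h) - F z - l * h) + (G (z + h) - G z - m * h) by ring.
have := H _ w1; have := H' _ w2.
have := cmD (F (z + h) - F z - l * h) (G (z + h) - G z - m * h); lra.
Qed.

Lemma cdM F G z l m : cd F z l -> cd G z m ->
  cd (fun w => F w * G w) z (l * G z + F z * m).
Proof.
move=> cF cG e e0.
have e3 : 0 < e / 3 by lra.
have p1 : 0 < cm (G z) + 1 by have := cm_ge0 (G z); lra.
have p2 : 0 < cm (F z) + 1 by have := cm_ge0 (F z); lra.
have p3 : 0 < cm l + 1 by have := cm_ge0 l; lra.
have [d0 d00 H0] := cont_local (cd_cont cG).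
have [d d1 H] := cF (e / 3 / (cm (G z) + 1)) ltac:(by rewrite !divr_gt0).
have [d' d'0 H'] := cG (e / 3 / (cm (F z) + 1)) ltac:(by rewrite !divr_gt0).
have [d2 d20 H2] := cd_cont cG (divr_gt0 e3 p3).
exists (Num.min (Num.min d0 d2) (Num.min d d')).
  by rewrite !lt_min ?d00 ?d1 ?d20.
move=> h; rewrite !lt_min => /andP[/andP[w0 w3] /andP[w1 w2]].
have -> : F (z + h) * G (z + h) - F z * G z - (l * G z + F z * m) * h =
  (F (z + h) - F z - l * h) * G (z + h) + (l * h * (G (z + h) - G z) +
   F z * (G (z + h) - G z - m * h)) by ring.
have h1 := H _ w1; have h2 := H' _ w2.
have h3 := H2 (z + h); rewrite [z + h]addrC addrK in h3; have {}h3 := h3 w3.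
have h0 := H0 (z + h); rewrite [z + h]addrC addrK in h0; have {}h0 := h0 w0.
have c0 := cm_ge0 h.
rewrite [z + h]addrC in h1 h2 *.
rewrite (le_trans (cmD _ _))// (le_trans (lerD (lexx _) (cmD _ _)))// !cmM.
set A := cm (F _ - _ - _) in h1 *; set B := cm (G _ - _ - _) in h2 *.
set D := cm (G _ - G z) in h3 *.
have g0 := cm_ge0 (G (h + z)).
have A0 : 0 <= A by exact: cm_ge0.
have B0 : 0 <= B by exact: cm_ge0.
have D0 : 0 <= D by exact: cm_ge0.
have a1 : A * cm (G (h + z)) <= e / 3 * cm h.
  apply: (@le_trans _ _ (A * (cm (G z) + 1))); first by rewrite ler_wpM2l.
  rewrite -ler_pdivlMr// (le_trans h1)// mulrAC; lra.
have a2 : cm (F z) * B <= e / 3 * cm h.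
  apply: (@le_trans _ _ ((cm (F z) + 1) * B)); first by rewrite ler_wpM2r// lerDl.
  rewrite mulrC -ler_pdivlMr// (le_trans h2)// mulrAC; lra.
have a3 : cm l * cm h * D <= e / 3 * cm h.
  rewrite mulrAC ler_wpM2r//.
  apply: (@le_trans _ _ ((cm l + 1) * D)); first by rewrite ler_wpM2r// lerDl.
  by rewrite mulrC -ler_pdivlMr// ltW.
lra.
Qed.

Lemma cdZ F z l (c : C) : cd F z l -> cd (fun w => c * F w) z (c * l).
Proof.
move=> cF; have := cdM (cd_cst c z) cF; by rewrite mul0r add0r.
Qed.

Lemma cdN F z l : cd F z l -> cd (fun w => - F w) z (- l).
Proof.
move=> /(cdZ (-1)); rewrite mulN1r; apply: (@cd_ext _ _ _ _ 1) => // w _.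
by rewrite mulN1r.
Qed.

Lemma cdB F G z l m : cd F z l -> cd G z m -> cd (fun w => F w - G w) z (l - m).
Proof. by move=> cF /cdN; exact: cdD. Qed.

Lemma cd_comp F G z l m : cd G z m -> cd F (G z) l -> cd (fun w => F (G w)) z (l * m).
Proof.
move=> cG cF e e0.
have p : 0 < cm m + 1 by have := cm_ge0 m; lra.
have pl : 0 < cm l + 1 by have := cm_ge0 l; lra.
have [d d0 H] := cF (e / 2 / (cm m + 1)) ltac:(by rewrite !divr_gt0).
have [d1 d10 H1] := cG (Num.min 1 (e / 2 / (cm l + 1)))
  ltac:(by rewrite lt_min ltr01 !divr_gt0).
have [d2 d20 H2] := cd_cont cG d0.
exists (Num.min d1 d2); first by rewrite lt_min d10.
move=> h; rewrite lt_min => /andP[w1 w2].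
set k := G (z + h) - G z.
have ck : cm k < d by apply: H2; have -> : z + h - z = h by ring.
have hk := H _ ck; have -> : G (z + h) = G z + k by rewrite /k; ring.
have -> : F (G z + k) - F (G z) - l * m * h =
  (F (G z + k) - F (G z) - l * k) + l * (k - m * h) by ring.
have := H1 _ w1; rewrite -/k => h1.
have c0 := cm_ge0 h.
have h11 : cm (k - m * h) <= cm h.
  by rewrite (le_trans h1)// -[leRHS]mul1r ler_wpM2r// ge_min lexx.
have h12 : cm (k - m * h) <= e / 2 / (cm l + 1) * cm h.
  by rewrite (le_trans h1)// ler_wpM2r// ge_min lexx orbT.
have k1 : cm k <= (cm m + 1) * cm h.
  have := cmD (k - m * h) (m * h); rewrite subrK cmM; lra.
rewrite (le_trans (cmD _ _))// cmM.
have a1 : cm (F (G z + k) - F (G z) - l * k) <= e / 2 * cm h.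
  apply: (le_trans hk); apply: (le_trans (ler_wpM2l _ k1)).
  - by rewrite !divr_ge0 ?ltW.
  - by rewrite mulrA divfK ?gt_eqF.
have a2 : cm l * cm (k - m * h) <= e / 2 * cm h.
  apply: (@le_trans _ _ ((cm l + 1) * cm (k - m * h))).
    by rewrite ler_wpM2r ?cm_ge0// lerDl.
  by rewrite mulrC -ler_pdivlMr// (le_trans h12)// mulrAC.
lra.
Qed.

Lemma cd_quad F z l (B d : R) : 0 < d -> 0 <= B ->
  (forall h, cm h < d -> cm (F (z + h) - F z - l * h) <= B * cm h ^+ 2) ->
  cd F z l.
Proof.
move=> d0 B0 H e e0; exists (Num.min d (e / (B + 1))).
  by rewrite lt_min d0 divr_gt0// ltr_wpDl.
move=> h; rewrite lt_min => /andP[/H h1 h2].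
rewrite (le_trans h1)// expr2 mulrA ler_wpM2r ?cm_ge0//.
rewrite ltr_pdivlMr ?ltr_wpDl// in h2.
have := cm_ge0 h; nra.
Qed.

Lemma cd_inv z : z != 0 -> cd (fun w => w^-1) z (- (z^-1) ^+ 2).
Proof.
move=> z0; have cz : 0 < cm z by rewrite cm_gt0.
apply: (@cd_quad _ _ _ (2 / cm z ^+ 3) (cm z / 2)).
- by rewrite divr_gt0.
- by rewrite divr_ge0 ?exprn_ge0 ?ltW.
move=> h h1.
have cw : cm z / 2 <= cm (z + h).
  by have := cm_ge_dist z (- h); rewrite cmN opprK; lra.
have cw0 : 0 < cm (z + h) by lra.
have w0 : z + h != 0 by rewrite -cm_gt0.
have -> : (z + h)^-1 - z^-1 - - z^-1 ^+ 2 * h = h ^+ 2 * ((z + h)^-1 * z^-1 ^+ 2).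
  by field; rewrite w0 z0.
rewrite expr2 !cmM !(cmX, cmV) mulrC ler_wpM2r ?mulr_ge0 ?cm_ge0//.
rewrite ler_pdivlMr ?exprn_gt0// mulrC.
have -> : cm z ^+ 3 * ((cm (z + h))^-1 * ((cm z)^-1 / cm z)) = cm z / cm (z + h).
  by field; rewrite !gt_eqF.
rewrite ler_pdivrMr//; lra.
Qed.

Lemma cdV F z l : F z != 0 -> cd F z l -> cd (fun w => (F w)^-1) z (- l / F z ^+ 2).
Proof.
move=> F0 cF; have := cd_comp cF (cd_inv F0).
by have -> : - (F z)^-1 ^+ 2 * l = - l / F z ^+ 2 by rewrite exprVn mulNr mulNr mulrC.
Qed.

Lemma cdX F z l n : cd F z l -> cd (fun w => F w ^+ n) z (n%:R * F z ^+ n.-1 * l).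
Proof.
move=> cF; elim: n => [|n IH].
  by rewrite !mul0r; apply: (@cd_ext (fun=> 1) _ _ _ 1) => //; exact: cd_cst.
have := cdM cF IH.
have -> : l * F z ^+ n + F z * (n%:R * F z ^+ n.-1 * l) = n.+1%:R * F z ^+ n.+1.-1 * l.
  case: n {IH} => [|n] /=; first by rewrite !expr0; ring.
  by rewrite -[n.+2]addn1 natrD exprS; ring.
by apply: (@cd_ext _ _ _ _ 1) => // w _; rewrite exprS.
Qed.

Lemma gd_ext u v z l (d : R) : 0 < d ->
  (forall w, cm (w - z) < d -> u w = v w) -> gd u z l -> gd v z l.
Proof.
move=> d0 FG cF e /cF[d' d'0 H]; exists (Num.min d d'); rewrite ?lt_min ?d0//.
move=> h; rewrite lt_min => /andP[w1 w2].
by rewrite -!FG ?subrr ?cm0// ?[_ + h]addrC ?addrK // addrC; apply: H.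
Qed.

Lemma cd_gdRe F z l : cd F z l -> gd (fun w => Re (F w)) z l.
Proof.
move=> cF e /cF[d d0 H]; exists d => // h /H; apply: le_trans.
by rewrite -!cReB; exact: Re_le_cm.
Qed.

Lemma cd_gdIm F z l : cd F z l -> gd (fun w => Im (F w)) z (- iC * l).
Proof.
move=> /(cdZ (- iC))/cd_gdRe; apply: (@gd_ext _ _ _ _ 1) => // w _.
by rewrite !cE /=; ring.
Qed.

(** These are the Cauchy-Riemann equations in gradient form: the conjugate gradient of the imaginary
    part is [- iC] times that of the real part. *)
Lemma gd_cd F z l : gd (fun w => Re (F w)) z l ->
  gd (fun w => Im (F w)) z (- iC * l) -> cd F z l.
Proof.
move=> c1 c2 e e0; have e2 : 0 < e / 2 by lra.
have [d d0 H] := c1 _ e2; have [d' d'0 H'] := c2 _ e2.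
exists (Num.min d d'); rewrite ?lt_min ?d0// => h.
rewrite lt_min => /andP[/H w1 /H' w2].
apply: (le_trans (cm_le_ReIm _)); rewrite !cReB !cImB.
have E : Re (- iC * l * h) = Im (l * h) by rewrite !cE /=; ring.
rewrite E in w2; lra.
Qed.

Lemma gdD u v z l m : gd u z l -> gd v z m -> gd (fun w => u w + v w) z (l + m).
Proof.
move=> cF cG e e0.
have e2 : 0 < e / 2 by lra.
have [d d0 H] := cF _ e2; have [d' d'0 H'] := cG _ e2.
exists (Num.min d d'); rewrite ?lt_min ?d0// => h.
rewrite lt_min => /andP[/H w1 /H' w2].
have -> : u (z + h) + v (z + h) - (u z + v z) - Re ((l + m) * h) =
  (u (z + h) - u z - Re (l * h)) + (v (z + h) - v z - Re (m * h)).
  by rewrite mulrDl cReD; ring.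
have := ler_normD (u (z + h) - u z - Re (l * h)) (v (z + h) - v z - Re (m * h)).
lra.
Qed.

Lemma gdZ u z l (c : R) : gd u z l -> gd (fun w => c * u w) z (c%:C * l).
Proof.
move=> cF e e0.
have p : 0 < `|c| + 1 by have := normr_ge0 c; lra.
have [d d0 H] := cF (e / (`|c| + 1)) ltac:(by rewrite divr_gt0).
exists d => // h /H h1.
have -> : c * u (z + h) - c * u z - Re (c%:C * l * h) =
  c * (u (z + h) - u z - Re (l * h)) by rewrite !cE /=; ring.
rewrite normrM; apply: (@le_trans _ _ ((`|c| + 1) * `|u (z + h) - u z - Re (l * h)|)).
  by rewrite ler_wpM2r// lerDl.
by rewrite mulrC -ler_pdivlMr// (le_trans h1)// mulrAC.
Qed.

Lemma gdB u v z l m : gd u z l -> gd v z m -> gd (fun w => u w - v w) z (l - m).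
Proof.
move=> cF /(gdZ (-1)) cG.
have := gdD cF cG; have -> : l + (-1)%:C * m = l - m.
  by rewrite cRN mulNr mul1r.
by apply: (@gd_ext _ _ _ _ 1) => // w _; rewrite mulN1r.
Qed.

(** With the conjugate of the gradient, the chain rule along a holomorphic map is plain
    multiplication. This is the conformal transport between the curve and the axis. *)
Lemma gd_comp u G z l m : cd G z m -> gd u (G z) l -> gd (fun w => u (G w)) z (l * m).
Proof.
move=> cG cF e e0.
have p : 0 < cm m + 1 by have := cm_ge0 m; lra.
have pl : 0 < cm l + 1 by have := cm_ge0 l; lra.
have [d d0 H] := cF (e / 2 / (cm m + 1)) ltac:(by rewrite !divr_gt0).
have [d1 d10 H1] := cG (Num.min 1 (e / 2 / (cm l + 1)))
  ltac:(by rewrite lt_min ltr01 !divr_gt0).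
have [d2 d20 H2] := cd_cont cG d0.
exists (Num.min d1 d2); first by rewrite lt_min d10.
move=> h; rewrite lt_min => /andP[w1 w2].
set k := G (z + h) - G z.
have ck : cm k < d by apply: H2; have -> : z + h - z = h by ring.
have hk := H _ ck; have -> : G (z + h) = G z + k by rewrite /k; ring.
have -> : u (G z + k) - u (G z) - Re (l * m * h) =
  (u (G z + k) - u (G z) - Re (l * k)) + Re (l * (k - m * h)).
  by rewrite !cE; ring.
have := H1 _ w1; rewrite -/k => h1.
have c0 := cm_ge0 h.
have h11 : cm (k - m * h) <= cm h.
  by rewrite (le_trans h1)// -[leRHS]mul1r ler_wpM2r// ge_min lexx.
have h12 : cm (k - m * h) <= e / 2 / (cm l + 1) * cm h.
  by rewrite (le_trans h1)// ler_wpM2r// ge_min lexx orbT.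
have k1 : cm k <= (cm m + 1) * cm h.
  have := cmD (k - m * h) (m * h); rewrite subrK cmM; lra.
rewrite (le_trans (ler_normD _ _))//.
have a1 : `|u (G z + k) - u (G z) - Re (l * k)| <= e / 2 * cm h.
  apply: (le_trans hk); apply: (le_trans (ler_wpM2l _ k1)).
  - by rewrite !divr_ge0 ?ltW.
  - by rewrite mulrA divfK ?gt_eqF.
have a2 : `|Re (l * (k - m * h))| <= e / 2 * cm h.
  apply: (le_trans (Re_le_cm _)); rewrite cmM.
  apply: (@le_trans _ _ ((cm l + 1) * cm (k - m * h))).
    by rewrite ler_wpM2r ?cm_ge0// lerDl.
  by rewrite mulrC -ler_pdivlMr// (le_trans h12)// mulrAC.
lra.
Qed.

Lemma gd_conj u z l : gd u (cj z) l -> gd (fun w => u (cj w)) z (cj l).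
Proof.
move=> cu e /cu[d d0 H]; exists d => // h hd.
have := H (cj h); rewrite cmJ => /(_ hd); rewrite cJD.
have -> : Re (cj l * h) = Re (l * cj h) by rewrite !cE; ring.
by [].
Qed.

Lemma cd_conj F z l : cd F (cj z) l -> cd (fun w => cj (F (cj w))) z (cj l).
Proof.
move=> cu e /cu[d d0 H]; exists d => // h hd.
have := H (cj h); rewrite cmJ => /(_ hd).
by rewrite -cmJ !(cJD, cJN, cJM) cJK.
Qed.

Lemma gd_local u z l : gd u z l -> exists2 d : R, 0 < d &
  forall h, cm h < d -> `|u (z + h) - u z| <= (cm l + 1) * cm h.
Proof.
move=> /(_ _ ltr01)[d d0 H]; exists d => // h /H h1.
have := ler_normD (u (z + h) - u z - Re (l * h)) (Re (l * h)); rewrite subrK.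
have := Re_le_cm (l * h); rewrite cmM; lra.
Qed.

Lemma is_derive_eps (f : R -> R) (x l : R) :
  (forall e : R, 0 < e -> exists2 d : R, 0 < d & forall h : R, `|h| < d ->
     `|f (x + h) - f x - l * h| <= e * `|h|) -> is_derive x 1 f l.
Proof.
move=> H.
have C0 : h^-1 *: (f (h *: 1 + x) - f x) @[h --> 0^'] --> l.
  apply/cvgrPdist_le => e e0; have [d d0 Hd] := H _ e0.
  exists d => //= h /=; rewrite sub0r normrN => hd h0.
  have := Hd _ hd; rewrite -[_ *: 1]/(h * 1) mulr1 [h + x]addrC => h1.
  rewrite -[_ *: _]/(_ * _).
  have -> : l - h^-1 * (f (x + h) - f x) = - (h^-1 * (f (x + h) - f x - l * h)).
    by field.
  rewrite normrN normrM normfV mulrC ler_pdivrMr ?normr_gt0//.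
split.
  by apply/cvg_ex; exists l.
exact/cvg_lim.
Qed.

Lemma gd_line u z (v : C) l (s : R) : gd u (z + s%:C * v) l ->
  is_derive s 1 (fun t : R => u (z + t%:C * v)) (Re (l * v)).
Proof.
move=> cu; apply: is_derive_eps => e e0.
have p : 0 < cm v + 1 by have := cm_ge0 v; lra.
have [d d0 H] := cu (e / (cm v + 1)) ltac:(by rewrite divr_gt0).
exists (d / (cm v + 1)); first by rewrite divr_gt0.
move=> h hd; rewrite ltr_pdivlMr // in hd.
have hv : cm (h%:C * v) <= `|h| * (cm v + 1).
  by rewrite cmM cmR ler_wpM2l// lerDl.
have := H (h%:C * v) (le_lt_trans hv hd).
have -> : z + s%:C * v + h%:C * v = z + (s + h)%:C * v by rewrite cRD; ring.
have -> : Re (l * (h%:C * v)) = Re (l * v) * h by rewrite !cE /=; ring.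
move=> /le_trans; apply.
by rewrite -mulrA ler_pM2l// ler_pdivrMl// [leRHS]mulrC.
Qed.

Lemma derive_continuous (f : R -> R) (x l : R) :
  is_derive x 1 f l -> {for x, continuous f}.
Proof.
move=> [d _]; apply: differentiable_continuous.
exact/derivable1_diffP.
Qed.

Lemma cvg_within_all (f : R -> R) (A : set R) :
  (forall x, A x -> {for x, continuous f}) -> {within A, continuous f}.
Proof.
move=> H; apply/subspace_continuousP => x Ax.
by rewrite /from_subspace /=; apply: cvg_within_filter; exact: H.
Qed.

Lemma mvt_gd_ex u (D : C -> C) z w :
  (forall s : R, 0 <= s <= 1 -> gd u (z + s%:C * (w - z)) (D (z + s%:C * (w - z)))) ->
  exists2 s : R, 0 < s < 1 & u w - u z = Re (D (z + s%:C * (w - z)) * (w - z)).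
Proof.
move=> H.
pose f := fun s : R => u (z + s%:C * (w - z)).
have df (s : R) : 0 <= s <= 1 -> is_derive s 1 f (Re (D (z + s%:C * (w - z)) * (w - z))).
  by move=> s01; apply: gd_line; exact: H.
have [|||s sI E] := @MVT R f (fun s => Re (D (z + s%:C * (w - z)) * (w - z))) 0 1.
- by [].
- move=> x; rewrite in_itv /= => /andP[x0 x1]; apply: df; lra.
- by apply: cvg_within_all => x; rewrite /= in_itv /= => x01; apply: derive_continuous (df _ x01).
exists s; first by rewrite in_itv in sI.
move: E; rewrite /f subr0 mulr1 => <-.
have -> : z + 1%:C * (w - z) = w by rewrite mul1r addrC subrK.
by rewrite mul0r addr0.
Qed.

Lemma mvt_gd u (D : C -> C) z w (M : R) :
  (forall s : R, 0 <= s <= 1 -> gd u (z + s%:C * (w - z)) (D (z + s%:C * (w - z)))) ->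
  (forall s : R, 0 <= s <= 1 -> cm (D (z + s%:C * (w - z))) <= M) ->
  `|u w - u z| <= M * cm (w - z).
Proof.
move=> H HM; have [s s01 ->] := mvt_gd_ex H.
rewrite (le_trans (Re_le_cm _))// cmM ler_wpM2r ?cm_ge0// HM//; lra.
Qed.

(** Complex functions have no intermediate point in the mean value theorem; the real theorem is
    applied to [Re (v * F)] for every rotation [v], and [cm_le_rot] recovers the modulus. *)
Lemma mvt_cd F (D : C -> C) z w (M : R) :
  (forall s : R, 0 <= s <= 1 -> cd F (z + s%:C * (w - z)) (D (z + s%:C * (w - z)))) ->
  (forall s : R, 0 <= s <= 1 -> cm (D (z + s%:C * (w - z))) <= M) ->
  cm (F w - F z) <= M * cm (w - z).
Proof.
move=> H HM.
have M0 : 0 <= M by apply: le_trans (cm_ge0 _) (HM 0 _); lra.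
apply: cm_le_rot => [|v]; first by rewrite mulr_ge0 ?cm_ge0.
apply: (le_trans (ler_norm _)); rewrite mulrBr cReB mulrA.
apply: (@mvt_gd (fun x => Re (v * F x)) (fun x => v * D x)).
- by move=> s s01; apply: cd_gdRe; apply: cdZ; exact: H.
- by move=> s s01; rewrite cmM ler_wpM2l ?cm_ge0// HM.
Qed.
End Deriv.

(** * Integrals over an interval *)

Section RealIntegral.
Context {R : realType}.
Local Notation mu := (@lebesgue_measure R).
Implicit Types (a b c : R) (f g : R -> R).

Definition rI a b f : R := \int[mu]_(t in `[a, b]) f t.
Definition itg a b f := mu.-integrable `[a, b] (EFin \o f).

Lemma itg_within a b f : {within `[a, b], continuous f} -> itg a b f.
Proof. by move=> cf; apply: continuous_compact_integrable => //; exact: segment_compact. Qed.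

Lemma itg_cont a b f :
  (forall t, a <= t <= b -> {for t, continuous f}) -> itg a b f.
Proof.
move=> cf; apply: itg_within; apply: cvg_within_all => x /=.
by rewrite in_itv /=; exact: cf.
Qed.

Lemma itg_cst a b (k : R) : itg a b (fun=> k).
Proof. by apply: itg_cont => t _; exact: cst_continuous. Qed.

Lemma itgD a b f g : itg a b f -> itg a b g -> itg a b (fun t => f t + g t).
Proof.
move=> hf hg; rewrite /itg (_ : _ \o _ = (EFin \o f) \+ (EFin \o g))%E; last by apply/funext.
exact: integrableD.
Qed.

Lemma itgZ a b f (k : R) : itg a b f -> itg a b (fun t => k * f t).
Proof.
move=> hf; rewrite /itg (_ : _ \o _ = (fun t => k%:E * (EFin \o f) t))%E; last by apply/funext.
exact: integrableZl.
Qed.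

Lemma itgN a b f : itg a b f -> itg a b (fun t => - f t).
Proof.
move=> /(itgZ (-1)); congr (itg _ _ _).
by apply/funext => t; rewrite mulN1r.
Qed.

Lemma itgB a b f g : itg a b f -> itg a b g -> itg a b (fun t => f t - g t).
Proof. by move=> hf /itgN; exact: itgD. Qed.

Lemma itg_abs a b f : itg a b f -> itg a b (fun t => `|f t|).
Proof. by move=> hf; exact: integrable_norm. Qed.

Lemma rI_ext a b f g : (forall t, a <= t <= b -> f t = g t) -> rI a b f = rI a b g.
Proof.
move=> fg; apply: eq_Rintegral => t; rewrite inE /= in_itv /=; exact: fg.
Qed.

Lemma rID a b f g : itg a b f -> itg a b g ->
  rI a b (fun t => f t + g t) = rI a b f + rI a b g.
Proof. by move=> hf hg; rewrite /rI RintegralD. Qed.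

Lemma rIB a b f g : itg a b f -> itg a b g ->
  rI a b (fun t => f t - g t) = rI a b f - rI a b g.
Proof. by move=> hf hg; rewrite /rI RintegralB. Qed.

Lemma rIZ a b f k : itg a b f -> rI a b (fun t => k * f t) = k * rI a b f.
Proof. by move=> hf; rewrite /rI RintegralZl. Qed.

Lemma rI_le a b f g : itg a b f -> itg a b g ->
  (forall t, a <= t <= b -> f t <= g t) -> rI a b f <= rI a b g.
Proof. by move=> hf hg fg; apply: le_Rintegral => // t /=; rewrite in_itv /=; exact: fg. Qed.

Lemma rI_abs a b f : itg a b f -> `|rI a b f| <= rI a b (fun t => `|f t|).
Proof. by move=> hf; apply: le_normr_Rintegral. Qed.

Lemma rI_cst a b k : a <= b -> rI a b (fun=> k) = k * (b - a).
Proof.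
move=> ab; rewrite /rI Rintegral_cst//.
congr (k * _); have -> : b - a = fine (b - a)%:E by [].
congr fine; apply: etrans (lebesgue_measure_itv `[a, b]) _.
rewrite /= lte_fin; case: ifPn => //; rewrite -leNgt => ba.
by rewrite (@le_anti _ _ a b) ?ab// subrr.
Qed.

Lemma rI_split a c b f : a <= c -> c <= b -> itg a b f ->
  rI a b f = rI a c f + rI c b f.
Proof.
move=> ac cb hf.
have := @Rintegral_itvB _ f (BLeft a) (BRight b) c hf.
rewrite !bnd_simp => /(_ ac cb).
rewrite (@Rintegral_itv_obnd_cbnd R c (BRight b) f).
  by rewrite /rI => <-; ring.
apply: integrableS hf => //.
apply: (@subset_itv _ R); rewrite bnd_simp//.
Qed.

Lemma FTC a b (F f : R -> R) : a < b ->
  (forall t, a <= t <= b -> is_derive t 1 F (f t)) ->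
  (forall t, a <= t <= b -> {for t, continuous f}) -> rI a b f = F b - F a.
Proof.
move=> ab dF cf.
have cF t : a <= t <= b -> {for t, continuous F}.
  by move=> tab; apply: derive_continuous (dF _ tab).
have h := @continuous_FTC2 R f F a b ab.
rewrite /rI /Rintegral h //.
- by apply: cvg_within_all => t /=; rewrite in_itv /=; exact: cf.
- split.
  + move=> t; rewrite in_itv /= => /andP[t1 t2].
    by case: (dF t _) => //; rewrite !ltW.
  + by apply: cvg_at_right_filter; apply: cF; rewrite lexx ltW.
  + by apply: cvg_at_left_filter; apply: cF; rewrite lexx ltW.
- move=> t; rewrite in_itv /= => /andP[t1 t2].
  rewrite derive1E.
  by case: (dF t _) => //; rewrite !ltW.
Qed.

Lemma FTC1 a b f x : a < x -> x < b ->
  (forall t, a <= t <= b -> {for t, continuous f}) ->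
  is_derive x 1 (fun y => rI a y f) (f x).
Proof.
move=> ax xb cf.
have [||d e] := @continuous_FTC1_closed R f a x b xb (itg_cont cf).
- by [].
- by apply: cf; rewrite !ltW.
split; first exact: d.
by rewrite -derive1E.
Qed.

Lemma FTC_pt a f : rI a a f = 0.
Proof. by rewrite /rI set_itv1 Rintegral_set1. Qed.

Lemma derive_cst_eq a b (F : R -> R) : a <= b ->
  (forall t, a <= t <= b -> is_derive t 1 F 0) -> F b = F a.
Proof.
move=> ab dF.
have cF : {within `[a, b], continuous F}.
  apply: cvg_within_all => t /=; rewrite in_itv /= => tab.
  exact: derive_continuous (dF _ tab).
have [||] := @MVT_segment R F (fun=> 0) a b ab.
- move=> x; rewrite in_itv /= => /andP[t1 t2]; apply: dF; rewrite !ltW//.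
- exact: cF.
- by move=> c _; rewrite mul0r => /eqP; rewrite subr_eq0 => /eqP.
Qed.

Lemma derive_under_rI a b (f f' : R -> R -> R) (u v x M : R) : u < x < v -> 0 <= M ->
  (forall y, u < y < v -> itg a b (f y)) ->
  (forall y t, u < y < v -> a <= t <= b -> is_derive y 1 (f ^~ t) (f' y t)) ->
  (forall y t, u < y < v -> a <= t <= b -> `|f' y t| <= M) ->
  is_derive x 1 (fun y => rI a b (f y)) (rI a b (f' x)).
Proof.
move=> uxv M0 hf df bf.
have Ix : `]u, v[%classic x by rewrite /= in_itv.
have h1 y : `]u, v[%classic y -> mu.-integrable `[a, b] (EFin \o f y).
  by rewrite /= in_itv => /hf.
have h2 y t : `]u, v[%classic y -> `[a, b]%classic t -> derivable (f ^~ t) y 1.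
  by rewrite /= !in_itv => yI tI; case: (df y t yI tI).
have h3 y t : `]u, v[%classic y -> `[a, b]%classic t -> partial1of2 f y t = f' y t.
  rewrite /= !in_itv => yI tI; rewrite partial1of2E.
  by case: (df y t yI tI).
have h4 y t : `]u, v[%classic y -> `[a, b]%classic t -> `|partial1of2 f y t| <= M.
  move=> yI tI; rewrite h3//.
  by move: yI tI; rewrite /= !in_itv; exact: bf.
have d1 := @derivable_under_integral R _ _ mu f _ (measurable_itv `[a, b]) x u v Ix
  h1 h2 (fun=> M) (fun=> M0) (itg_cst a b M) h4.
have d2 := @differentiation_under_integral R _ _ mu f _ (measurable_itv `[a, b]) x u v Ix
  h1 h2 (fun=> M) (fun=> M0) (itg_cst a b M) h4.
split; first exact: d1.
rewrite -derive1E; apply: etrans d2 _.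
by apply: eq_Rintegral => t; rewrite inE => tI; rewrite h3.
Qed.
End RealIntegral.

(** * Dominated convergence and integrability of the logarithm *)

Section Singular.
Context {R : realType}.
Local Notation mu := (@lebesgue_measure R).
Implicit Types (a b c : R) (f g : R -> R).

Lemma ae_neq (x : R) (P : R -> Prop) : (forall t, t != x -> P t) -> {ae mu, forall t, P t}.
Proof.
move=> H; exists [set x]; split => //.
- exact: lebesgue_measure_set1.
- move=> t /= nP; apply/eqP; apply/negPn/negP => tx; apply: nP; exact: H.
Qed.

Lemma rI_dominated a b (fn : nat -> R -> R) f (k : R -> R) (x : R) :
  (forall n, itg a b (fn n)) -> measurable_fun `[a, b]%classic f -> itg a b k ->
  (forall t, a <= t <= b -> t != x -> (fn ^~ t) @ \oo --> f t) ->
  (forall n t, a <= t <= b -> t != x -> `|fn n t| <= k t) ->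
  itg a b f /\ (fun n => rI a b (fn n)) @ \oo --> rI a b f.
Proof.
move=> ifn mf ik cf bf.
have [|||||i1 _ i2] := @dominated_convergence _ _ _ mu `[a, b]%classic (measurable_itv _)
  (fun n t => (fn n t)%:E) (EFin \o f) (EFin \o k).
- by move=> n; have /integrableP[] := ifn n.
- exact/measurable_EFinP.
- apply: (@ae_neq x) => t tx /=; rewrite in_itv /= => tI.
  by apply: cvg_EFin; [exact: nearW|exact: cf].
- exact: ik.
- apply: (@ae_neq x) => t tx n /=; rewrite in_itv /= => tI.
  by rewrite lee_fin bf.
split; first exact: i1.
rewrite /rI /Rintegral; apply: fine_cvg.
rewrite fineK; first exact: i2.
by apply: integrable_fin_num => //; exact: i1.
Qed.

(* The truncations to [|x - t| >= e] exhaust the interval up to the null set [{x}]. *)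
Lemma itg_exhaust a b f (x C : R) : measurable_fun `[a, b]%classic f ->
  (forall t, a <= t <= b -> t != x -> 0 <= f t) ->
  (forall e : R, 0 < e <= 1 -> exists h : R -> R, [/\ itg a b h,
     forall t, a <= t <= b -> 0 <= h t,
     forall t, a <= t <= b -> e <= `|x - t| -> f t <= h t & rI a b h <= C]) ->
  itg a b f.
Proof.
move=> mf f0 H.
pose D := (`[a, b]%classic : set R).
pose F (n : nat) := D `&` [set t | n.+1%:R^-1 <= `|x - t|].
have mD : measurable D by exact: measurable_itv.
have mFn n : measurable (F n).
  have mfx : measurable_fun D (fun t => `|x - t|).
    apply: measurableT_comp; first exact: normr_measurable.
    by apply: measurable_funB => //; exact: measurable_cst.
  rewrite [F n](_ : _ = D `&` (fun t => `|x - t|) @^-1` `[n.+1%:R^-1, +oo[%classic).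
    by apply: mfx => //; exact: measurable_itv.
  by apply/seteqP; split => t [tD] /=; rewrite in_itv /= andbT.
have uF : \bigcup_n F n = D `\ x.
  apply/seteqP; split => [t [n _ [/= tD tn]]|t [/= tD /eqP tx]].
    split => // /= E; move: tn; rewrite E subrr normr0 leNgt invr_gt0 ltr0n//.
  have xt : 0 < `|x - t| by rewrite normr_gt0 subr_eq0 eq_sym.
  exists (Num.bound (`|x - t|^-1)) => //; split => //=.
  rewrite -[leRHS]invrK lef_pV2 ?posrE ?invr_gt0 ?ltr0n//.
  have := archi_boundP (ltW (eq_ind_r (fun z => 0 < z) xt erefl)).
  by move=> _; apply: ltW; apply: (lt_trans (archi_boundP _)); rewrite ?invr_ge0 ?ltr_nat.
have homF : {homo F : n m / (n <= m)%N >-> (n <= m)%O}.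
  move=> n m nm; apply/subsetPset => t [/= tD tn]; split => //=.
  apply: le_trans tn; rewrite lef_pV2 ?posrE ?ltr0n// ler_nat ltnS//.
have f0F n t : F n t -> (0 <= (f t)%:E)%E.
  move=> [/= tD tn]; rewrite lee_fin; apply: f0.
    by move: tD; rewrite /D /= in_itv.
  by apply: contraTneq tn => ->; rewrite subrr normr0 -ltNge invr_gt0 ltr0n.
have mfF n : measurable_fun (F n) (EFin \o f).
  apply/measurable_EFinP; apply: measurable_funS mf => //.
  by move=> t [].
have bF n : (\int[mu]_(t in F n) (f t)%:E <= C%:E)%E.
  have n1 : 0 < (n.+1%:R^-1 : R) <= 1.
    by apply/andP; split; [rewrite invr_gt0 ltr0n|rewrite -[leRHS]invr1 lef_pV2 ?posrE ?ltr0n// ler1n].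
  have [h [ih h0 fh hC]] := H _ n1.
  apply: (@le_trans _ _ (\int[mu]_(t in F n) (h t)%:E)%E).
    apply: ge0_le_integral => //.
    - exact: mFn.
    - exact: f0F.
    - exact: mfF.
    - have /integrableP[mh _] := ih; apply: measurable_funS mh => //.
      by move=> t [].
    - by move=> t [/= tD tn]; rewrite lee_fin fh//; move: tD; rewrite /D /= in_itv.
  apply: (@le_trans _ _ (\int[mu]_(t in D) (h t)%:E)%E).
    apply: ge0_subset_integral => //.
    - exact: mFn.
    - by have /integrableP[] := ih.
    - by move=> t [].
  have fin : (\int[mu]_(t in D) (h t)%:E)%E \is a fin_num.
    exact: integrable_fin_num.
  by rewrite -(fineK fin) lee_fin.
(* Monotone convergence along the increasing sets [F n] carries the uniform bound [C] over to the
   punctured interval. *)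
have cv := @ge0_nondecreasing_set_cvg_integral _ (measurableTypeR R) R F (EFin \o f) mu homF mFn mfF f0F.
rewrite uF in cv.
have bD : (\int[mu]_(t in D `\ x) (f t)%:E <= C%:E)%E.
  by apply: (cvge_le _ cv); apply: nearW => n; exact: bF.
have mDx : measurable (D `\ x) by apply: measurableD.
have mfD : measurable_fun (D `\ x) (EFin \o f).
  apply/measurable_EFinP; apply: measurable_funS mf => //.
apply/(@negligible_integrable _ _ _ mu D [set x]) => //.
- exact/measurable_EFinP.
- exact: lebesgue_measure_set1.
apply/integrableP; split => //.
apply: le_lt_trans (ltry C); apply: le_trans bD.
rewrite le_eqVlt; apply/orP; left; apply/eqP; apply: eq_integral => t.
rewrite inE => -[/= tD /eqP tx]; rewrite ger0_norm// f0//.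
Qed.

Lemma is_derive_shift_sqr (x e t : R) :
  is_derive t 1 (fun t => (x - t) ^+ 2 + e ^+ 2) (-2 * (x - t)).
Proof.
apply: is_derive_eps => k k0; exists k => // h hk.
have -> : (x - (t + h)) ^+ 2 + e ^+ 2 - ((x - t) ^+ 2 + e ^+ 2) - -2 * (x - t) * h = h * h.
  by ring.
by rewrite normrM ler_wpM2r// ltW.
Qed.

Lemma is_derive_sub (x t : R) : is_derive t 1 (fun t => x - t) (-1).
Proof.
apply: is_derive_eps => k k0; exists k => // h hk.
have -> : x - (t + h) - (x - t) - -1 * h = 0 by ring.
by rewrite normr0 mulr_ge0// ltW.
Qed.

(** The logarithm increases, so [e] may be dropped; then [ln u^-1 < u^-1] bounds [u * ln u^-1] by
    one. The bound is uniform in [e]. *)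
Lemma u_ln_bound (u e : R) : 0 <= u -> 0 < e -> - (u * ln (u ^+ 2 + e ^+ 2)) <= 2.
Proof.
move=> u0 e0; have [->|un0] := eqVneq u 0; first by rewrite mul0r oppr0.
have up : 0 < u by rewrite lt_def un0.
have l1 : ln (u ^+ 2) <= ln (u ^+ 2 + e ^+ 2).
  by rewrite ler_ln ?posrE ?lerDl ?sqr_ge0 ?addr_gt0 ?exprn_gt0.
have l2 : ln (u ^+ 2) = - (2 * ln (u^-1)).
  by rewrite lnXn// lnV ?posrE// mulrN opprK mulr_natl.
have l3 : ln u^-1 < u^-1 by apply: ln_sublinear; rewrite invr_gt0.
have l4 : u * ln u^-1 <= 1.
  by rewrite -(mulfV un0) ler_wpM2l// ltW.
have : u * ln (u ^+ 2) <= u * ln (u ^+ 2 + e ^+ 2) by rewrite ler_wpM2l.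
rewrite l2; lra.
Qed.

Lemma continuous_ln_comp (f : R -> R) (t : R) : 0 < f t -> {for t, continuous f} ->
  {for t, continuous (fun s => ln (f s))}.
Proof. by move=> f0 cf; apply: (@continuous_comp _ _ _ f (@ln R)) => //; exact: continuous_ln. Qed.

(** The function [F] is a primitive of minus the logarithm up to the term [2 * r], and [r] lies
    below one, so no arctangent has to be integrated. The constant ten is [4 * 2] plus half of the
    two boundary terms, each at most two by [u_ln_bound]. *)
Lemma log_integral_bound (x e : R) : -1 <= x <= 1 -> 0 < e <= 1 ->
  rI (-1) 1 (fun t => 3 - 2^-1 * ln ((x - t) ^+ 2 + e ^+ 2)) <= 10.
Proof.
move=> xI /andP[e0 e1].
have p t : 0 < (x - t) ^+ 2 + e ^+ 2 by rewrite ltr_wpDl ?sqr_ge0// exprn_gt0.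
pose l t := ln ((x - t) ^+ 2 + e ^+ 2).
pose r t := (x - t) ^+ 2 / ((x - t) ^+ 2 + e ^+ 2).
pose F t := (x - t) * l t.
pose f t := - l t - 2 * r t.
have cl (t : R) : {for t, continuous l}.
  by apply: continuous_ln_comp => //; apply: derive_continuous; exact: is_derive_shift_sqr.
have cr (t : R) : {for t, continuous r}.
  have c1 : {for t, continuous (fun t => (x - t) ^+ 2 + e ^+ 2)}.
    by apply: derive_continuous; exact: is_derive_shift_sqr.
  have -> : r = (fun t => 1 + - e ^+ 2 * ((x - t) ^+ 2 + e ^+ 2)^-1).
    by apply/funext => s; rewrite /r; field; rewrite gt_eqF.
  apply: continuousD; first exact: cst_continuous.
  apply: continuousM; first exact: cst_continuous.
  by apply: continuousV => //; rewrite gt_eqF.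
have cf (t : R) : {for t, continuous f}.
  apply: continuousB; first by apply: continuousN; exact: cl.
  by apply: continuousM; [exact: cst_continuous|exact: cr].
have dF (t : R) : is_derive t 1 F (f t).
  have d1 := @is_derive1_comp _ (@ln R) (fun t => (x - t) ^+ 2 + e ^+ 2) _ _ _ (is_derive1_ln (p t)) (is_derive_shift_sqr x e t).
  have := is_deriveM (is_derive_sub x t) d1.
  congr is_derive; rewrite -![_ *: _]/(_ * _) /f /r /l /=; field.
  by rewrite gt_eqF.
have F2 : rI (-1) 1 f = F 1 - F (-1).
  by apply: FTC => //; lra.
have h1 : rI (-1) 1 (fun t => 3 - 2^-1 * l t) <= rI (-1) 1 (fun t => 4 + 2^-1 * f t).
  apply: rI_le.
  - by apply: itgB; [exact: itg_cst|apply: itgZ; apply: itg_cont => t _; exact: cl].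
  - by apply: itgD; [exact: itg_cst|apply: itgZ; apply: itg_cont => t _; exact: cf].
  - move=> t _; rewrite /f.
    have r1 : r t <= 1 by rewrite /r ler_pdivrMr// mul1r lerDl sqr_ge0.
    lra.
apply: (le_trans h1); rewrite rID; last 2 first.
- exact: itg_cst.
- by apply: itgZ; apply: itg_cont => t _; exact: cf.
rewrite rIZ; last by apply: itg_cont => t _; exact: cf.
rewrite rI_cst; last lra.
rewrite F2 /F /l.
have b1 : - ((1 - x) * ln ((1 - x) ^+ 2 + e ^+ 2)) <= 2 by apply: u_ln_bound => //; lra.
have b2 : - ((x + 1) * ln ((x + 1) ^+ 2 + e ^+ 2)) <= 2 by apply: u_ln_bound => //; lra.
rewrite opprK.
have -> : (x - 1) ^+ 2 = (1 - x) ^+ 2 by ring.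
lra.
Qed.

Lemma itg_ln_dist (x : R) : -1 <= x <= 1 -> itg (-1) 1 (fun t => ln `|x - t|).
Proof.
move=> xI.
have mln : measurable_fun (`[(-1), 1]%classic : set R) (fun t : R => ln `|x - t|).
  apply: measurableT_comp; first exact: measurable_ln.
  apply: measurableT_comp; first exact: normr_measurable.
  by apply: measurable_funB => //; exact: measurable_cst.
have : itg (-1) 1 (fun t => 2 - ln `|x - t|).
  apply: (@itg_exhaust _ _ _ x 10).
  - by apply: measurable_funB => //; exact: measurable_cst.
  - move=> t tI tx; have xt : 0 < `|x - t| by rewrite normr_gt0 subr_eq0 eq_sym.
    have := ln_sublinear xt.
    have : `|x - t| <= 2 by rewrite ler_norml; lra.
    lra.
  - move=> e eI; have /andP[e0 e1] := eI.
    have p t : 0 < (x - t) ^+ 2 + e ^+ 2 by rewrite ltr_wpDl ?sqr_ge0// exprn_gt0.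
    (* Where [e <= |x - t|], the sum of squares is at most [2 * (x - t) ^+ 2], so half its logarithm
       exceeds [ln |x - t|] by at most [ln 2 / 2 < 1]; this turns the two of the integrand into
       three. *)
    exists (fun t => 3 - 2^-1 * ln ((x - t) ^+ 2 + e ^+ 2)); split.
    + apply: itgB; first exact: itg_cst.
      apply: itgZ; apply: itg_cont => t _; apply: continuous_ln_comp => //.
      by apply: derive_continuous; exact: is_derive_shift_sqr.
    + move=> t tI; have := ln_sublinear (p t).
      have : (x - t) ^+ 2 <= 4.
        have -> : 4 = 2 ^+ 2 :> R by rewrite expr2; lra.
        rewrite -(real_normK (num_real (x - t))); apply: lerXn2r; rewrite ?nnegrE//.
        by rewrite ler_norml; lra.
      have : e ^+ 2 <= 1 by rewrite expr_le1// ltW.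
      lra.
    + move=> t tI et.
      have xt : 0 < `|x - t| by exact: lt_le_trans et.
      have E1 : 2 * ln `|x - t| = ln ((x - t) ^+ 2).
        by rewrite -(real_normK (num_real (x - t))) lnXn// mulr_natl.
      have s0 : 0 < (x - t) ^+ 2 by rewrite -(real_normK (num_real (x - t))) exprn_gt0.
      have E2 : ln ((x - t) ^+ 2 + e ^+ 2) <= ln (2 * (x - t) ^+ 2).
        rewrite ler_ln; [|by rewrite posrE; exact: p|by rewrite posrE mulr_gt0].
        rewrite mulr_natl mulr2n lerD2l.
        rewrite -[leRHS](real_normK (num_real (x - t))).
        by apply: lerXn2r; rewrite ?nnegrE// ltW.
      have E3 : ln (2 * (x - t) ^+ 2) = ln 2 + ln ((x - t) ^+ 2) by rewrite lnM ?posrE.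
      have E4 : ln 2 < 2 :> R by apply: ln_sublinear.
      lra.
    + exact: log_integral_bound.
move=> /(itgB (itg_cst (-1) 1 2)); congr (itg _ _ _).
by apply/funext => t; ring.
Qed.

(** This allows the integrand of [H_fun], which may take default values at the end points, to be
    exchanged for one that is measurable on the closed interval. *)
Lemma rI_eq_open a b f g : measurable_fun `[a, b]%classic f ->
  {in `]a, b[%R, f =1 g} -> \int[mu]_(t in `[a, b]) g t = rI a b f.
Proof.
move=> mf E; rewrite /rI /Rintegral; congr fine; apply: esym.
have sub : `]a, b[%classic `<=` `[a, b]%classic by exact: subset_itv_oo_cc.
have mf' := measurable_funS (measurable_itv _) sub mf.
apply: eq_integral_itv_bounded => //.
by apply: eq_measurable_fun mf' => t; rewrite inE => tI; apply: E.
Qed.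
End Singular.

Opaque rI itg.
Arguments rI : simpl never.
Arguments itg : simpl never.

Section ComplexIntegral.
Context {R : realType}.
Local Notation C := R[i].
Implicit Types (f g F : R -> C) (a b c : R).

Definition rcont f (t : R) := forall e : R, 0 < e -> exists2 d : R, 0 < d &
  forall s : R, `|s - t| < d -> cm (f s - f t) < e.

Definition rcont_on a b f := forall t : R, a <= t <= b -> rcont f t.

Definition rd F (t : R) (l : C) := forall e : R, 0 < e -> exists2 d : R, 0 < d &
  forall h : R, `|h| < d -> cm (F (t + h) - F t - l * h%:C) <= e * `|h|.

Lemma rcont_cts f (t : R) (p : C -> R) : rcont f t ->
  (forall z w, `|p z - p w| <= cm (z - w)) ->
  {for t, continuous (fun s => p (f s))}.
Proof.
move=> cf hp; apply/cvgrPdist_lt => e e0; have [d d0 H] := cf _ e0.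
exists d => //= s; rewrite /ball_ /= distrC => /H; apply: le_lt_trans.
by rewrite distrC hp.
Qed.

Lemma rcont_Re f t : rcont f t -> {for t, continuous (fun s => Re (f s))}.
Proof. by move=> cf; apply: rcont_cts => // z w; rewrite -cReB Re_le_cm. Qed.

Lemma rcont_Im f t : rcont f t -> {for t, continuous (fun s => Im (f s))}.
Proof. by move=> cf; apply: rcont_cts => // z w; rewrite -cImB Im_le_cm. Qed.

Lemma cts_rcont (f : R -> R) (t : R) : {for t, continuous f} -> rcont (fun s => (f s)%:C) t.
Proof.
move=> /cvgrPdist_lt cf e e0; have [d /= d0 H] := cf _ e0.
exists d; first by []. 
move=> s st; rewrite -cRN -cRD cmR distrC; apply: H => /=.
by rewrite distrC.
Qed.

Lemma rcont_comp (F : C -> C) f t : rcont f t -> ccont F (f t) -> rcont (fun s => F (f s)) t.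
Proof. by move=> cf cF e /cF[d /cf[d' d'0 H] H']; exists d' => // s /H /H'. Qed.

Lemma rcont_line (z v : C) (t : R) : rcont (fun s => z + s%:C * v) t.
Proof.
move=> e e0; have p : 0 < cm v + 1 by have := cm_ge0 v; lra.
exists (e / (cm v + 1)); first by rewrite divr_gt0.
move=> s; rewrite ltr_pdivlMr//; apply: le_lt_trans.
have -> : z + s%:C * v - (z + t%:C * v) = (s - t)%:C * v.
  by rewrite cRD cRN; ring.
by rewrite cmM cmR ler_wpM2l// lerDl.
Qed.

Lemma rcontM f g t : rcont f t -> rcont g t -> rcont (fun s => f s * g s) t.
Proof.
move=> cF cG e e0.
have [d0 d00 H0] := cG _ ltr01.
have p1 : 0 < cm (g t) + 1 by have := cm_ge0 (g t); lra.
have p2 : 0 < cm (f t) + 1 by have := cm_ge0 (f t); lra.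
have [d d1 H] := cF (e / 2 / (cm (g t) + 1)) ltac:(by rewrite !divr_gt0).
have [d' d'0 H'] := cG (e / 2 / (cm (f t) + 1)) ltac:(by rewrite !divr_gt0).
exists (Num.min d0 (Num.min d d')); rewrite ?lt_min ?d00 ?d1// => w.
rewrite !lt_min => /and3P[w0 w1 w2].
have -> : f w * g w - f t * g t = (f w - f t) * g w + f t * (g w - g t) by ring.
rewrite (le_lt_trans (cmD _ _))// !cmM.
have h1 := H _ w1; have h2 := H' _ w2.
have h0 := le_trans (cm_ge_dist _ _) (ltW (H0 _ w0)).
rewrite ltr_pdivlMr // in h1; rewrite ltr_pdivlMr // in h2.
have a1 : cm (f w - f t) * cm (g w) <= cm (f w - f t) * (cm (g t) + 1).
  by rewrite ler_wpM2l ?cm_ge0//; lra.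
have a2 : cm (f t) * cm (g w - g t) <= (cm (f t) + 1) * cm (g w - g t).
  by rewrite ler_wpM2r ?cm_ge0// lerDl.
lra.
Qed.

Lemma rcontD f g t : rcont f t -> rcont g t -> rcont (fun s => f s + g s) t.
Proof.
move=> cF cG e e0; have e2 : 0 < e / 2 by lra.
have [d d0 H] := cF _ e2; have [d' d'0 H'] := cG _ e2.
exists (Num.min d d'); rewrite ?lt_min ?d0// => w.
rewrite lt_min => /andP[w1 w2].
have -> : f w + g w - (f t + g t) = (f w - f t) + (g w - g t) by ring.
have := H _ w1; have := H' _ w2; have := cmD (f w - f t) (g w - g t); lra.
Qed.

Lemma rcont_cst (k : C) t : rcont (fun=> k) t.
Proof. by move=> e e0; exists 1 => // s _; rewrite subrr cm0. Qed.

Definition cI a b f : C := (rI a b (fun t => Re (f t))) +i* (rI a b (fun t => Im (f t))).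
Lemma Re_cI a b f : Re (cI a b f) = rI a b (fun t => Re (f t)). Proof. by []. Qed.
Lemma Im_cI a b f : Im (cI a b f) = rI a b (fun t => Im (f t)). Proof. by []. Qed.

Definition citg a b f :=
  itg a b (fun t => Re (f t)) /\ itg a b (fun t => Im (f t)).

Lemma citg_cont a b f : rcont_on a b f -> citg a b f.
Proof.
move=> cf; split; apply: itg_cont => t tab.
- exact: rcont_Re (cf _ tab).
- exact: rcont_Im (cf _ tab).
Qed.

Lemma cI_ext a b f g : (forall t, a <= t <= b -> f t = g t) -> cI a b f = cI a b g.
Proof. by move=> fg; congr (_ +i* _); apply: rI_ext => t /fg ->. Qed.

Lemma eq_citg a b f g : (forall t, f t = g t) -> citg a b f -> citg a b g.
Proof. by move=> /funext ->. Qed.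

Lemma citgD a b f g : citg a b f -> citg a b g -> citg a b (fun t => f t + g t).
Proof.
move=> [f1 f2] [g1 g2]; split.
- by under eq_fun do rewrite cReD; exact: itgD.
- by under eq_fun do rewrite cImD; exact: itgD.
Qed.

Lemma citgZ a b f (k : C) : citg a b f -> citg a b (fun t => k * f t).
Proof.
move=> [f1 f2]; split.
- by under eq_fun do rewrite cReM; apply: itgB; exact: itgZ.
- by under eq_fun do rewrite cImM; apply: itgD; exact: itgZ.
Qed.

Lemma citgB a b f g : citg a b f -> citg a b g -> citg a b (fun t => f t - g t).
Proof.
move=> hf /(citgZ (-1)) hg; have := citgD hf hg.
by apply: eq_citg => t; rewrite mulN1r.
Qed.

Lemma cID a b f g : citg a b f -> citg a b g ->
  cI a b (fun t => f t + g t) = cI a b f + cI a b g.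
Proof.
move=> [f1 f2] [g1 g2]; apply: c_eqP; rewrite !cE /=.
- by under eq_fun do rewrite cReD; rewrite rID.
- by under eq_fun do rewrite cImD; rewrite rID.
Qed.

Lemma cIZ a b f (k : C) : citg a b f -> cI a b (fun t => k * f t) = k * cI a b f.
Proof.
move=> [f1 f2]; apply: c_eqP; rewrite !cE /=.
- under eq_fun do rewrite cReM; rewrite rIB ?rIZ//; exact: itgZ.
- under eq_fun do rewrite cImM; rewrite rID ?rIZ//; exact: itgZ.
Qed.

Lemma cIB a b f g : citg a b f -> citg a b g ->
  cI a b (fun t => f t - g t) = cI a b f - cI a b g.
Proof.
move=> hf hg; have hg' := citgZ (-1) hg.
have -> : (fun t => f t - g t) = (fun t => f t + -1 * g t).
  by apply/funext => t; rewrite mulN1r.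
by rewrite cID// cIZ// mulN1r.
Qed.

Lemma cI_split a c b f : a <= c -> c <= b -> citg a b f ->
  cI a b f = cI a c f + cI c b f.
Proof.
by move=> ac cb [f1 f2]; apply: c_eqP; rewrite !cE /=; exact: rI_split.
Qed.

(** By [cm_le_rot] it is enough to bound the real part of [u * cI a b f], which is a real integral
    and can be compared pointwise with [cm u * k]. *)
Lemma cI_le a b f (k : R -> R) : citg a b f -> itg a b k ->
  (forall t, a <= t <= b -> cm (f t) <= k t) -> cm (cI a b f) <= rI a b k.
Proof.
move=> hf hk H.
have k0 : 0 <= rI a b k.
  apply: Rintegral_ge0 => t /=; rewrite in_itv /= => /H.
  by apply: le_trans; exact: cm_ge0.
apply: cm_le_rot => // u.
rewrite -cIZ//= -rIZ//; apply: rI_le => [||t tab].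
- by have [] := citgZ u hf.
- exact: itgZ.
- apply: (le_trans (ler_norm _)); apply: (le_trans (Re_le_cm _)).
  by rewrite cmM ler_wpM2l ?cm_ge0// H.
Qed.

Lemma cI_bound a b f (K : R) : a <= b -> citg a b f ->
  (forall t, a <= t <= b -> cm (f t) <= K) -> cm (cI a b f) <= K * (b - a).
Proof.
by move=> ab hf H; rewrite -rI_cst//; apply: cI_le => //; exact: itg_cst.
Qed.

Lemma rd_derive F (t : R) l (p : C -> R) : rd F t l ->
  (forall z, `|p z| <= cm z) -> (forall z w, p (z - w) = p z - p w) ->
  (forall z (x : R), p (z * x%:C) = p z * x) ->
  is_derive t 1 (fun s => p (F s)) (p l).
Proof.
move=> dF h1 h2 h3; apply: is_derive_eps => e /dF[d d0 H].
by exists d => // h /H; apply: le_trans; rewrite -h2 -h3 -h2; exact: h1.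
Qed.

Lemma rd_Re F t l : rd F t l -> is_derive t 1 (fun s => Re (F s)) (Re l).
Proof.
move=> dF; apply: rd_derive => //; first exact: Re_le_cm.
- by move=> z w; rewrite cReB.
- by move=> z x; rewrite !cE /=; ring.
Qed.

Lemma rd_Im F t l : rd F t l -> is_derive t 1 (fun s => Im (F s)) (Im l).
Proof.
move=> dF; apply: rd_derive => //; first exact: Im_le_cm.
- by move=> z w; rewrite cImB.
- by move=> z x; rewrite !cE /=; ring.
Qed.

Lemma cFTC a b F f : a < b -> (forall t, a <= t <= b -> rd F t (f t)) ->
  rcont_on a b f -> cI a b f = F b - F a.
Proof.
move=> ab dF cf; apply: c_eqP; rewrite !cE /=.
- apply: (@FTC _ a b (fun t => Re (F t))) => //.
  + by move=> t /dF/rd_Re.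
  + by move=> t /cf/rcont_Re.
- apply: (@FTC _ a b (fun t => Im (F t))) => //.
  + by move=> t /dF/rd_Im.
  + by move=> t /cf/rcont_Im.
Qed.

Lemma cd_rd (G : C -> C) (z v l : C) (t : R) : cd G (z + t%:C * v) l ->
  rd (fun s => G (z + s%:C * v)) t (l * v).
Proof.
move=> cG e e0.
have p : 0 < cm v + 1 by have := cm_ge0 v; lra.
have [d d0 H] := cG (e / (cm v + 1)) ltac:(by rewrite divr_gt0).
exists (d / (cm v + 1)); first by rewrite divr_gt0.
move=> h hd; rewrite ltr_pdivlMr // in hd.
have hv : cm (h%:C * v) <= `|h| * (cm v + 1).
  by rewrite cmM cmR ler_wpM2l// lerDl.
have := H (h%:C * v) (le_lt_trans hv hd).
have -> : z + t%:C * v + h%:C * v = z + (t + h)%:C * v by rewrite cRD; ring.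
have -> : l * (h%:C * v) = l * v * h%:C by ring.
move=> /le_trans; apply.
by rewrite -mulrA ler_pM2l// ler_pdivrMl// [leRHS]mulrC.
Qed.

Lemma rcont_comp_line (F : C -> C) (z v : C) (t : R) : ccont F (z + t%:C * v) ->
  rcont (fun s => F (z + s%:C * v)) t.
Proof. by move=> cF; apply: rcont_comp cF; exact: rcont_line. Qed.

End ComplexIntegral.

(** * Integrals along rectangles and power series expansion *)

Section Rectangle.
Context {R : realType}.
Local Notation C := R[i].
Implicit Types (f g F : C -> C) (a b c d x y r : R) (z w h : C).

(** This is the near-covering form of compactness. The local hypothesis holds for all small [i] at
    once, so finitely many neighbourhoods admit a common parameter. It yields bounds (with [i] as an
    inverse bound), uniform continuity, and the strip about the segment on which the curve is
    controlled. *)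
Lemma rect_compact (P : R -> C -> Prop) a b c d :
  (forall z, a <= Re z <= b -> c <= Im z <= d ->
    exists2 e : R, 0 < e & forall w (i : R), cm (w - z) < e -> 0 < i < e -> P i w) ->
  exists2 e : R, 0 < e & forall z, a <= Re z <= b -> c <= Im z <= d -> P e z.
Proof.
move=> H.
have K : compact (`[a, b]%classic `*` `[c, d]%classic : set (R * R)).
  by apply: compact_setX; exact: segment_compact.
have := (compact_near_coveringP _).1 K R (at_right 0) (fun i p => P i (p.1 +i* p.2)) _.
case.
- move=> [x y] [] /=; rewrite !in_itv /= => xI yI.
  have [e e0 He] := H (x +i* y) xI yI.
  near=> p i => /=.
  apply: He; last by apply/andP; split; near: i; [exact: nbhs_right_gt|exact: nbhs_right_lt].
  apply: (le_lt_trans (cm_le_ReIm _)); rewrite cReB cImB /=.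
  rewrite [ltRHS](splitr e) ltrD//.
    near: p; exists (ball x (e / 2), ball y (e / 2)).
      by split => /=; apply: nbhsx_ballx; lra.
    by move=> [p1 p2] [/= b1 _]; rewrite distrC.
  near: p; exists (ball x (e / 2), ball y (e / 2)).
    by split => /=; apply: nbhsx_ballx; lra.
  by move=> [p1 p2] [/= _ b1]; rewrite distrC.
- move=> e /= e0 He; exists (e / 2); first by rewrite divr_gt0.
  move=> [x y] /= xI yI.
  apply: (He (e / 2) _ _ (x, y)) => /=.
  + rewrite sub0r normrN gtr0_norm; lra.
  + by rewrite divr_gt0.
  + by split; rewrite /= in_itv.
Unshelve. all: by end_near. Qed.

Lemma rect_bounded f a b c d :
  (forall z, a <= Re z <= b -> c <= Im z <= d -> ccont f z) ->
  exists2 M : R, 0 < M & forall z, a <= Re z <= b -> c <= Im z <= d -> cm (f z) <= M.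
Proof.
move=> cf.
have [z h1 h2|e e0 H] := @rect_compact (fun i w => cm (f w) <= i^-1) a b c d.
  have [e e0 He] := cont_local (cf z h1 h2).
  have p : 0 < cm (f z) + 1 by have := cm_ge0 (f z); lra.
  exists (Num.min e (cm (f z) + 1)^-1); first by rewrite lt_min e0 invr_gt0.
  move=> w i; rewrite !lt_min => /andP[w1 _] /andP[i0 /andP[_ i1]].
  apply: (le_trans (He _ w1)).
  by rewrite -[leLHS]invrK lef_pV2 ?posrE ?invr_gt0 ?ltW.
by exists e^-1; rewrite ?invr_gt0.
Qed.

Lemma rect_unif f a b c d (e : R) : 0 < e ->
  (forall z, a <= Re z <= b -> c <= Im z <= d -> ccont f z) ->
  exists2 k : R, 0 < k & forall z, a <= Re z <= b -> c <= Im z <= d ->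
   forall w, cm (w - z) < k -> cm (f w - f z) < e.
Proof.
move=> e0 cf; have e2 : 0 < e / 2 by lra.
apply: (@rect_compact (fun i z => forall w, cm (w - z) < i -> cm (f w - f z) < e)).
move=> z h1 h2; have [k k0 Hk] := cf z h1 h2 _ e2.
exists (k / 2); first by rewrite divr_gt0.
move=> w i wz /andP[i0 ik] w' ww'.
have -> : f w' - f w = (f w' - f z) - (f w - f z) by ring.
have t1 : cm (f w - f z) < e / 2 by apply: Hk; lra.
have t2 : cm (f w' - f z) < e / 2.
  apply: Hk; have -> : w' - z = (w' - w) + (w - z) by ring.
  have := cmD (w' - w) (w - z); lra.
have := cmB (f w' - f z) (f w - f z); lra.
Qed.

(* The contour is the boundary of the rectangle, counterclockwise. *)
Definition rint f a b c d : C :=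
  cI a b (fun s => f (s +i* c)) - cI a b (fun s => f (s +i* d)) +
  iC * (cI c d (fun s => f (b +i* s)) - cI c d (fun s => f (a +i* s))).

Lemma hlineE x y : x +i* y = (0 +i* y) + x%:C * 1.
Proof. by apply: c_eqP; rewrite !cE /=; ring. Qed.

Lemma vlineE x y : x +i* y = x%:C + y%:C * iC.
Proof. by apply: c_eqP; rewrite !cE /=; ring. Qed.

Lemma rcont_h f x y : ccont f (x +i* y) -> rcont (fun s => f (s +i* y)) x.
Proof.
move=> cf; under eq_fun do rewrite hlineE.
by apply: rcont_comp_line; rewrite -hlineE.
Qed.

Lemma rcont_v f x y : ccont f (x +i* y) -> rcont (fun s => f (x +i* s)) y.
Proof.
move=> cf; under eq_fun do rewrite vlineE.
by apply: rcont_comp_line; rewrite -vlineE.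
Qed.

Lemma rd_h f x y l : cd f (x +i* y) l -> rd (fun s => f (s +i* y)) x l.
Proof.
move=> cf; under eq_fun do rewrite hlineE.
by rewrite -[l]mulr1; apply: cd_rd; rewrite -hlineE.
Qed.

Lemma rd_v f x y l : cd f (x +i* y) l -> rd (fun s => f (x +i* s)) y (l * iC).
Proof.
move=> cf; under eq_fun do rewrite vlineE.
by apply: cd_rd; rewrite -vlineE.
Qed.

(** Since [f'] is continuous, no subdivision argument is required: the contour integral is
    differentiated in the position [x] of the right side. The derivative compares the values of [f]
    at the two ends of that side with the vertical integral of [f'], and vanishes by the fundamental
    theorem of calculus. *)
Lemma rint_hol_Re f (f' : C -> C) a0 a b b0 c d : a0 < a -> a < b -> b < b0 -> c < d ->
  (forall z, a0 < Re z < b0 -> c <= Im z <= d -> cd f z (f' z) /\ ccont f' z) ->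
  Re (rint f a b c d) = 0.
Proof.
move=> a0a ab bb0 cd_ H.
(* The derivative in [x] is two-sided, so it needs room beyond both [a] and [b]. *)
set a1 := (a0 + a) / 2; set b1 := (b + b0) / 2.
have a1a : a0 < a1 < a by rewrite /a1; lra.
have b1b : b < b1 < b0 by rewrite /b1; lra.
have [z h1 h2|M M0 HM] := @rect_bounded f' a1 b1 c d.
  by apply: (H z _ h2).2; lra.
have cf x y : a0 < x < b0 -> c <= y <= d -> ccont f (x +i* y).
  by move=> hx hy; exact: cd_cont (H (x +i* y) hx hy).1.
pose K := fun x => rI a1 x (fun s => Re (f (s +i* c))) -
   rI a1 x (fun s => Re (f (s +i* d))) - rI c d (fun s => Im (f (x +i* s))).
have dK x : a <= x <= b -> is_derive x 1 K 0.
  move=> xab.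
  have E : Re (f (x +i* c)) - Re (f (x +i* d)) - rI c d (fun s => Im (f' (x +i* s))) = 0.
    have -> : rI c d (fun s => Im (f' (x +i* s))) = - (Re (f (x +i* d)) - Re (f (x +i* c))).
      have x0 : a0 < x < b0 by lra.
      have ct t : c <= t <= d -> rcont (fun s => f' (x +i* s) * iC) t.
        move=> tI; apply: rcontM; last exact: rcont_cst.
        by apply: rcont_v; exact: (H (x +i* t) x0 tI).2.
      have dt t : c <= t <= d -> rd (fun s => f (x +i* s)) t (f' (x +i* t) * iC).
        by move=> tI; apply: rd_v; exact: (H (x +i* t) x0 tI).1.
      have <- := FTC cd_ (fun t tI => rd_Re (dt t tI)) (fun t tI => rcont_Re (ct t tI)).
      rewrite -mulN1r -rIZ; first by apply: rI_ext => t _; rewrite !cE /=; ring.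
      by apply: itg_cont => t tI; exact: rcont_Re (ct t tI).
    by ring.
  rewrite -E; apply: is_deriveB; first apply: is_deriveB.
  - apply: (@FTC1 _ a1 b1) => [||t tI]; [lra|lra|].
    apply: (rcont_Re (f := fun s => f (s +i* c))); apply: rcont_h.
    by apply: cf; lra.
  - apply: (@FTC1 _ a1 b1) => [||t tI]; [lra|lra|].
    apply: (rcont_Re (f := fun s => f (s +i* d))); apply: rcont_h.
    by apply: cf; lra.
  - apply: (@derive_under_rI _ c d (fun x s => Im (f (x +i* s)))
      (fun x s => Im (f' (x +i* s))) a1 b1 x M) => //; first lra.
    + exact: ltW.
    + move=> y yI; apply: itg_cont => t tI.
      apply: (rcont_Im (f := fun s => f (y +i* s))); apply: rcont_v.
      by apply: cf; lra.
    + move=> y t yI tI; apply: (rd_Im (F := fun s => f (s +i* t))); apply: rd_h.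
      by apply: (H (y +i* t) _ tI).1 => /=; lra.
    + move=> y t yI tI; apply: (le_trans (Im_le_cm _)); apply: HM => //=; lra.
have := derive_cst_eq (ltW ab) dK.
have sp y : c <= y <= d -> rI a1 b (fun s => Re (f (s +i* y))) =
   rI a1 a (fun s => Re (f (s +i* y))) + rI a b (fun s => Re (f (s +i* y))).
  move=> yI; apply: rI_split; [lra|lra|].
  apply: itg_cont => t tI; apply: (rcont_Re (f := fun s => f (s +i* y))).
  by apply: rcont_h; apply: cf; lra.
rewrite /K !sp ?lexx ?ltW// /rint !cE /= => h; lra.
Qed.

(** The imaginary part is the real part for [- iC * f]. *)
Lemma rint_hol f (f' : C -> C) a0 a b b0 c d : a0 < a -> a < b -> b < b0 -> c < d ->
  (forall z, a0 < Re z < b0 -> c <= Im z <= d -> cd f z (f' z) /\ ccont f' z) ->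
  rint f a b c d = 0.
Proof.
move=> a0a ab bb0 cd_ H; apply: c_eqP; first exact: (rint_hol_Re a0a ab bb0 cd_ H).
have H2 z : a0 < Re z < b0 -> c <= Im z <= d ->
    cd (fun w => - iC * f w) z (- iC * f' z) /\ ccont (fun w => - iC * f' w) z.
  move=> h1 h2; split; first by apply: cdZ; exact: (H z h1 h2).1.
  by apply: contM; [exact: cont_cst|exact: (H z h1 h2).2].
have cf x y : a0 < x < b0 -> c <= y <= d -> ccont f (x +i* y).
  by move=> hx hy; exact: cd_cont (H (x +i* y) hx hy).1.
have := rint_hol_Re a0a ab bb0 cd_ H2.
rewrite /rint !cIZ.
- by rewrite !cE /=; lra.
- apply: citg_cont => t tI; apply: rcont_v; apply: cf => //; lra.
- apply: citg_cont => t tI; apply: rcont_v; apply: cf => //; lra.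
- apply: citg_cont => t tI; apply: rcont_h; apply: cf => //; lra.
- apply: citg_cont => t tI; apply: rcont_h; apply: cf => //; lra.
Qed.

Lemma rint_split f a0 a b b0 c0 d0 c m d : a0 < a -> a < b -> b < b0 ->
  (forall z, a0 < Re z < b0 -> c0 < Im z < d0 -> ccont f z) ->
  c0 < c -> c <= m -> m <= d -> d < d0 ->
  rint f a b c d = rint f a b c m + rint f a b m d.
Proof.
move=> a0a ab bb0 cf cc cm_ md dd; rewrite /rint (@cI_split _ c m d (fun s => f (b +i* s)))//; last first.
  apply: citg_cont => t tI; apply: rcont_v; apply: cf => /=; lra.
rewrite (@cI_split _ c m d (fun s => f (a +i* s)))//; last first.
  apply: citg_cont => t tI; apply: rcont_v; apply: cf => /=; lra.
ring.
Qed.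

Lemma cI_pt (g : R -> C) y : cI y y g = 0.
Proof.
apply: c_eqP => /=.
- by have := FTC_pt y (fun t => Re (g t)).
- by have := FTC_pt y (fun t => Im (g t)).
Qed.

(** Holomorphy is lacking only on the two horizontal sides. The rectangle is made lower by [t] at
    both ends, where [rint_hol] applies; uniform continuity controls the shifted sides and a bound
    on [f] the short vertical pieces. *)
Lemma rint_strip f (f' : C -> C) a0 a b b0 c0 d0 c d : a0 < a -> a < b -> b < b0 ->
  (forall z, a0 < Re z < b0 -> c0 < Im z < d0 -> ccont f z) ->
  c0 < c -> c <= d -> d < d0 ->
  (forall z, a0 < Re z < b0 -> c < Im z < d -> cd f z (f' z) /\ ccont f' z) ->
  rint f a b c d = 0.
Proof.
move=> a0a ab bb0 cf cc; rewrite le_eqVlt => /orP[/eqP -> dd _|cd_ dd H].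
  by rewrite /rint subrr add0r !cI_pt subrr mulr0.
have [z h1 h2|M M0 HM] := @rect_bounded f a b c d; first by apply: cf; lra.
have cfr x y : a0 < x < b0 -> c0 < y < d0 -> ccont f (x +i* y).
  by move=> ? ?; apply: cf.
have hi y u v : a <= u -> v <= b -> c0 < y < d0 -> citg u v (fun s => f (s +i* y)).
  by move=> ? ? ?; apply: citg_cont => t tI; apply: rcont_h; apply: cfr => //; lra.
have vi x u v : a <= x <= b -> c <= u -> v <= d -> citg u v (fun s => f (x +i* s)).
  by move=> ? ? ?; apply: citg_cont => t tI; apply: rcont_v; apply: cfr => //; lra.
apply/eqP; rewrite -cm_eq0 -(inj_eq (@addIr _ 0)) add0r addr0.
rewrite eq_le cm_ge0 andbT; apply/ler_addgt0Pl => e e0; rewrite addr0.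
pose e1 := e / 4 / (b - a).
have e10 : 0 < e1 by rewrite /e1 !divr_gt0 ?subr_gt0.
have [z h1 h2|k k0 Hk] := @rect_unif f a b c d e1 e10; first by apply: cf; lra.
(* The three terms give uniform continuity across the shift, the inequality [c + t < d - t], and at
   most [e / 8] for each vertical piece. The total error is two times [e / 4] plus four times
   [e / 8]. *)
pose t := Num.min (k / 2) (Num.min ((d - c) / 3) (e / (8 * M))).
have t0 : 0 < t by rewrite /t !lt_min !divr_gt0 ?mulr_gt0 ?subr_gt0.
have tk : t < k by rewrite /t !gt_min; apply/orP; left; lra.
have td : t <= (d - c) / 3 by rewrite /t !ge_min lexx !orbT.
have te : t <= e / (8 * M) by rewrite /t !ge_min lexx !orbT.
have z0 : rint f a b (c + t) (d - t) = 0.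
  apply: (@rint_hol _ f' a0 _ _ b0) => //; first lra.
  by move=> z h1 h2; apply: H => //; lra.
have hb y y' : c <= y <= d -> c <= y' <= d -> `|y' - y| < k ->
    cm (cI a b (fun s => f (s +i* y')) - cI a b (fun s => f (s +i* y))) <= e / 4.
  move=> h1 h2 h3; rewrite -cIB; [|apply: hi; lra..].
  apply: le_trans (_ : e1 * (b - a) <= _).
    apply: cI_bound; [exact: ltW|by apply: citgB; apply: hi; lra|].
    move=> s sI; apply: ltW; apply: Hk => //=.
    by apply: le_lt_trans h3; apply: (le_trans (cm_le_ReIm _)); rewrite cReB cImB /= subrr normr0 add0r.
  by rewrite /e1 divfK // gt_eqF// subr_gt0.
have vb x u v : a <= x <= b -> c <= u -> v <= d -> v - u = t ->
    cm (cI u v (fun s => f (x +i* s))) <= e / 8.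
  move=> h1 h2 h3 h4; apply: le_trans (_ : M * (v - u) <= _).
    apply: cI_bound; [lra|exact: vi|].
    by move=> s sI; apply: HM => //=; lra.
  rewrite h4 mulrC -ler_pdivlMr//; apply: (le_trans te).
  by rewrite invfM mulrA lexx.
have sp x : a <= x <= b -> cI c d (fun s => f (x +i* s)) =
   cI c (c + t) (fun s => f (x +i* s)) + (cI (c + t) (d - t) (fun s => f (x +i* s)) +
   cI (d - t) d (fun s => f (x +i* s))).
  move=> h1; rewrite (@cI_split _ c (c + t) d); [|lra|lra|by apply: vi].
  congr (_ + _); rewrite (@cI_split _ (c + t) (d - t) d) //; [lra|lra|].
  by apply: vi => //; lra.
have aI : a <= a <= b by lra. have bI : a <= b <= b by lra.
have -> : rint f a b c d = rint f a b c d - rint f a b (c + t) (d - t) by rewrite z0 subr0.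
rewrite /rint !sp//.
set A := cI a b (fun s => f (s +i* c)) - cI a b (fun s => f (s +i* (c + t))).
set B := cI a b (fun s => f (s +i* (d - t))) - cI a b (fun s => f (s +i* d)).
set D1 := cI c (c + t) (fun s => f (b +i* s)).
set D2 := cI (d - t) d (fun s => f (b +i* s)).
set D3 := cI c (c + t) (fun s => f (a +i* s)).
set D4 := cI (d - t) d (fun s => f (a +i* s)).
rewrite (_ : _ - _ = (A + B) + iC * ((D1 + D2) - (D3 + D4))); last first.
  by rewrite /A /B /D1 /D2 /D3 /D4; ring.
have hA : cm A <= e / 4.
  by apply: hb; [lra|lra|rewrite opprD addNKr normrN gtr0_norm].
have hB : cm B <= e / 4.
  by apply: hb; [lra|lra|rewrite addrAC subrr add0r normrN gtr0_norm].
have h1 : cm D1 <= e / 8 by apply: vb => //; lra.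
have h2 : cm D2 <= e / 8 by apply: vb => //; lra.
have h3 : cm D3 <= e / 8 by apply: vb => //; lra.
have h4 : cm D4 <= e / 8 by apply: vb => //; lra.
apply: (le_trans (cmD _ _)); rewrite cmM cm_i mul1r.
have := cmD A B; have := cmB (D1 + D2) (D3 + D4); have := cmD D1 D2; have := cmD D3 D4.
lra.
Qed.

Lemma rint_line f (f' : C -> C) a0 a b b0 c0 d0 c d l : a0 < a -> a < b -> b < b0 ->
  (forall z, a0 < Re z < b0 -> c0 < Im z < d0 -> ccont f z) ->
  c0 < c -> c <= d -> d < d0 ->
  (forall z, a0 < Re z < b0 -> c < Im z < d -> Im z != l -> cd f z (f' z) /\ ccont f' z) ->
  rint f a b c d = 0.
Proof.
move=> a0a ab bb0 cf cc cd_ dd H.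
have [/andP[cl ld]|hl] := boolP (c < l < d).
  rewrite (@rint_split f a0 a b b0 c0 d0 c l d)// ?ltW// !(@rint_strip f f' a0 a b b0 c0 d0) ?addr0 ?ltW//; [lra| |lra|].
  - by move=> z h1 h2; apply: H => //; [lra|rewrite gt_eqF//; lra].
  - by move=> z h1 h2; apply: H => //; [lra|rewrite lt_eqF//; lra].
apply: (@rint_strip f f' a0 a b b0 c0 d0) => // z h1 h2; apply: H => //.
by apply: contra hl => /eqP <-.
Qed.

(** Cauchy's formula requires two exceptional lines: the line [l] on which the function itself is
    only continuous, and the horizontal line through the point where its difference quotient is
    taken. *)
Lemma rint_lines f (f' : C -> C) a0 a b b0 c0 d0 c d l m : a0 < a -> a < b -> b < b0 ->
  (forall z, a0 < Re z < b0 -> c0 < Im z < d0 -> ccont f z) ->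
  c0 < c -> c <= d -> d < d0 ->
  (forall z, a0 < Re z < b0 -> c < Im z < d -> Im z != l -> Im z != m ->
     cd f z (f' z) /\ ccont f' z) ->
  rint f a b c d = 0.
Proof.
move=> a0a ab bb0 cf cc cd_ dd H.
have [/andP[cl ld]|hl] := boolP (c < l < d).
  rewrite (@rint_split f a0 a b b0 c0 d0 c l d)// ?ltW// !(@rint_line f f' a0 a b b0 c0 d0 _ _ m) ?addr0 ?ltW//; [lra| |lra|].
  - by move=> z h1 h2 h3; apply: H => //; [lra|rewrite gt_eqF//; lra].
  - by move=> z h1 h2 h3; apply: H => //; [lra|rewrite lt_eqF//; lra].
apply: (@rint_line f f' a0 a b b0 c0 d0 _ _ m) => // z h1 h2 h3; apply: H => //.
by apply: contra hl => /eqP <-.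
Qed.
End Rectangle.

(** * Integrals over a square and the geometric expansion of the Cauchy kernel *)

Section CauchyFormula.
Context {R : realType}.
Local Notation C := R[i].
Implicit Types (f g F : C -> C) (r : R) (z w h : C).

Definition onsq r z :=
  [&& `|Re z| <= r, `|Im z| <= r & (`|Re z| == r) || (`|Im z| == r)].

Definition sqint r f := rint f (- r) r (- r) r.

Lemma onsq_h r s e : `|s| <= r -> 0 <= r -> `|e| = r -> onsq r (s +i* e).
Proof. by move=> h1 h2 h3; rewrite /onsq /= h1 h3 lexx eqxx orbT. Qed.
Lemma onsq_v r s e : `|s| <= r -> 0 <= r -> `|e| = r -> onsq r (e +i* s).
Proof. by move=> h1 h2 h3; rewrite /onsq /= h1 h3 lexx eqxx. Qed.

Lemma onsq_ge r z : onsq r z -> r <= cm z.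
Proof.
move=> /and3P[_ _ /orP[]/eqP <-]; [exact: Re_le_cm|exact: Im_le_cm].
Qed.

Lemma onsq_neq0 r z : 0 < r -> onsq r z -> z != 0.
Proof. by move=> r0 /onsq_ge h; rewrite -cm_gt0 (lt_le_trans r0). Qed.

Lemma onsq_sub r z h : cm h <= r / 2 -> onsq r z -> r / 2 <= cm (z - h).
Proof. move=> h1 /onsq_ge h2; have := cm_ge_dist z h; lra. Qed.

Lemma onsq_sub0 r z h : 0 < r -> cm h <= r / 2 -> onsq r z -> z - h != 0.
Proof. move=> r0 h1 /(onsq_sub h1) h2; rewrite -cm_gt0; lra. Qed.

Definition csq r f := forall z, onsq r z -> ccont f z.

Lemma csq_citg r f : 0 < r -> csq r f ->
  [/\ citg (- r) r (fun s => f (s +i* - r)), citg (- r) r (fun s => f (s +i* r)),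
      citg (- r) r (fun s => f (r +i* s)) & citg (- r) r (fun s => f (- r +i* s))].
Proof.
move=> r0 cf; split; apply: citg_cont => t tI;
  [apply: rcont_h|apply: rcont_h|apply: rcont_v|apply: rcont_v]; apply: cf;
  [apply: onsq_h|apply: onsq_h|apply: onsq_v|apply: onsq_v];
  rewrite ?normrN ?ler_norml ?(ltW r0) // gtr0_norm//.
Qed.

Lemma sqintD r f g : 0 < r -> csq r f -> csq r g ->
  sqint r (fun z => f z + g z) = sqint r f + sqint r g.
Proof.
move=> r0 /(csq_citg r0)[f1 f2 f3 f4] /(csq_citg r0)[g1 g2 g3 g4].
by rewrite /sqint /rint !cID//; ring.
Qed.

Lemma sqintZ r f k : 0 < r -> csq r f -> sqint r (fun z => k * f z) = k * sqint r f.
Proof.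
move=> r0 /(csq_citg r0)[f1 f2 f3 f4].
by rewrite /sqint /rint !cIZ//; ring.
Qed.

Lemma sqint_ext r f g : 0 < r -> (forall z, onsq r z -> f z = g z) ->
  sqint r f = sqint r g.
Proof.
move=> r0 fg; rewrite /sqint /rint.
congr (_ - _ + _ * (_ - _)); apply: cI_ext => t tI; apply: fg;
  [apply: onsq_h|apply: onsq_h|apply: onsq_v|apply: onsq_v];
  rewrite ?normrN ?ler_norml ?(ltW r0) // gtr0_norm//.
Qed.

Lemma sqint_bound r f (K : R) : 0 < r -> csq r f ->
  (forall z, onsq r z -> cm (f z) <= K) -> cm (sqint r f) <= 8 * r * K.
Proof.
move=> r0 /(csq_citg r0)[f1 f2 f3 f4] H.
have rr : - r <= r by lra.
have E : r - - r = 2 * r by ring.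
have h1 : cm (cI (- r) r (fun s => f (s +i* - r))) <= K * (2 * r).
  rewrite -E; apply: cI_bound => // t tI; apply/H/onsq_h;
  by rewrite ?normrN ?ler_norml ?(ltW r0) // gtr0_norm.
have h2 : cm (cI (- r) r (fun s => f (s +i* r))) <= K * (2 * r).
  rewrite -E; apply: cI_bound => // t tI; apply/H/onsq_h;
  by rewrite ?normrN ?ler_norml ?(ltW r0) // gtr0_norm.
have h3 : cm (cI (- r) r (fun s => f (r +i* s))) <= K * (2 * r).
  rewrite -E; apply: cI_bound => // t tI; apply/H/onsq_v;
  by rewrite ?normrN ?ler_norml ?(ltW r0) // gtr0_norm.
have h4 : cm (cI (- r) r (fun s => f (- r +i* s))) <= K * (2 * r).
  rewrite -E; apply: cI_bound => // t tI; apply/H/onsq_v;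
  by rewrite ?normrN ?ler_norml ?(ltW r0) // gtr0_norm.
rewrite /sqint /rint; apply: (le_trans (cmD _ _)); rewrite cmM cm_i mul1r.
have := cmB (cI (- r) r (fun s => f (s +i* - r))) (cI (- r) r (fun s => f (s +i* r))).
have := cmB (cI (- r) r (fun s => f (r +i* s))) (cI (- r) r (fun s => f (- r +i* s))).
lra.
Qed.

Lemma sqint_prim r F f : 0 < r -> csq r f -> (forall z, onsq r z -> cd F z (f z)) ->
  sqint r f = 0.
Proof.
move=> r0 cf dF; have rr : - r < r by lra.
have [f1 f2 f3 f4] := csq_citg r0 cf.
have h t e : - r <= t <= r -> `|e| = r -> onsq r (t +i* e).
  by move=> tI eE; apply: onsq_h => //; [rewrite ler_norml|exact: ltW].
have v t e : - r <= t <= r -> `|e| = r -> onsq r (e +i* t).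
  by move=> tI eE; apply: onsq_v => //; [rewrite ler_norml|exact: ltW].
have hI e : `|e| = r -> cI (- r) r (fun s => f (s +i* e)) = F (r +i* e) - F (- r +i* e).
  move=> eE; apply: (@cFTC _ _ _ (fun s => F (s +i* e))) => // t tI.
  - by apply: rd_h; apply/dF/h.
  - by apply: rcont_h; apply/cf/h.
have vI e : `|e| = r -> iC * cI (- r) r (fun s => f (e +i* s)) = F (e +i* r) - F (e +i* - r).
  move=> eE; rewrite -cIZ//; last first.
    by apply: citg_cont => t tI; apply: rcont_v; apply/cf/v.
  apply: (@cFTC _ _ _ (fun s => F (e +i* s))) => // t tI.
  - by rewrite mulrC; apply: rd_v; apply/dF/v.
  - by apply: rcontM; [exact: rcont_cst|apply: rcont_v; apply/cf/v].
rewrite /sqint /rint mulrBr !hI ?vI ?normrN ?gtr0_norm//; ring.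
Qed.

(** The exact value is never computed, since it only serves as a divisor. Each side has length
    [2 * r] and an integrand of modulus at least [1 / (2 * r)] in the relevant part, so the four
    sides together contribute at least four to the imaginary part. *)
Lemma sqint_inv_neq0 r : 0 < r -> sqint r (fun z => z^-1) != 0.
Proof.
move=> r0.
have cf : csq r (fun z => z^-1) by move=> z /(onsq_neq0 r0); exact: cont_inv.
have [[a1 b1] [a2 b2] [a3 b3] [a4 b4]] := csq_citg r0 cf.
have rr : - r <= r by lra.
suff : 4 <= Im (sqint r (fun z => z^-1)).
  by apply: contraTneq => -> /=; rewrite -ltNge.
have E : r - - r = 2 * r by ring.
have iE x y : Im ((x +i* y)^-1) = - y / (x ^+ 2 + y ^+ 2) by rewrite /= mulNr.
have rE x y : Re ((x +i* y)^-1) = x / (x ^+ 2 + y ^+ 2) by [].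
have lb t : - r <= t <= r -> (2 * r)^-1 <= r / (t ^+ 2 + r ^+ 2).
  move=> tI; have p : 0 < t ^+ 2 + r ^+ 2 by rewrite ltr_wpDl ?sqr_ge0 ?exprn_gt0.
  rewrite ler_pdivlMr// ler_pdivrMl ?mulr_gt0//; nra.
have lb' t : - r <= t <= r -> (2 * r)^-1 <= r / (r ^+ 2 + t ^+ 2).
  by move=> /lb; rewrite addrC.
have c1 : (2 * r)^-1 * (r - - r) = 1 by rewrite E mulVf// gt_eqF// mulr_gt0.
have q1 : 1 <= rI (- r) r (fun s => Im ((s +i* - r)^-1)).
  rewrite -c1 -rI_cst//; apply: rI_le => [||t tI]; [exact: itg_cst|by []|].
  by rewrite iE opprK sqrrN lb.
have q2 : rI (- r) r (fun s => Im ((s +i* r)^-1)) <= -1.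
  rewrite -c1 -mulNr -rI_cst//; apply: rI_le => [||t tI]; [by []|exact: itg_cst|].
  by rewrite iE mulNr lerN2 lb.
have q3 : 1 <= rI (- r) r (fun s => Re ((r +i* s)^-1)).
  rewrite -c1 -rI_cst//; apply: rI_le => [||t tI]; [exact: itg_cst|by []|].
  by rewrite rE lb'.
have q4 : rI (- r) r (fun s => Re ((- r +i* s)^-1)) <= -1.
  rewrite -c1 -mulNr -rI_cst//; apply: rI_le => [||t tI]; [by []|exact: itg_cst|].
  by rewrite rE sqrrN mulNr lerN2 lb'.
rewrite /sqint /rint !cE [Re iC]/= [Im iC]/= !Re_cI !Im_cI; lra.
Qed.

Definition sqcoef r f n := sqint r (fun w => f w * w^-1 ^+ n.+1).

Lemma csq_coef r f n : 0 < r -> csq r f -> csq r (fun w => f w * w^-1 ^+ n).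
Proof.
move=> r0 cf z zs; apply: contM; first exact: cf.
by apply: contX; apply: cont_inv; exact: onsq_neq0 zs.
Qed.

Lemma csq_ker r f h : 0 < r -> cm h <= r / 2 -> csq r f -> csq r (fun w => f w * (w - h)^-1).
Proof.
move=> r0 hr cf z zs; apply: contM; first exact: cf.
apply: contV; first exact: onsq_sub0 zs.
by apply: contB; [exact: cont_id|exact: cont_cst].
Qed.

Lemma sqint_geo r f h N : 0 < r -> cm h <= r / 2 -> csq r f ->
  sqint r (fun w => f w * (w - h)^-1) =
  \sum_(n < N) sqcoef r f n * h ^+ n +
  h ^+ N * sqint r (fun w => f w * w^-1 ^+ N * (w - h)^-1).
Proof.
move=> r0 hr cf; elim: N => [|N ->].
  rewrite big_ord0 add0r mul1r; apply: sqint_ext => // z _.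
  by rewrite expr0 mulr1.
rewrite big_ord_recr /= -addrA; congr (_ + _).
rewrite /sqcoef exprSr.
rewrite [sqint r (fun w => f w * w^-1 ^+ N * _)](_ : _ = sqint r (fun w => f w * w^-1 ^+ N.+1) +
   h * sqint r (fun w => f w * w^-1 ^+ N.+1 * (w - h)^-1)); first by ring.
rewrite -sqintZ//; last by apply: csq_ker => //; exact: csq_coef.
rewrite -sqintD//.
- apply: sqint_ext => // z zs; rewrite exprS.
  by field; rewrite (onsq_neq0 r0 zs) (onsq_sub0 r0 hr zs).
- exact: csq_coef.
- by move=> z zs; apply: contM; [exact: cont_cst|apply: (csq_ker r0 hr (csq_coef _ r0 cf))].
Qed.

(** The remainder of the geometric sum is at most the perimeter [8 * r] times [M / r ^+ N] times
    [2 / r] for the kernel, and [h ^+ N] contributes [(r / 2) ^+ N]. *)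
Lemma sqint_geo_bound r f h M N : 0 < r -> cm h <= r / 2 -> csq r f ->
  (forall w, onsq r w -> cm (f w) <= M) ->
  cm (sqint r (fun w => f w * (w - h)^-1) - \sum_(n < N) sqcoef r f n * h ^+ n) <=
  16 * M / 2 ^+ N.
Proof.
move=> r0 hr cf HM; rewrite (sqint_geo N r0 hr cf) addrAC subrr add0r cmM cmX.
have M0 : 0 <= M.
  apply: le_trans (cm_ge0 _) (HM (r +i* 0) _).
  by apply: onsq_v; rewrite ?normr0 ?ltW// gtr0_norm.
have bd : cm (sqint r (fun w => f w * w^-1 ^+ N * (w - h)^-1)) <=
    8 * r * (M * r^-1 ^+ N * (r / 2)^-1).
  apply: sqint_bound => //.
    by apply: csq_ker => //; exact: csq_coef.
  move=> w ws; rewrite !cmM cmX !cmV.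
  have cw : r <= cm w := onsq_ge ws.
  have cw0 : 0 < cm w by lra.
  have ch := onsq_sub hr ws.
  apply: ler_pM; rewrite ?mulr_ge0 ?exprn_ge0 ?invr_ge0 ?cm_ge0//.
  - apply: ler_pM; rewrite ?exprn_ge0 ?invr_ge0 ?cm_ge0 ?HM//.
    by apply: lerXn2r; rewrite ?nnegrE ?invr_ge0 ?cm_ge0 ?(ltW r0)// lef_pV2.
  - by rewrite lef_pV2 ?posrE ?divr_gt0//; lra.
have hN : cm h ^+ N <= (r / 2) ^+ N.
  by apply: lerXn2r; rewrite ?nnegrE ?cm_ge0// divr_ge0// ltW.
apply: (le_trans (ler_pM _ _ hN bd)); rewrite ?exprn_ge0 ?cm_ge0//.
rewrite exprMn exprVn exprVn le_eqVlt; apply/orP; left; apply/eqP.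
have r1 : r != 0 by rewrite gt_eqF.
have rN : r ^+ N != 0 by rewrite expf_neq0.
have tN : 2 ^+ N != 0 :> R by rewrite expf_neq0.
move: rN tN; set a := r ^+ N; set b := 2 ^+ N => rN tN.
by field; rewrite rN r1 tN.
Qed.

Lemma geo_small (x K : R) : 0 <= x -> (forall N, x <= K / 2 ^+ N) -> x = 0.
Proof.
move=> x0 H; apply/eqP; rewrite eq_le x0 andbT; apply/ler_addgt0Pl => e e0; rewrite addr0.
have K0 : 0 <= K by have := H 0; rewrite expr0 divr1; exact: le_trans.
have [N HN] : exists N : nat, K / e < N%:R.
  exists (Num.bound (K / e)); apply: archi_boundP.
  by rewrite divr_ge0 // ltW.
apply: (le_trans (H N)); rewrite ler_pdivrMr ?exprn_gt0//.
rewrite ltr_pdivrMr// in HN; apply: (le_trans (ltW HN)); rewrite mulrC ler_pM2l//.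
rewrite -natrX ler_nat; apply: ltnW; exact: ltn_expl.
Qed.

(** In the geometric expansion every coefficient except the first is the integral of a power
    [w^-1 ^+ n.+2], which has a primitive on the contour. *)
Lemma sqint_ker r h : 0 < r -> cm h <= r / 2 ->
  sqint r (fun w => (w - h)^-1) = sqint r (fun w => w^-1).
Proof.
move=> r0 hr.
have c1 : csq r (fun=> 1) by move=> z _; exact: cont_cst.
have E0 : sqcoef r (fun=> 1) 0 = sqint r (fun w => w^-1).
  by apply: sqint_ext => // z _; rewrite mul1r expr1.
have ES n : sqcoef r (fun=> 1) n.+1 = 0.
  apply: (@sqint_prim _ (fun w => - (n.+1%:R)^-1 * w^-1 ^+ n.+1)) => //.
    exact: csq_coef.
  move=> z zs; have z0 := onsq_neq0 r0 zs.
  have := cdZ (- (n.+1%:R)^-1) (cdX n.+1 (cd_inv z0)).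
  congr cd => /=; rewrite mul1r.
  have n0 : n.+1%:R != 0 :> C by rewrite pnatr_eq0.
  rewrite (exprS _ n.+1) (exprS _ n).
  move: (n.+1%:R : C) n0 (z^-1 ^+ n) => k n0 a.
  by field; rewrite ?n0 ?z0.
apply/eqP; rewrite -subr_eq0 -cm_eq0; apply/eqP.
apply: (@geo_small _ 8) => [|N]; first exact: cm_ge0.
have := @sqint_geo_bound r (fun=> 1) h 1 N.+1 r0 hr c1.
rewrite big_ord_recl big1 => [|i _]; last by rewrite ES mul0r.
rewrite addr0 expr0 mulr1 E0 (@sqint_ext _ _ (fun w => (w - h)^-1)) => [H||z _]; last 2 first.
- by [].
- by rewrite mul1r.
apply: le_trans (H _) _; first by move=> w _; rewrite cm1.
have tN : 2 ^+ N != 0 :> R by rewrite expf_neq0.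
rewrite exprS le_eqVlt; apply/orP; left; apply/eqP.
move: tN; set b := 2 ^+ N => tN.
by field.
Qed.
End CauchyFormula.

(** * Cauchy's formula and power series across an exceptional line *)

Section CauchySeries.
Context {R : realType}.
Local Notation C := R[i].
Implicit Types (f g F : C -> C) (r : R) (z w h : C).

Definition insq r z := (`|Re z| < r) && (`|Im z| < r).

Lemma insq_cm r z : cm z < r -> insq r z.
Proof.
by move=> h; rewrite /insq !(le_lt_trans _ h) ?Re_le_cm ?Im_le_cm.
Qed.

Lemma onsq_in r r' z : r < r' -> onsq r z -> insq r' z.
Proof. by move=> rr /and3P[h1 h2 _]; rewrite /insq !(le_lt_trans _ rr). Qed.

(** The difference quotient [psi], completed at [h] by the derivative, is continuous because [f] is
    differentiable at [h]; this is why [h] must avoid the line [l]. Its contour integral vanishes by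
    [rint_lines], which leaves [f h] times the integral of the kernel. *)
Lemma cauchy_kernel f (f' : C -> C) r l h : 0 < r ->
  (forall z, insq (2 * r) z -> ccont f z) ->
  (forall z, insq (2 * r) z -> Im z != l -> cd f z (f' z) /\ ccont f' z) ->
  cm h <= r / 2 -> Im h != l ->
  sqint r (fun w => f w * (w - h)^-1) = f h * sqint r (fun w => w^-1).
Proof.
move=> r0 cf df hr hl.
have h_in : insq (2 * r) h by apply: insq_cm; lra.
pose psi w := if w == h then f' h else (f w - f h) * (w - h)^-1.
pose psi' w := (f' w * (w - h) - (f w - f h)) * (w - h)^-1 ^+ 2.
have near_psi z w : z != h -> cm (w - z) < cm (z - h) -> (f w - f h) * (w - h)^-1 = psi w.
  move=> zh wz; rewrite /psi ifN//; apply: contraTneq wz => ->.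
  by rewrite cm_dist ltxx.
have csub z : ccont (fun w => w - h) z.
  by apply: contB; [exact: cont_id|exact: cont_cst].
have cpsi z : insq (2 * r) z -> ccont psi z.
  move=> zin; have [->|zh] := eqVneq z h.
    have [dfh _] := df h h_in hl => e e0.
    have e2 : 0 < e / 2 by lra.
    have [d d0 H] := dfh _ e2; exists d => // w wh.
    rewrite /psi eqxx; have [_|wneh] := eqVneq w h; first by rewrite subrr cm0.
    have := H _ wh; have -> : h + (w - h) = w by ring.
    have wh0 : w - h != 0 by rewrite subr_eq0.
    have -> : f w - f h - f' h * (w - h) = ((f w - f h) * (w - h)^-1 - f' h) * (w - h).
      by field.
    rewrite cmM ler_pM2r ?cm_gt0// => /le_lt_trans; apply; lra.
  have zh0 : z - h != 0 by rewrite subr_eq0.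
  apply: (@cont_ext _ (fun w => (f w - f h) * (w - h)^-1) _ _ (cm (z - h))).
  - by rewrite cm_gt0.
  - by move=> w; exact: near_psi.
  - apply: contM; last by apply: contV.
    by apply: contB; [exact: cf|exact: cont_cst].
have dpsi z : insq (2 * r) z -> Im z != l -> Im z != Im h ->
    cd psi z (psi' z) /\ ccont psi' z.
  move=> zin zl zh'; have zh : z != h by apply: contra zh' => /eqP ->.
  have zh0 : z - h != 0 by rewrite subr_eq0.
  have [dfz cfz] := df z zin zl; split.
    apply: (@cd_ext _ (fun w => (f w - f h) * (w - h)^-1) _ _ _ (cm (z - h))).
    - by rewrite cm_gt0.
    - by move=> w; exact: near_psi.
    - have := cdM (cdB dfz (cd_cst (f h) z)) (@cdV _ (fun w => w - h) _ _ zh0 (cdB (cd_id z) (cd_cst h z))).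
      rewrite !subr0; congr cd; rewrite /psi'.
      by field.
  apply: contM; last by apply: contX; apply: contV.
  apply: contB; first by apply: contM.
  by apply: contB; [exact: cd_cont dfz|exact: cont_cst].
have psi0 : sqint r psi = 0.
  apply: (@rint_lines _ psi psi' (- (2 * r)) _ _ (2 * r) (- (2 * r)) (2 * r) _ _ l (Im h)); try lra.
  - by move=> z h1 h2; apply: cpsi; rewrite /insq !ltr_norml; apply/andP; split.
  - move=> z h1 h2 zl zh; apply: dpsi => //; rewrite /insq !ltr_norml; apply/andP; split => //; lra.
have rr : r < 2 * r by lra.
have csf : csq r f by move=> z zs; apply: cf; exact: onsq_in zs.
have ck : csq r (fun w => (w - h)^-1).
  by move=> z zs; apply: contV; [exact: onsq_sub0 zs|exact: csub].
have E : sqint r psi = sqint r (fun w => f w * (w - h)^-1 + - f h * (w - h)^-1).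
  apply: sqint_ext => // z zs; rewrite /psi ifN; first by ring.
  by rewrite -subr_eq0; exact: onsq_sub0 zs.
move: psi0; rewrite E sqintD//.
- rewrite sqintZ// sqint_ker// => /eqP; rewrite mulNr subr_eq0 => /eqP //.
- exact: csq_ker.
- by move=> z zs; apply: contM; [exact: cont_cst|exact: ck].
Qed.

Lemma cont_sum (c : nat -> C) N z : ccont (fun h => \sum_(n < N) c n * h ^+ n) z.
Proof.
elim: N => [|N IH].
  by apply: (@cont_ext _ (fun=> 0) _ _ 1) (cont_cst 0 z) => // w _; rewrite big_ord0.
apply: (@cont_ext _ (fun h => \sum_(n < N) c n * h ^+ n + c N * h ^+ N) _ _ 1) => //.
  by move=> w _; rewrite big_ord_recr.
by apply: contD => //; apply: contM; [exact: cont_cst|apply: contX; exact: cont_id].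
Qed.

(** This replaces Morera's theorem: a function glued along a line and merely continuous there still
    has a power series, with the geometric rate of convergence that [is_psum] asks for. *)
Lemma cauchy_series f (f' : C -> C) r l : 0 < r ->
  (forall z, insq (2 * r) z -> ccont f z) ->
  (forall z, insq (2 * r) z -> Im z != l -> cd f z (f' z) /\ ccont f' z) ->
  exists (c : nat -> C) (K : R), 0 <= K /\ forall h, cm h < r / 2 -> forall N,
    cm (f h - \sum_(n < N) c n * h ^+ n) <= K / 2 ^+ N.
Proof.
move=> r0 cf df.
have rr : r < 2 * r by lra.
have csf : csq r f by move=> z zs; apply: cf; exact: onsq_in zs.
have [z h1 h2|M M0 HM] := @rect_bounded R f (- r) r (- r) r.
  by apply: cf; rewrite /insq !ltr_norml; apply/andP; split; lra.
have HM' w : onsq r w -> cm (f w) <= M.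
  by move=> /and3P[]; rewrite !ler_norml => h1 h2 _; exact: HM.
set c0 := sqint r (fun w => w^-1); have c00 : c0 != 0 := sqint_inv_neq0 r0.
exists (fun n => sqcoef r f n / c0), (16 * M / cm c0).
have cc0 : 0 < cm c0 by rewrite cm_gt0.
split; first by rewrite divr_ge0 ?cm_ge0// mulr_ge0// ltW.
have main h N : cm h <= r / 2 -> Im h != l ->
    cm (f h - \sum_(n < N) sqcoef r f n / c0 * h ^+ n) <= 16 * M / cm c0 / 2 ^+ N.
  move=> hr hl; have := sqint_geo_bound N r0 hr csf HM'.
  rewrite (cauchy_kernel r0 cf df hr hl) -/c0.
  have -> : f h * c0 - \sum_(n < N) sqcoef r f n * h ^+ n =
     (f h - \sum_(n < N) sqcoef r f n / c0 * h ^+ n) * c0.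
    rewrite mulrBl mulr_suml; congr (_ - _); apply: eq_bigr => n _.
    by field.
  by rewrite cmM -ler_pdivlMr// mulrAC.
(* On the exceptional line the estimate is obtained by continuity, both of [f] and of the partial
   sum, from points [h + iC * t] slightly above it. *)
move=> h hr N; have [hl|hl] := eqVneq (Im h) l; last by apply: main => //; exact: ltW.
apply/ler_addgt0Pl => e e0.
have hin : insq (2 * r) h by apply: insq_cm; lra.
have cg : ccont (fun h => f h - \sum_(n < N) sqcoef r f n / c0 * h ^+ n) h.
  by apply: contB; [exact: cf|exact: (cont_sum (fun n => sqcoef r f n / c0) N h)].
have [d d0 Hd] := cg e e0.
pose t := Num.min (d / 2) ((r / 2 - cm h) / 2).
have t0 : 0 < t by rewrite /t lt_min !divr_gt0// subr_gt0.
have td : t < d by rewrite /t gt_min; apply/orP; left; lra.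
have tr : t < r / 2 - cm h by rewrite /t gt_min; apply/orP; right; lra.
pose w := h + iC * t%:C.
have cw : cm (w - h) = t by rewrite /w addrC addrA [- h + h]addrC subrr add0r cmM cm_i mul1r cmR gtr0_norm.
have wl : Im w != l by rewrite /w !cE /= hl -subr_eq0 (_ : _ - _ = t) ?gt_eqF//; ring.
have wr : cm w <= r / 2.
  by have := cmD (w - h) h; rewrite subrK cw; lra.
have h1 := main w N wr wl.
have h2 := Hd w; rewrite cw in h2; have {h2} := h2 td.
set A := f w - _ in h1 *; set B := f h - _ => h2.
have := cmB A (A - B); have -> : A - (A - B) = B by ring.
by lra.
Qed.
End CauchySeries.

(** * Holomorphic extension of real analytic functions *)

Section PowerSeries.
Context {R : realType}.
Local Notation C := R[i].
Implicit Types (F : C -> C) (r rho M K : R) (z w h : C) (c d e : nat -> C).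

Lemma geo_le (x B K : R) : (forall N, x <= B + K / 2 ^+ N) -> x <= B.
Proof.
move=> H; rewrite leNgt; apply/negP => xB.
have : x - B = 0.
  by apply: (@geo_small _ _ K) => [|N]; [rewrite subr_ge0 ltW|rewrite lerBlDl].
by move=> h; move: xB; rewrite -subr_gt0 h ltxx.
Qed.

Definition csumn c h N := \sum_(n < N) c n * h ^+ n.

(** Convergence is encoded by the rate [2 ^- N] with some constant, which is what half a radius of
    convergence provides. Limits then become inequalities valid for all [N], and sums are unique by
    [geo_small]. *)
Definition is_psum c h (s : C) := exists K : R, forall N,
  cm (s - csumn c h N) <= K / 2 ^+ N.

Definition psum c h : C := xget 0 (is_psum c h).

Lemma is_psum_uniq c h (s t : C) : is_psum c h s -> is_psum c h t -> s = t.
Proof.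
move=> [K HK] [K' HK']; apply/eqP; rewrite -subr_eq0 -cm_eq0; apply/eqP.
apply: (@geo_small _ _ (K + K')) => [|N]; first exact: cm_ge0.
have -> : s - t = (s - csumn c h N) - (t - csumn c h N) by ring.
have := cmB (s - csumn c h N) (t - csumn c h N).
by have := HK N; have := HK' N; lra.
Qed.

Lemma psumE c h s : is_psum c h s -> psum c h = s.
Proof.
by move=> H; apply: (is_psum_uniq _ H); apply: (@xgetPex _ (0 : C) (is_psum c h)); exists s.
Qed.

Lemma geo_sum_lt m n : (m <= n)%N ->
  \sum_(m <= i < n) (2 ^+ i)^-1 <= 2 / 2 ^+ m - 2 / 2 ^+ n :> R.
Proof.
move=> /subnK <-; elim: (n - m)%N => [|k IH]; first by rewrite big_geq// subrr.
rewrite addSn big_nat_recr ?leq_addl//= exprS.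
have p : 0 < 2 ^+ (k + m) :> R by rewrite exprn_gt0.
have -> : 2 / (2 * 2 ^+ (k + m)) = (2 ^+ (k + m))^-1 :> R by field; rewrite gt_eqF.
lra.
Qed.

Lemma real_geo_series (a : nat -> R) M : (forall n, `|a n| <= M / 2 ^+ n) ->
  exists s : R, forall N, `|s - \sum_(n < N) a n| <= 2 * M / 2 ^+ N.
Proof.
move=> H.
have M0 : 0 <= M by have := H 0%N; rewrite expr0 divr1; exact: le_trans.
have diff m n : (m <= n)%N -> `|\sum_(i < n) a i - \sum_(i < m) a i| <= 2 * M / 2 ^+ m.
  move=> mn; rewrite -!(big_mkord xpredT a) (big_cat_nat _ mn)//= addrAC subrr add0r.
  apply: (le_trans (ler_norm_sum _ _ _)).
  apply: (@le_trans _ _ (\sum_(m <= i < n) M * (2 ^+ i)^-1)).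
    by apply: ler_sum => i _; exact: H.
  rewrite -mulr_sumr; apply: (le_trans (ler_wpM2l M0 (geo_sum_lt mn))).
  rewrite mulrBr; have : 0 <= M * (2 / 2 ^+ n) by rewrite mulr_ge0// divr_ge0// exprn_ge0.
  by rewrite mulrA [M * 2]mulrC; lra.
have cv : cvgn (series a).
  apply: normed_cvg.
  apply: (@series_le_cvg _ _ (fun n => M / 2 ^+ n)) => [n|n|n|].
  - exact: normr_ge0.
  - by rewrite divr_ge0// exprn_ge0.
  - exact: H.
  - rewrite (_ : (fun _ => _) = geometric M 2^-1); last first.
      by apply/funext => i /=; rewrite exprVn.
    by apply: is_cvg_geometric_series; rewrite ger0_norm// invf_lt1// ltr1n.
exists (limn (series a)) => N.
apply/ler_addgt0Pl => e e0.
move: cv => /cvgrPdist_lt /(_ e e0)[m _ Hm].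
have := Hm (maxn m N) (leq_maxl _ _).
rewrite /series /= big_mkord.
set S := \sum_(i < maxn m N) a i => h1.
have h2 := diff _ _ (leq_maxr m N); rewrite -/S in h2.
have := ler_normD (limn (series a) - S) (S - \sum_(i < N) a i).
by rewrite addrA subrK; lra.
Qed.

Definition cbound c rho M := 0 < rho /\ forall n, cm (c n) * rho ^+ n <= M.

Lemma cbound_M0 c rho M : cbound c rho M -> 0 <= M.
Proof.
by move=> [r0 /(_ 0%N)]; rewrite expr0 mulr1; apply: le_trans; exact: cm_ge0.
Qed.

Lemma cbound_term c rho M h n : cbound c rho M -> cm h <= rho / 2 ->
  cm (c n * h ^+ n) <= M / 2 ^+ n.
Proof.
move=> [r0 H] hr; rewrite cmM cmX.
apply: (@le_trans _ _ (cm (c n) * (rho / 2) ^+ n)).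
  rewrite ler_wpM2l ?cm_ge0//; apply: lerXn2r; rewrite ?nnegrE ?cm_ge0//.
  by rewrite divr_ge0// ltW.
by rewrite exprMn mulrA exprVn ler_wpM2r ?invr_ge0 ?exprn_ge0.
Qed.

Lemma csumn_Re c h N : Re (csumn c h N) = \sum_(n < N) Re (c n * h ^+ n).
Proof.
rewrite /csumn; elim: N => [|N IH]; first by rewrite !big_ord0.
by rewrite !big_ord_recr /= cReD IH.
Qed.
Lemma csumn_Im c h N : Im (csumn c h N) = \sum_(n < N) Im (c n * h ^+ n).
Proof.
rewrite /csumn; elim: N => [|N IH]; first by rewrite !big_ord0.
by rewrite !big_ord_recr /= cImD IH.
Qed.

Lemma is_psum_psum c rho M h : cbound c rho M -> cm h <= rho / 2 ->
  forall N, cm (psum c h - csumn c h N) <= 4 * M / 2 ^+ N.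
Proof.
move=> cb hr.
have [a Ha] := @real_geo_series (fun n => Re (c n * h ^+ n)) M
  (fun n => le_trans (Re_le_cm _) (cbound_term n cb hr)).
have [b Hb] := @real_geo_series (fun n => Im (c n * h ^+ n)) M
  (fun n => le_trans (Im_le_cm _) (cbound_term n cb hr)).
have H N : cm ((a +i* b) - csumn c h N) <= 4 * M / 2 ^+ N.
  apply: (le_trans (cm_le_ReIm _)); rewrite cReB cImB csumn_Re csumn_Im /=.
  have := Ha N; have := Hb N; lra.
have -> : psum c h = a +i* b by apply: psumE; exists (4 * M).
exact: H.
Qed.

Definition dcoef c n := n.+1%:R * c n.+1.

Lemma cm_natr n : cm (n%:R : C) = n%:R.
Proof.
have -> : (n%:R : C) = (n%:R : R)%:C by rewrite (rmorph_nat (real_complex R)).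
by rewrite cmR ger0_norm.
Qed.

(** Halving the radius provides a factor [2 ^+ n], which absorbs the [n.+1] of the derived
    coefficient. *)
Lemma cbound_dcoef c rho M : cbound c rho M -> cbound (dcoef c) (rho / 2) (M / rho).
Proof.
move=> [r0 H]; split; first by rewrite divr_gt0.
move=> n; rewrite cmM cm_natr exprMn exprVn.
have -> : n.+1%:R * cm (c n.+1) * (rho ^+ n / 2 ^+ n) =
   (cm (c n.+1) * rho ^+ n.+1) / rho * (n.+1%:R / 2 ^+ n).
  rewrite exprS; have r1 : rho != 0 by rewrite gt_eqF.
  have tN : 2 ^+ n != 0 :> R by rewrite expf_neq0.
  by field; rewrite r1 tN.
have h1 : n.+1%:R / 2 ^+ n <= 1 :> R.
  by rewrite ler_pdivrMr ?exprn_gt0// mul1r -natrX ler_nat ltn_expl.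
apply: (@le_trans _ _ (M / rho * 1)); last by rewrite mulr1.
apply: ler_pM => //.
- by apply: divr_ge0; rewrite ?(ltW r0)// mulr_ge0 ?cm_ge0// exprn_ge0 ?ltW.
- by rewrite ler_wpM2r ?invr_ge0 ?(ltW r0).
Qed.

Lemma csumn_cd c z N : cd (fun h => csumn c h N.+1) z (csumn (dcoef c) z N).
Proof.
rewrite /csumn; elim: N => [|N IH].
  rewrite big_ord0; apply: (@cd_ext _ (fun=> c 0%N) _ _ _ 1) (cd_cst _ _) => // w _.
  by rewrite big_ord1 expr0 mulr1.
rewrite big_ord_recr /=.
apply: (@cd_ext _ (fun h => \sum_(n < N.+1) c n * h ^+ n + c N.+1 * h ^+ N.+1) _ _ _ 1) => //.
  by move=> w _; rewrite [RHS]big_ord_recr.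
apply: cdD => //; have := cdZ (c N.+1) (cdX N.+1 (cd_id z)).
by congr cd; rewrite /dcoef /=; ring.
Qed.

Lemma csumn_bound c rho M h N : cbound c rho M -> cm h <= rho / 2 ->
  cm (csumn c h N) <= 5 * M.
Proof.
move=> cb hr; have h1 := is_psum_psum cb hr N.
have h2 := is_psum_psum cb hr 0.
have M0 := cbound_M0 cb.
rewrite /csumn.
have -> : \sum_(n < N) c n * h ^+ n = \sum_(0 <= n < N) c n * h ^+ n by rewrite big_mkord.
have H : cm (\sum_(0 <= n < N) c n * h ^+ n) <= \sum_(0 <= n < N) M * (2 ^+ n)^-1.
  elim: N {h1} => [|k IH]; first by rewrite !big_geq// cm0.
  rewrite !big_nat_recr//=; apply: (le_trans (cmD _ _)).
  by rewrite lerD// (cbound_term _ cb hr).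
apply: (le_trans H); rewrite -mulr_sumr.
apply: (le_trans (ler_wpM2l M0 (geo_sum_lt (leq0n N)))).
rewrite expr0 divr1 mulrBr.
have : 0 <= M * (2 / 2 ^+ N) by rewrite mulr_ge0// divr_ge0// exprn_ge0.
lra.
Qed.

Lemma mvt2 F (F1 F2 : C -> C) z w (B : R) :
  (forall s : R, 0 <= s <= 1 -> cd F (z + s%:C * (w - z)) (F1 (z + s%:C * (w - z)))) ->
  (forall s : R, 0 <= s <= 1 -> cd F1 (z + s%:C * (w - z)) (F2 (z + s%:C * (w - z)))) ->
  (forall s : R, 0 <= s <= 1 -> cm (F2 (z + s%:C * (w - z))) <= B) ->
  cm (F w - F z - F1 z * (w - z)) <= B * cm (w - z) ^+ 2.
Proof.
move=> H1 H2 HB.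
have B0 : 0 <= B by apply: le_trans (cm_ge0 _) (HB 0 _); rewrite lexx ler01.
have -> : F w - F z - F1 z * (w - z) = (F w - F1 z * w) - (F z - F1 z * z) by ring.
rewrite expr2 mulrA.
apply: (@mvt_cd _ (fun x => F x - F1 z * x) (fun x => F1 x - F1 z)).
- move=> s s01; apply: cdB; first exact: H1.
  by have := cdZ (F1 z) (cd_id (z + s%:C * (w - z))); rewrite mulr1.
- move=> s /andP[s0 s1].
  apply: (@le_trans _ _ (B * cm (z + s%:C * (w - z) - z))).
    apply: (@mvt_cd _ F1 F2) => u /andP[u0 u1];
    have -> : z + u%:C * (z + s%:C * (w - z) - z) = z + (u * s)%:C * (w - z)
      by rewrite cRM; ring.
    - by apply: H2; rewrite mulr_ge0//= mulr_ile1.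
    - by apply: HB; rewrite mulr_ge0//= mulr_ile1.
  rewrite addrAC subrr add0r cmM cmR ger0_norm// ler_wpM2l//.
  by rewrite ler_piMl ?cm_ge0.
Qed.

Lemma cm_seg (a z w : C) (s k : R) : 0 <= s <= 1 -> cm (z - a) <= k -> cm (w - a) <= k ->
  cm (z + s%:C * (w - z) - a) <= k.
Proof.
move=> /andP[s0 s1] h1 h2.
have -> : z + s%:C * (w - z) - a = (1 - s)%:C * (z - a) + s%:C * (w - a).
  by rewrite cRD cRN; ring.
apply: (le_trans (cmD _ _)); rewrite !cmM !cmR !ger0_norm ?subr_ge0//.
have : (1 - s) * cm (z - a) <= (1 - s) * k by rewrite ler_wpM2l// subr_ge0.
have : s * cm (w - a) <= s * k by rewrite ler_wpM2l.
lra.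
Qed.

(** The second-order estimate holds for the partial sums with a constant independent of their
    length, and [geo_le] passes to the sums. The second derived coefficients are bounded at radius
    [rho / 4] and summed within half of it, hence [rho / 8]. *)
Lemma psum_cd c rho M z : cbound c rho M -> cm z < rho / 8 ->
  cd (psum c) z (psum (dcoef c) z).
Proof.
move=> cb zr.
have db := cbound_dcoef cb; have ddb := cbound_dcoef db.
have M20 := cbound_M0 ddb.
set M2 := M / rho / (rho / 2) in ddb M20.
apply: (@cd_quad _ _ _ _ (5 * M2) (rho / 8 - cm z)).
- by rewrite subr_gt0.
- by rewrite mulr_ge0.
move=> h hr.
have zhr : cm (z + h) <= rho / 8 by have := cmD z h; lra.
have r0 := cb.1.
have z2 : cm z <= rho / 2 by lra.
have zh2 : cm (z + h) <= rho / 2 by lra.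
have z4 : cm z <= rho / 2 / 2 by lra.
(* These are the errors of replacing three sums by partial sums: at [z + h], at [z], and for the
   derived series at [z], multiplied by [h]. *)
pose P := 4 * M + (4 * M + 4 * (M / rho) * cm h).
apply: (@geo_le _ _ P) => N.
have p1 := is_psum_psum cb z2 N.+1.
have p2 := is_psum_psum cb zh2 N.+1.
have p3 := is_psum_psum db z4 N.
have q := @mvt2 (fun h => csumn c h N.+2) (fun h => csumn (dcoef c) h N.+1)
   (fun h => csumn (dcoef (dcoef c)) h N) z (z + h) (5 * M2).
have zz : z + h - z = h by ring.
rewrite zz in q.
have {}q : cm (csumn c (z + h) N.+2 - csumn c z N.+2 - csumn (dcoef c) z N.+1 * h) <=
   5 * M2 * cm h ^+ 2.
  apply: q => s s01; try exact: csumn_cd.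
  apply: (csumn_bound N ddb).
  have := @cm_seg 0 z (z + h) s (rho / 8) s01; rewrite !subr0 zz => /(_ (ltW zr) zhr).
  lra.
have {p1}p1 := is_psum_psum cb z2 N.+2.
have {p2}p2 := is_psum_psum cb zh2 N.+2.
have {p3}p3 := is_psum_psum db z4 N.+1.
have E (a b k a' b' k' l : C) : a - b - k * l = (a' - b' - k' * l) +
   ((a - a') - ((b - b') + (k - k') * l)) by ring.
rewrite (E _ _ _ (csumn c (z + h) N.+2) (csumn c z N.+2) (csumn (dcoef c) z N.+1)).
apply: (le_trans (cmD _ _)); apply: lerD => //.
apply: (le_trans (cmB _ _)).
have := cmD (psum c z - csumn c z N.+2) ((psum (dcoef c) z - csumn (dcoef c) z N.+1) * h).
rewrite cmM => q2.
have q3 : cm (psum (dcoef c) z - csumn (dcoef c) z N.+1) * cm h <=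
   4 * (M / rho) / 2 ^+ N.+1 * cm h by rewrite ler_wpM2r ?cm_ge0.
have M0 := cbound_M0 cb.
have pw k : (2 ^+ (N + k))^-1 <= (2 ^+ N)^-1 :> R.
  by rewrite lef_pV2 ?posrE ?exprn_gt0// ler_weXn2l ?ler1n// leq_addr.
have w1 : 4 * M / 2 ^+ N.+2 <= 4 * M / 2 ^+ N.
  by rewrite ler_wpM2l ?mulr_ge0//; have := pw 2%N; rewrite addn2.
have w2 : 4 * (M / rho) / 2 ^+ N.+1 * cm h <= 4 * (M / rho) / 2 ^+ N * cm h.
  rewrite ler_wpM2r ?cm_ge0// ler_wpM2l//; last by have := pw 1%N; rewrite addn1.
  by apply: mulr_ge0 => //; apply: divr_ge0 => //; exact: ltW.
have -> : P / 2 ^+ N = 4 * M / 2 ^+ N + (4 * M / 2 ^+ N + 4 * (M / rho) / 2 ^+ N * cm h).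
  by rewrite /P !mulrDl; congr (_ + (_ + _)); rewrite mulrAC.
lra.
Qed.

Lemma psum_at0 c : psum c 0 = c 0%N.
Proof.
apply: psumE; exists (cm (c 0%N)); case=> [|N].
  by rewrite /csumn big_ord0 subr0 expr0 divr1.
rewrite /csumn big_ord_recl big1 => [|i _]; last by rewrite exprS mul0r mulr0.
by rewrite expr0 mulr1 addr0 subrr cm0 divr_ge0 ?cm_ge0// exprn_ge0.
Qed.

Lemma cbound_shift c rho M : cbound c rho M -> cbound (fun n => c n.+1) rho (M / rho).
Proof.
move=> [r0 H]; split => // n.
by have := H n.+1; rewrite exprS ler_pdivlMr// mulrA mulrAC.
Qed.

Lemma psum_shift c rho M h : cbound c rho M -> cm h <= rho / 2 ->
  psum c h = c 0%N + h * psum (fun n => c n.+1) h.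
Proof.
move=> cb hr; have sb := cbound_shift cb; have r0 := cb.1.
have M0 := cbound_M0 sb.
apply: psumE; exists (cm (c 0%N + h * psum (fun n => c n.+1) h) + cm h * (8 * (M / rho))).
case=> [|N].
  rewrite /csumn big_ord0 subr0 expr0 divr1 lerDl.
  by rewrite mulr_ge0 ?cm_ge0// mulr_ge0.
rewrite /csumn big_ord_recl expr0 mulr1.
have -> : c 0%N + h * psum (fun n => c n.+1) h - (c 0%N + \sum_(i < N) c (lift ord0 i) * h ^+ lift ord0 i) =
  h * (psum (fun n => c n.+1) h - csumn (fun n => c n.+1) h N).
  rewrite mulrBr /csumn mulr_sumr.
  have -> : \sum_(i < N) c (lift ord0 i) * h ^+ lift ord0 i = \sum_(i < N) h * (c i.+1 * h ^+ i).
    by apply: eq_bigr => i _; rewrite lift0 exprS mulrCA.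
  by ring.
rewrite cmM mulrDl -[leLHS]add0r lerD//.
  by rewrite divr_ge0 ?cm_ge0// exprn_ge0.
rewrite -mulrA ler_wpM2l ?cm_ge0//; apply: (le_trans (is_psum_psum sb hr N)).
have tN : 2 ^+ N != 0 :> R by rewrite expf_neq0.
by rewrite exprS le_eqVlt; apply/orP; left; apply/eqP; field; rewrite ?tN ?(gt_eqF r0).
Qed.

Lemma psum_coef0 e rho M r : 0 < r -> cbound e rho M ->
  (forall x : R, 0 < x < r -> psum e x%:C = 0) -> e 0%N = 0.
Proof.
move=> r0 eb H; apply/eqP; rewrite -cm_eq0 eq_le cm_ge0 andbT.
apply/ler_addgt0Pl => k k0; rewrite addr0.
have R0 := eb.1.
have c0 : ccont (psum e) 0.
  by apply: cd_cont (psum_cd eb _); rewrite cm0 divr_gt0.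
have [d d0 Hd] := c0 k k0.
pose x := Num.min (d / 2) (r / 2).
have x0 : 0 < x by rewrite /x lt_min !divr_gt0.
have xd : x < d by rewrite /x gt_min; apply/orP; left; lra.
have xr : x < r by rewrite /x gt_min; apply/orP; right; lra.
have := Hd x%:C; rewrite subr0 cmR gtr0_norm// => /(_ xd).
by rewrite H ?x0// psum_at0 sub0r cmN => /ltW.
Qed.

(** The constant coefficient vanishes by continuity at zero; dividing by the variable shifts the
    sequence, and induction does the rest. *)
Lemma psum_uniq0 e rho M r : 0 < r -> cbound e rho M ->
  (forall x : R, 0 < x < r -> psum e x%:C = 0) -> forall n, e n = 0.
Proof.
move=> r0 eb H n; elim: n e M r r0 eb H => [|n IH] e M r r0 eb H; last first.
  have R0 := eb.1; have sb := cbound_shift eb.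
  apply: (IH (fun n => e n.+1) (M / rho) (Num.min r (rho / 2))) => //.
    by rewrite lt_min r0 divr_gt0.
  move=> x; rewrite lt_min => /andP[x0 /andP[xr xh]].
  have cx : cm x%:C <= rho / 2 by rewrite cmR ger0_norm ltW.
  have := psum_shift eb cx; rewrite H ?x0//.
  have -> : e 0%N = 0 by apply: (@psum_coef0 e rho M r).
  rewrite add0r => /esym/eqP; rewrite mulf_eq0 cR_eq0 gt_eqF//= => /eqP //.
exact: (@psum_coef0 e rho M r).
Qed.
End PowerSeries.

(** * Holomorphic continuation off the real line *)

Section AnalyticExtension.
Context {R : realType}.
Local Notation C := R[i].
Implicit Types (F : C -> C) (f : R -> R) (r rho M K x y a : R) (z w h : C).

Lemma cd_uniq F z l m : cd F z l -> cd F z m -> l = m.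
Proof.
move=> hl hm; apply/eqP; rewrite -subr_eq0 -cm_eq0 eq_le cm_ge0 andbT.
apply/ler_addgt0Pl => e e0; rewrite addr0.
have e2 : 0 < e / 2 by lra.
have [d d0 H] := hl _ e2; have [d' d'0 H'] := hm _ e2.
pose t := Num.min (d / 2) (d' / 2).
have t0 : 0 < t by rewrite /t lt_min !divr_gt0.
have td : t < d by rewrite /t gt_min; apply/orP; left; lra.
have td' : t < d' by rewrite /t gt_min; apply/orP; right; lra.
have ct : cm t%:C = t by rewrite cmR gtr0_norm.
have := H t%:C; have := H' t%:C; rewrite ct => /(_ td') h1 /(_ td) h2.
have := cmB (F (z + t%:C) - F z - m * t%:C) (F (z + t%:C) - F z - l * t%:C).
have -> : F (z + t%:C) - F z - m * t%:C - (F (z + t%:C) - F z - l * t%:C) = (l - m) * t%:C.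
  by ring.
rewrite cmM ct => h3.
by rewrite -(ler_pM2r t0); lra.
Qed.

Definition cder F z : C := xget 0 [set l | cd F z l].

Lemma cderE F z l : cd F z l -> cder F z = l.
Proof.
move=> H; apply: (cd_uniq _ H).
exact: (@xgetPex _ (0 : C) [set l | cd F z l] (ex_intro _ l H)).
Qed.

Lemma cd_cder F z l : cd F z l -> cd F z (cder F z).
Proof. by move=> H; rewrite (cderE H). Qed.

Lemma cd_shift F z (a : C) l : cd F (z - a) l -> cd (fun w => F (w - a)) z l.
Proof.
move=> H; have := @cd_comp _ F (fun w => w - a) z l 1 _ H; rewrite mulr1; apply.
by have := cdB (cd_id z) (cd_cst a z); rewrite subr0.
Qed.

Definition rcoef f x : nat -> R := xget (fun=> 0) [set c : nat -> R |
  exists2 r : R, 0 < r & forall y, `|y - x| < r -> pseries c (y - x) @ \oo --> f y].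

(* The Taylor series at [Re z], summed at the imaginary increment [i Im z]. *)
Definition aext f z : C := psum (fun n => (rcoef f (Re z) n)%:C) (iC * (Im z)%:C).

Lemma pseries_cbound (c : nat -> R) rho : 0 < rho -> cvgn (pseries c rho) ->
  exists M, cbound (fun n => (c n)%:C) rho M.
Proof.
move=> r0 /cvg_series_bounded[K [_ HK]].
exists (`|K| + 1); split=> // n.
have K1 : K < `|K| + 1 by rewrite (le_lt_trans (ler_norm _))// ltrDl.
have := HK (`|K| + 1) K1 n I.
by rewrite /= cmR normrM normrX (gtr0_norm r0).
Qed.

Lemma csumn_real (c : nat -> R) x N :
  csumn (fun n => (c n)%:C) x%:C N = (\sum_(n < N) c n * x ^+ n)%:C.
Proof.
rewrite /csumn rmorph_sum /=; apply: eq_bigr => i _.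
by rewrite rmorphM rmorphXn.
Qed.

Lemma pseries_psum (c : nat -> R) rho M x (l : R) : cbound (fun n => (c n)%:C) rho M ->
  `|x| <= rho / 2 -> pseries c x @ \oo --> l -> psum (fun n => (c n)%:C) x%:C = l%:C.
Proof.
move=> cb xr cl; apply/eqP; rewrite -subr_eq0 -cm_eq0 eq_le cm_ge0 andbT.
apply: (@geo_le _ _ 0 (4 * M)) => N; rewrite add0r.
apply/ler_addgt0Pl => e e0.
move/cvgrPdist_lt : cl => /(_ e e0)[m _ Hm].
have := Hm (maxn m N) (leq_maxl _ _).
rewrite /pseries /series /= big_mkord => h1.
have cx : cm x%:C <= rho / 2 by rewrite cmR.
have := is_psum_psum cb cx (maxn m N).
rewrite csumn_real; set S := \sum_(_ < _) _ in h1 * => h2.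
have := cmB (psum (fun n : nat => (c n)%:C) x%:C - S%:C) (l%:C - S%:C).
have -> : psum (fun n : nat => (c n)%:C) x%:C - S%:C - (l%:C - S%:C) =
   psum (fun n : nat => (c n)%:C) x%:C - l%:C by ring.
have E1 : l%:C - S%:C = (l - S)%:C by rewrite cRD cRN.
rewrite E1 cmR => h3.
have h4 : 4 * M / 2 ^+ maxn m N <= 4 * M / 2 ^+ N.
  rewrite ler_wpM2l ?mulr_ge0 ?(cbound_M0 cb)//.
  by rewrite lef_pV2 ?posrE ?exprn_gt0// ler_weXn2l ?ler1n// leq_maxr.
lra.
Qed.

Lemma real_analytic_coef (A : set R) f x : real_analytic_on A f -> A x ->
  exists2 r : R, 0 < r & forall y, `|y - x| < r -> pseries (rcoef f x) (y - x) @ \oo --> f y.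
Proof.
move=> fA Ax; apply: (@xgetPex _ (fun=> 0) [set c : nat -> R |
  exists2 r : R, 0 < r & forall y, `|y - x| < r -> pseries c (y - x) @ \oo --> f y]).
by have [c [r [r0 H]]] := fA x Ax; exists c, r.
Qed.

Lemma real_analytic_psum (A : set R) f x : real_analytic_on A f -> A x ->
  exists rho M r, [/\ cbound (fun n => (rcoef f x n)%:C) rho M, 0 < r &
    forall y, `|y| < r -> psum (fun n => (rcoef f x n)%:C) y%:C = (f (x + y))%:C].
Proof.
move=> fA Ax; have [r r0 H] := real_analytic_coef fA Ax.
have r2 : 0 < r / 2 by lra.
have [M cb] : exists M, cbound (fun n => (rcoef f x n)%:C) (r / 2) M.
  apply: pseries_cbound => //; have := H (x + r / 2).
  rewrite addrAC subrr add0r gtr0_norm// => H'.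
  by apply: cvgP (f (x + r / 2)) _; apply: H'; lra.
exists (r / 2), M, (r / 4); split => //; first lra.
move=> y yr; apply: (pseries_psum cb); first lra.
have := H (x + y); rewrite addrAC subrr add0r; apply; lra.
Qed.

(** The centre of the series defining [aext] moves with [Re z], so holomorphy is not visible from
    the definition. Cauchy's expansion re-centres the series at [a] to [Re z], and uniqueness of
    coefficients identifies the result with the chosen [rcoef f (Re z)]. Near [a] all these series
    therefore have the sum of a single one. *)
Lemma aext_local (A : set R) f a : open A -> real_analytic_on A f -> A a ->
  exists (c : nat -> R) rho M r, [/\ cbound (fun n => (c n)%:C) rho M, 0 < r,
   (forall z, cm (z - a%:C) < r -> A (Re z)) &
   forall z, cm (z - a%:C) < r -> aext f z = psum (fun n => (c n)%:C) (z - a%:C)].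
Proof.
move=> oA fA Aa; have [rho [M [r1 [cb r10 Hr]]]] := real_analytic_psum fA Aa.
have rho0 := cb.1.
have [d d0 Hd] : exists2 d : R, 0 < d & forall x, `|x - a| < d -> A x.
  have /nbhs_ballP[d /= d0 Hd] := open_nbhs_nbhs (conj oA Aa).
  by exists d => // x xa; apply: Hd; rewrite /ball /= distrC.
pose r := Num.min (rho / 64) r1 / 4.
have rr : r <= rho / 256 by rewrite /r ler_pdivrMr// ge_min; apply/orP; left; lra.
have rr1 : r <= r1 / 4 by rewrite /r ler_pdivrMr// ge_min; apply/orP; right; lra.
have r0 : 0 < r by rewrite /r divr_gt0// lt_min r10 divr_gt0.
exists (rcoef f a), rho, M, (Num.min (r / 2) d); split; first exact: cb.
- by rewrite lt_min d0 divr_gt0.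
- move=> z; rewrite lt_min => /andP[_ h]; apply: Hd.
  by apply: le_lt_trans h; rewrite (_ : _ - _ = Re (z - a%:C)) ?Re_le_cm// cReB.
move=> z; rewrite lt_min => /andP[zr zd].
set c := fun n => (rcoef f a n)%:C.
set x := Re z; set t := x - a.
have Ax : A x.
  by apply: Hd; apply: le_lt_trans zd; rewrite (_ : _ - _ = Re (z - a%:C)) ?Re_le_cm// cReB.
have tr : `|t| < r / 2.
  by apply: le_lt_trans zr; rewrite (_ : t = Re (z - a%:C)) ?Re_le_cm// cReB.
pose g h := psum c (t%:C + h).
have db := cbound_dcoef cb.
have din w : insq (2 * r) w -> cm (t%:C + w) < rho / 2 / 8.
  move=> /andP[w1 w2]; have := cmD t%:C w; have := cm_le_ReIm w; rewrite cmR; lra.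
have sh h : t%:C + h = h - (- t%:C) by ring.
have dg w : insq (2 * r) w -> cd g w (psum (dcoef c) (t%:C + w)) /\
    ccont (fun h => psum (dcoef c) (t%:C + h)) w.
  move=> /din win; split.
    have -> : g = (fun h => psum c (h - (- t%:C))).
      by apply/funext => h; rewrite /g sh.
    by rewrite sh; apply: cd_shift; apply: (psum_cd cb); rewrite -sh; lra.
  have -> : (fun h => psum (dcoef c) (t%:C + h)) = (fun h => psum (dcoef c) (h - (- t%:C))).
    by apply/funext => h; rewrite sh.
  apply: cd_cont; apply: cd_shift; apply: (psum_cd db); rewrite -sh; lra.
have [e [K [K0 HK]]] := @cauchy_series R g (fun h => psum (dcoef c) (t%:C + h)) r 0 r0
  (fun w win => cd_cont (dg w win).1) (fun w win _ => dg w win).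
have ge h : cm h < r / 2 -> psum e h = g h.
  by move=> hr; apply: psumE; exists K => N; exact: HK.
have [rhox [Mx [rx [cbx rx0 Hrx]]]] := real_analytic_psum fA Ax.
have eb : cbound e (r / 4) (2 * K).
  split; first lra.
  move=> n; have h4 : cm (r / 4)%:C < r / 2 by rewrite cmR gtr0_norm; lra.
  have := HK _ h4 n; have := HK _ h4 n.+1; rewrite big_ord_recr /=.
  set S := \sum_(_ < _) _; set G := g _ => h1 h2.
  have := cmB (G - S) (G - (S + e n * (r / 4)%:C ^+ n)).
  have -> : G - S - (G - (S + e n * (r / 4)%:C ^+ n)) = e n * (r / 4)%:C ^+ n by ring.
  rewrite cmM cmX cmR gtr0_norm; last lra.
  have w1 : K / 2 ^+ n <= K.
    by rewrite ler_pdivrMr ?exprn_gt0// ler_peMr// exprn_ege1// ler1n.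
  have w2 : K / 2 ^+ n.+1 <= K.
    by rewrite ler_pdivrMr ?exprn_gt0// ler_peMr// exprn_ege1// ler1n.
  lra.
(* On small positive reals [y] both series sum to [f (x + y)], one by re-expansion from [a] and the
   other by choice, so their difference has vanishing coefficients. *)
pose k n := e n - (rcoef f x n)%:C.
pose rk := Num.min (r / 4) rhox.
have rk0 : 0 < rk by rewrite /rk lt_min cbx.1 eb.1.
have kb : cbound k rk (2 * K + Mx).
  split => // n; apply: (le_trans (ler_wpM2r _ (cmB _ _))); first by rewrite exprn_ge0 ?ltW.
  rewrite mulrDl; apply: lerD.
    apply: le_trans (eb.2 n); rewrite ler_wpM2l ?cm_ge0//.
    by apply: lerXn2r; rewrite ?nnegrE ?(ltW rk0) ?(ltW eb.1)// ge_min lexx.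
  apply: le_trans (cbx.2 n); rewrite ler_wpM2l ?cm_ge0//.
  by apply: lerXn2r; rewrite ?nnegrE ?(ltW rk0) ?(ltW cbx.1)// ge_min lexx orbT.
pose r' := Num.min (r / 8) (Num.min rx (rhox / 2)).
have rhx : 0 < rhox := cbx.1.
have r'0 : 0 < r' by rewrite /r' !lt_min; apply/and3P; split; lra.
have k0 n : k n = 0.
  apply: (psum_uniq0 r'0 kb) => y /andP[y0]; rewrite /r' !lt_min => /and3P[y1 y2 y3].
  have cy : cm y%:C = y by rewrite cmR gtr0_norm.
  apply: psumE; exists (4 * (2 * K) + 4 * Mx) => N.
  have ey : cm y%:C <= r / 4 / 2 by rewrite cy; lra.
  have xy : cm y%:C <= rhox / 2 by rewrite cy ltW.
  have h1 := is_psum_psum eb ey N.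
  have h2 := is_psum_psum cbx xy N.
  have ygt : `|y| < rx by rewrite gtr0_norm.
  rewrite (Hrx y ygt) in h2.
  rewrite ge in h1; last by rewrite cy; lra.
  rewrite /g -cRD Hr in h1; last first.
    have := ler_normD t y; rewrite (gtr0_norm y0); lra.
  have E : a + (t + y) = x + y by rewrite /t; ring.
  rewrite E in h1.
  have -> : 0 - csumn k y%:C N = ((f (x + y))%:C - csumn e y%:C N) -
     ((f (x + y))%:C - csumn (fun n => (rcoef f x n)%:C) y%:C N).
    rewrite (_ : csumn k y%:C N = csumn e y%:C N - csumn (fun n => (rcoef f x n)%:C) y%:C N).
      by ring.
    by rewrite /csumn -sumrB; apply: eq_bigr => i _; rewrite /k mulrBl.
  apply: (le_trans (cmB _ _)); rewrite mulrDl; exact: lerD.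
have -> : z - a%:C = t%:C + iC * (Im z)%:C.
  by rewrite {1}(cm_split z) /t cRD cRN -/x; ring.
rewrite -/(g _) -ge.
  rewrite /aext; congr (psum _ _); apply/funext => n.
  by apply/esym/eqP; rewrite -subr_eq0; apply/eqP/k0.
rewrite cmM cm_i mul1r cmR; apply: le_lt_trans zr.
have -> : Im z = Im (z - a%:C) by rewrite cImB /= subr0.
exact: Im_le_cm.
Qed.

Lemma aext_real (A : set R) f x : real_analytic_on A f -> A x -> aext f x%:C = (f x)%:C.
Proof.
move=> fA Ax; have [rho [M [r [cb r0 H]]]] := real_analytic_psum fA Ax.
by have := H 0; rewrite normr0 addr0 /aext /= mulr0 => ->.
Qed.

Definition dext k f : C -> C := iter k cder (aext f).

(** One coefficient sequence serves every order, differentiated termwise; only the radius of the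
    neighbourhood depends on [k]. *)
Lemma dext_local (A : set R) f a : open A -> real_analytic_on A f -> A a ->
  exists c : nat -> C, forall k, exists rho M r, [/\ cbound (iter k dcoef c) rho M, 0 < r &
   forall z, cm (z - a%:C) < r -> dext k f z = psum (iter k dcoef c) (z - a%:C)].
Proof.
move=> oA fA Aa; have [c [rho [M [r [cb r0 _ H]]]]] := aext_local oA fA Aa.
exists (fun n => (c n)%:C); elim=> [|k [rho' [M' [r' [cb' r'0 H']]]]].
  by exists rho, M, r.
exists (rho' / 2), (M' / rho'), (Num.min r' (rho' / 8)); split.
- exact: cbound_dcoef cb'.
- by rewrite lt_min r'0 divr_gt0// cb'.1.
- move=> z; rewrite lt_min => /andP[z1 z2].
  rewrite /dext iterS; apply: cderE.
  apply: (@cd_ext _ (fun w => psum (iter k dcoef (fun n => (c n)%:C)) (w - a%:C)) _ _ _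
    (r' - cm (z - a%:C))); first by rewrite subr_gt0.
    move=> w wz; rewrite -H'//.
    have -> : w - a%:C = (w - z) + (z - a%:C) by ring.
    have := cmD (w - z) (z - a%:C); lra.
  exact: cd_shift (psum_cd cb' z2).
Qed.

Lemma dext_cd (A : set R) f a k : open A -> real_analytic_on A f -> A a ->
  exists2 r : R, 0 < r & forall z, cm (z - a%:C) < r -> cd (dext k f) z (dext k.+1 f z).
Proof.
move=> oA fA Aa; have [c /(_ k)[rho [M [r [cb r0 H]]]]] := dext_local oA fA Aa.
exists (Num.min r (rho / 8)); first by rewrite lt_min r0 divr_gt0// cb.1.
move=> z; rewrite lt_min => /andP[z1 z2].
rewrite /dext iterS; apply: (@cd_cder _ _ (psum (dcoef (iter k dcoef c)) (z - a%:C))).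
apply: (@cd_ext _ (fun w => psum (iter k dcoef c) (w - a%:C)) _ _ _
    (r - cm (z - a%:C))); first by rewrite subr_gt0.
  move=> w wz; rewrite -H//.
  have -> : w - a%:C = (w - z) + (z - a%:C) by ring.
  have := cmD (w - z) (z - a%:C); lra.
exact: cd_shift (psum_cd cb z2).
Qed.
End AnalyticExtension.

(** * The logarithmic potential of a curve *)

Section ParamIntegral.
Context {R : realType}.
Local Notation C := R[i].
Implicit Types (z w h : C).

Lemma derive_eps (f : R -> R) (x l : R) : is_derive x 1 f l ->
  forall e : R, 0 < e -> exists2 d : R, 0 < d & forall h : R, `|h| < d ->
     `|f (x + h) - f x - l * h| <= e * `|h|.
Proof.
move=> [df dl] e e0.
have : h^-1 *: (f (h *: 1 + x) - f x) @[h --> 0^'] --> l.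
  by rewrite -dl; exact: df.
move=> /cvgrPdist_le /(_ e e0)[d /= d0 Hd]; exists d => // h hd.
have [->|h0] := eqVneq h 0; first by rewrite addr0 subrr mulr0 subrr normr0 mulr0.
have := Hd h; rewrite /= sub0r normrN => /(_ hd h0).
rewrite -[_ *: 1]/(h * 1) mulr1 [h + x]addrC -[_ *: _]/(_ * _) => h1.
have -> : f (x + h) - f x - l * h = - ((l - h^-1 * (f (x + h) - f x)) * h).
  by field.
by rewrite normrN normrM ler_wpM2r.
Qed.

Lemma gd_real_comp (f : R -> R) (u : C -> R) z l (k : R) :
  is_derive (u z) 1 f k -> gd u z l -> gd (fun w => f (u w)) z (k%:C * l).
Proof.
move=> df du e e0; have e2 : 0 < e / 2 by lra.
have [d1 d10 H1] := gd_local du.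
have p : 0 < cm l + 1 by have := cm_ge0 l; lra.
have pk : 0 < `|k| + 1 by have := normr_ge0 k; lra.
have [d2 d20 H2] := derive_eps df (divr_gt0 e2 p).
have [d3 d30 H3] := du _ (divr_gt0 e2 pk).
exists (Num.min d1 (Num.min (d2 / (cm l + 1)) d3)).
  by rewrite !lt_min d10 d30 divr_gt0.
move=> h; rewrite !lt_min => /and3P[h1 h2 h3].
set s := u (z + h) - u z.
have sb : `|s| <= (cm l + 1) * cm h := H1 _ h1.
have sd : `|s| < d2 by apply: (le_lt_trans sb); rewrite mulrC -ltr_pdivlMr.
have -> : u (z + h) = u z + s by rewrite /s; ring.
have -> : f (u z + s) - f (u z) - Re (k%:C * l * h) =
  (f (u z + s) - f (u z) - k * s) + k * (s - Re (l * h)) by rewrite !cE /=; ring.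
apply: (le_trans (ler_normD _ _)); rewrite normrM.
have a1 : `|f (u z + s) - f (u z) - k * s| <= e / 2 * cm h.
  apply: (le_trans (H2 _ sd)); apply: (le_trans (ler_wpM2l _ sb)).
    by rewrite !divr_ge0 ?ltW.
  by rewrite mulrA divfK ?gt_eqF.
have a2 : `|k| * `|s - Re (l * h)| <= e / 2 * cm h.
  apply: (@le_trans _ _ ((`|k| + 1) * `|s - Re (l * h)|)).
    by rewrite ler_wpM2r// lerDl.
  by rewrite mulrC -ler_pdivlMr// (le_trans (H3 _ h3))// mulrAC.
lra.
Qed.

Lemma gd_cmsqr z : gd (fun w => cm w ^+ 2) z (2 * cj z).
Proof.
move=> e e0; exists e => // h he.
have -> : cm (z + h) ^+ 2 - cm z ^+ 2 - Re (2 * cj z * h) = cm h ^+ 2.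
  rewrite !cm_sqr [2 * _]mulr_natl !cE /=; ring.
by rewrite ger0_norm ?sqr_ge0// expr2 ler_wpM2r ?cm_ge0// ltW.
Qed.

(** The logarithm is written as half of [ln (cm w ^+ 2)], which avoids the square root, and
    [cj z / cm z ^+ 2] is [z^-1]. *)
Lemma gd_lncm z : z != 0 -> gd (fun w => ln (cm w)) z z^-1.
Proof.
move=> z0; have cz : 0 < cm z by rewrite cm_gt0.
have cz2 : 0 < cm z ^+ 2 by rewrite exprn_gt0.
have := gdZ (2^-1) (gd_real_comp (is_derive1_ln cz2) (gd_cmsqr z)).
have -> : (2^-1)%:C * (((cm z ^+ 2)^-1)%:C * (2 * cj z)) = z^-1.
  have E : (2^-1)%:C = 2^-1 :> C by rewrite cRV (rmorph_nat (real_complex R)).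
  rewrite E cRV -mul_cJ.
  have cj0 : cj z != 0 by rewrite -cm_gt0 cmJ.
  by field; rewrite z0 cj0.
apply: (@gd_ext _ _ _ _ _ (cm z)) => // w wz.
have cw : 0 < cm w by have := cm_ge_dist z w; rewrite cm_dist; lra.
have -> : ln (cm w ^+ 2) = 2%:R * ln (cm w) by rewrite lnXn// mulr_natl.
by rewrite mulrA mulVf ?mul1r// pnatr_eq0.
Qed.

(** A Lipschitz bound on the gradient of the kernel, uniform in [t], makes the first-order remainder
    quadratic in the increment, and this survives integration over [t]. *)
Lemma gd_rI (a b : R) (k : C -> R -> R) (k1 : C -> R -> C) z (r B : R) :
  a <= b -> 0 < r -> 0 <= B ->
  (forall w t, cm (w - z) < r -> a <= t <= b -> gd (fun w => k w t) w (k1 w t)) ->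
  (forall w t, cm (w - z) < r -> a <= t <= b -> cm (k1 w t - k1 z t) <= B * cm (w - z)) ->
  (forall w, cm (w - z) < r -> itg a b (k w)) -> citg a b (k1 z) ->
  gd (fun w => rI a b (k w)) z (cI a b (k1 z)).
Proof.
move=> ab r0 B0 dk bk ik ik1.
have quad h t : cm h < r -> a <= t <= b ->
   `|k (z + h) t - k z t - Re (k1 z t * h)| <= B * cm h ^+ 2.
  move=> hr tI.
  have -> : k (z + h) t - k z t - Re (k1 z t * h) =
     (k (z + h) t - Re (k1 z t * (z + h))) - (k z t - Re (k1 z t * z)).
    by rewrite mulrDr cReD; ring.
  have zz : z + h - z = h by ring.
  have := @mvt_gd _ (fun w => k w t - Re (k1 z t * w)) (fun w => k1 w t - k1 z t)
    z (z + h) (B * cm h).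
  rewrite zz expr2 mulrA.
  have hs (s : R) : 0 <= s <= 1 -> cm (z + s%:C * h - z) <= cm h.
    move=> /andP[s0 s1]; rewrite addrAC subrr add0r cmM cmR ger0_norm//.
    by rewrite ler_piMl ?cm_ge0.
  apply => s s01.
  - apply: gdB; first by apply: dk => //; exact: le_lt_trans (hs s s01) hr.
    by have := cd_gdRe (cdZ (k1 z t) (cd_id (z + s%:C * h))); rewrite mulr1.
  - apply: (le_trans (bk _ _ (le_lt_trans (hs s s01) hr) tI)).
    by rewrite ler_wpM2l// hs.
move=> e e0; exists (Num.min r (e / (B * (b - a) + 1))).
  by rewrite lt_min r0 divr_gt0// ltr_wpDl// mulr_ge0 ?subr_ge0.
move=> h; rewrite lt_min => /andP[hr he].
have zhr : cm (z + h - z) < r by rewrite addrAC subrr add0r.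
have z0r : cm (z - z) < r by rewrite subrr cm0.
have ikh : citg a b (fun t => h * k1 z t) by exact: citgZ.
rewrite [cI a b _ * h]mulrC -cIZ// -rIB; [|exact: ik|exact: ik].
rewrite Re_cI -rIB; [|by apply: itgB; exact: ik|exact: ikh.1].
apply: le_trans (rI_abs _) _.
  by apply: itgB; [apply: itgB; exact: ik|exact: ikh.1].
apply: (@le_trans _ _ (B * cm h ^+ 2 * (b - a))).
  rewrite -rI_cst//; apply: rI_le.
  - by apply: itg_abs; apply: itgB; [apply: itgB; exact: ik|exact: ikh.1].
  - exact: itg_cst.
  - by move=> t tI; rewrite [h * _]mulrC quad.
rewrite ltr_pdivlMr in he; last by rewrite ltr_wpDl// mulr_ge0 ?subr_ge0.
have := cm_ge0 h; rewrite expr2 => c0.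
have : B * (b - a) * cm h <= e by lra.
move=> /(ler_wpM2r c0); lra.
Qed.

Lemma cd_cI (a b : R) (k k1 : C -> R -> C) z (r B : R) :
  a <= b -> 0 < r -> 0 <= B ->
  (forall w t, cm (w - z) < r -> a <= t <= b -> cd (fun w => k w t) w (k1 w t)) ->
  (forall w t, cm (w - z) < r -> a <= t <= b -> cm (k1 w t - k1 z t) <= B * cm (w - z)) ->
  (forall w, cm (w - z) < r -> citg a b (k w)) -> citg a b (k1 z) ->
  cd (fun w => cI a b (k w)) z (cI a b (k1 z)).
Proof.
move=> ab r0 B0 dk bk ik ik1; apply: gd_cd.
- apply: (@gd_rI a b (fun w t => Re (k w t)) k1 z r B) => //.
  + by move=> w t wr tI; apply: cd_gdRe; exact: dk.
  + by move=> w wr; case: (ik w wr).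
- rewrite -cIZ//.
  apply: (@gd_rI a b (fun w t => Im (k w t)) (fun w t => - iC * k1 w t) z r B) => //.
  + by move=> w t wr tI; apply: cd_gdIm; exact: dk.
  + by move=> w t wr tI; rewrite -mulrBr cmM cmN cm_i mul1r bk.
  + by move=> w wr; case: (ik w wr).
  + exact: citgZ.
Qed.
End ParamIntegral.

(** * Estimates for a holomorphic parametrisation *)

Section Curve.
Context {R : realType}.
Local Notation C := R[i].
Implicit Types (z w h u : C) (r m : R).

Definition strip (dl : R) z := (`|Re z| < 1 + dl) && (`|Im z| < dl).

Lemma seg_itv (p q x y s : R) : 0 <= s <= 1 -> p < x < q -> p < y < q ->
  p < x + s * (y - x) < q.
Proof.
move=> /andP[s0 s1] /andP[x1 x2] /andP[y1 y2].
have [xy|yx] := leP x y.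
  have h : 0 <= s * (y - x) by rewrite mulr_ge0// subr_ge0.
  have h' : s * (y - x) <= y - x by rewrite ler_piMl// subr_ge0.
  by apply/andP; split; lra.
have h : 0 <= s * (x - y) by rewrite mulr_ge0// subr_ge0 ltW.
have h' : s * (x - y) <= x - y by rewrite ler_piMl// subr_ge0 ltW.
by apply/andP; split; lra.
Qed.

Lemma strip_seg dl z w (s : R) : 0 <= s <= 1 -> strip dl z -> strip dl w ->
  strip dl (z + s%:C * (w - z)).
Proof.
move=> s01 /andP[z1 z2] /andP[w1 w2].
rewrite !ltr_norml in z1 z2 w1 w2; rewrite /strip !ltr_norml !cE /= mul0r subr0 mul0r addr0.
by apply/andP; split; exact: seg_itv.
Qed.

Lemma strip_real dl (t : R) : 0 < dl -> -1 <= t <= 1 -> strip dl t%:C.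
Proof. by move=> d0 tI; rewrite /strip /= normr0 d0 andbT ltr_norml; lra. Qed.

(** One constant [M] bounds the three derivatives that enter the kernels; the lower bound on [Re g1]
    gives injectivity, as the strip is convex. The record is kept abstract in [g] because it is used
    twice: for the curve, and for the identity. *)
Record curve_data (g g1 g2 g3 : C -> C) (dl M : R) : Prop := CurveData {
  cv_dl : 0 < dl;
  cv_dl1 : dl <= 1;
  cv_M : 1 <= M;
  cv_d1 : forall z, strip dl z -> cd g z (g1 z);
  cv_d2 : forall z, strip dl z -> cd g1 z (g2 z);
  cv_d3 : forall z, strip dl z -> cd g2 z (g3 z);
  cv_b1 : forall z, strip dl z -> cm (g1 z) <= M;
  cv_b2 : forall z, strip dl z -> cm (g2 z) <= M;
  cv_b3 : forall z, strip dl z -> cm (g3 z) <= M;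
  cv_re : forall z, strip dl z -> 2^-1 <= Re (g1 z) }.

Section Facts.
Context (g g1 g2 g3 : C -> C) (dl M : R).
Variable H : curve_data g g1 g2 g3 dl M.

Lemma cv_ub z w : strip dl z -> strip dl w -> cm (g w - g z) <= M * cm (w - z).
Proof.
move=> hz hw; apply: (@mvt_cd _ g g1) => s s01.
- by apply: (cv_d1 H); exact: strip_seg.
- by apply: (cv_b1 H); exact: strip_seg.
Qed.

(* The Noshiro-Warschawski argument: the real part of the difference quotient is a value of [Re g1]. *)
Lemma cv_lb_re z w : strip dl z -> strip dl w ->
  2^-1 * cm (w - z) ^+ 2 <= Re (cj (w - z) * (g w - g z)).
Proof.
move=> hz hw.
have [s s01 E] := @mvt_gd_ex _ (fun x => Re (cj (w - z) * g x))
  (fun x => cj (w - z) * g1 x) z w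
  (fun s s01 => cd_gdRe (cdZ _ (cv_d1 H (strip_seg s01 hz hw)))).
rewrite mulrBr cReB E.
have -> (a b : C) : cj a * b * a = (cm a ^+ 2)%:C * b by rewrite -mul_cJ; ring.
rewrite cReM [Re (_%:C)]/= [Im (_%:C)]/= mul0r subr0 [2^-1 * _]mulrC ler_wpM2l ?sqr_ge0//.
apply: (cv_re H); apply: strip_seg => //; lra.
Qed.

Lemma cv_lb z w : strip dl z -> strip dl w -> cm (w - z) / 2 <= cm (g w - g z).
Proof.
move=> hz hw; have := cv_lb_re hz hw.
have [->|wz] := eqVneq w z; first by rewrite subrr cm0 mul0r cm_ge0.
have c0 : 0 < cm (w - z) by rewrite cm_gt0 subr_eq0.
move=> h1; rewrite -(ler_pM2l c0).
have : Re (cj (w - z) * (g w - g z)) <= cm (w - z) * cm (g w - g z).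
  by apply: (le_trans (ler_norm _)); apply: (le_trans (Re_le_cm _)); rewrite cmM cmJ.
by rewrite expr2 in h1; lra.
Qed.

Lemma cv_inj z w : strip dl z -> strip dl w -> g z = g w -> z = w.
Proof.
move=> hz hw E; have := cv_lb hz hw; rewrite E subrr cm0 => h.
apply/esym/eqP; rewrite -subr_eq0 -cm_eq0 eq_le cm_ge0 andbT; lra.
Qed.

Lemma cv_taylor z w : strip dl z -> strip dl w ->
  cm (g w - g z - g1 z * (w - z) - g2 z / 2 * (w - z) ^+ 2) <= M * cm (w - z) ^+ 3.
Proof.
move=> hz hw.
have M0 : 0 <= M by have := cv_M H; lra.
pose E x := g x - g1 z * x - g2 z / 2 * (x - z) ^+ 2.
pose E1 x := g1 x - g1 z - g2 z * (x - z).
have -> : g w - g z - g1 z * (w - z) - g2 z / 2 * (w - z) ^+ 2 = E w - E z.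
  by rewrite /E; ring.
have -> : M * cm (w - z) ^+ 3 = M * cm (w - z) ^+ 2 * cm (w - z) by rewrite !exprS; ring.
apply: (@mvt_cd _ E E1) => s s01.
- have dz := cdB (cd_id (z + s%:C * (w - z))) (cd_cst z (z + s%:C * (w - z))).
  have := cdB (cdB (cv_d1 H (strip_seg s01 hz hw)) (cdZ (g1 z) (cd_id _)))
     (cdZ (g2 z / 2) (cdX 2 dz)).
  by congr cd; rewrite /E1 /=; field.
- rewrite /E1; set x := z + s%:C * (w - z).
  have hx : strip dl x by exact: strip_seg.
  apply: (@le_trans _ _ (M * cm (x - z) ^+ 2)).
    apply: (@mvt2 _ g1 g2 g3) => u u01.
    + by apply: (cv_d2 H); exact: strip_seg.
    + by apply: (cv_d3 H); exact: strip_seg.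
    + by apply: (cv_b3 H); exact: strip_seg.
  rewrite ler_wpM2l//; apply: lerXn2r; rewrite ?nnegrE ?cm_ge0//.
  rewrite /x addrAC subrr add0r cmM cmR; case/andP: s01 => s0 s1.
  by rewrite ger0_norm// ler_piMl ?cm_ge0.
Qed.

(* [K0], [K1], [K2] are the first three derivatives in [z] of [log (g z - u)]. *)
Definition K0 u z := g1 z / (g z - u).
Definition K1 u z := g2 z / (g z - u) - (g1 z / (g z - u)) ^+ 2.
Definition K2 u z := g3 z / (g z - u) - 3 * g1 z * g2 z / (g z - u) ^+ 2 +
  2 * g1 z ^+ 3 / (g z - u) ^+ 3.

Lemma K0_cd u z : strip dl z -> g z != u -> cd (K0 u) z (K1 u z).
Proof.
move=> hz zu; have zu0 : g z - u != 0 by rewrite subr_eq0.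
have dG := cdB (cv_d1 H hz) (cd_cst u z).
have := cdM (cv_d2 H hz) (@cdV _ (fun w => g w - u) _ _ zu0 dG).
by congr cd; rewrite /K1; field.
Qed.

Lemma K1_cd u z : strip dl z -> g z != u -> cd (K1 u) z (K2 u z).
Proof.
move=> hz zu; have zu0 : g z - u != 0 by rewrite subr_eq0.
have dG := cdB (cv_d1 H hz) (cd_cst u z).
have dV := @cdV _ (fun w => g w - u) _ _ zu0 dG.
have := cdB (cdM (cv_d3 H hz) dV) (cdX 2 (cdM (cv_d2 H hz) dV)).
by congr cd; rewrite /K2 /=; field.
Qed.

Lemma K0_bound u z m : strip dl z -> 0 < m -> m <= cm (g z - u) -> cm (K0 u z) <= M / m.
Proof.
move=> hz m0 hm; rewrite /K0 cmM cmV.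
apply: ler_pM; rewrite ?cm_ge0 ?invr_ge0 ?cm_ge0 ?(cv_b1 H)//.
by rewrite lef_pV2 ?posrE// (lt_le_trans m0).
Qed.

Lemma K1_bound u z m : strip dl z -> 0 < m -> m <= cm (g z - u) ->
  cm (K1 u z) <= M / m + (M / m) ^+ 2.
Proof.
move=> hz m0 hm; apply: (le_trans (cmB _ _)).
have M0 : 0 <= M by have := cv_M H; lra.
have iv : (cm (g z - u))^-1 <= m^-1 by rewrite lef_pV2 ?posrE// (lt_le_trans m0).
apply: lerD.
- rewrite cmM cmV; apply: ler_pM; rewrite ?cm_ge0 ?invr_ge0 ?cm_ge0 ?(cv_b2 H)//.
- rewrite cmX; apply: lerXn2r; rewrite ?nnegrE ?cm_ge0 ?divr_ge0 ?(ltW m0)//.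
  exact: K0_bound.
Qed.

Lemma K2_bound u z m : strip dl z -> 0 < m -> m <= cm (g z - u) ->
  cm (K2 u z) <= M / m + 3 * (M / m) ^+ 2 + 2 * (M / m) ^+ 3.
Proof.
move=> hz m0 hm.
have M0 : 0 <= M by have := cv_M H; lra.
have iv : (cm (g z - u))^-1 <= m^-1 by rewrite lef_pV2 ?posrE// (lt_le_trans m0).
have b1 := K0_bound hz m0 hm.
have b2 : cm (g2 z / (g z - u)) <= M / m.
  by rewrite cmM cmV; apply: ler_pM; rewrite ?cm_ge0 ?invr_ge0 ?cm_ge0 ?(cv_b2 H).
have b3 : cm (g3 z / (g z - u)) <= M / m.
  by rewrite cmM cmV; apply: ler_pM; rewrite ?cm_ge0 ?invr_ge0 ?cm_ge0 ?(cv_b3 H).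
have -> : K2 u z = g3 z / (g z - u) + (- (3%:R * (K0 u z * (g2 z / (g z - u)))) + 2%:R * K0 u z ^+ 3).
  by rewrite /K2 /K0 -!exprVn; ring.
apply: (le_trans (cmD _ _)); rewrite -addrA; apply: lerD => //.
apply: (le_trans (cmD _ _)); rewrite cmN (cmM 3) (cmM 2) cmX (cmM (K0 u z)) !cm_natr; apply: lerD.
- by rewrite ler_wpM2l// expr2; apply: ler_pM; rewrite ?cm_ge0.
- rewrite ler_wpM2l//; apply: lerXn2r; rewrite ?nnegrE ?cm_ge0 ?divr_ge0 ?(ltW m0)//.
Qed.

(* The double poles of [K1] and of [- (z - t)^-2] cancel; what is left is bounded by Taylor's formula at [z]. *)
Lemma K1_regular z w : strip dl z -> strip dl w -> z != w ->
  cm (K1 (g w) z + (z - w)^-1 ^+ 2) <= 16 * M ^+ 2 * (1 + (cm (z - w)) ^+ 2).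
Proof.
move=> hz hw zw.
have M1 := cv_M H.
set d := z - w; have d0 : d != 0 by rewrite subr_eq0.
have cd0 : 0 < cm d by rewrite cm_gt0.
set G := g z - g w.
have cG : cm d / 2 <= cm G by exact: cv_lb.
have G0 : G != 0 by rewrite -cm_gt0; lra.
pose e := G - g1 z * d + g2 z / 2 * d ^+ 2.
have ce : cm e <= M * cm d ^+ 3.
  have := cv_taylor hz hw; rewrite -cmN [cm (w - z)]cm_dist -/d.
  by congr (cm _ <= _); rewrite /e /G /d; ring.
(* Over the common denominator [G ^+ 2 * d ^+ 2], the terms of order two and three in [d] cancel in
   the numerator. What remains has order four, matching the denominator since [cm G] is at least
   [cm d / 2]. *)
have -> : K1 (g w) z + d^-1 ^+ 2 =
   (- (g2 z ^+ 2 / 4 * d ^+ 4) + (e ^+ 2 + 2%:R * (g1 z * d * e))) * (G^-1 ^+ 2 * d^-1 ^+ 2).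
  rewrite /K1 -/G.
  have -> : g2 z / G - (g1 z / G) ^+ 2 + d^-1 ^+ 2 =
    (g2 z * G * d ^+ 2 - (g1 z * d) ^+ 2 + G ^+ 2) * (G^-1 ^+ 2 * d^-1 ^+ 2).
    by field; rewrite d0 G0.
  congr (_ * _).
  have -> : G = g1 z * d - g2 z / 2 * d ^+ 2 + e by rewrite /e; ring.
  by field.
have n4 : cm (4^-1 : C) = 4^-1 by rewrite cmV cm_natr.
have b1 := cv_b1 H hz; have b2 := cv_b2 H hz.
have c1 := cm_ge0 (g1 z); have c2 := cm_ge0 (g2 z).
have N : cm (- (g2 z ^+ 2 / 4 * d ^+ 4) + (e ^+ 2 + 2%:R * (g1 z * d * e))) <=
   4 * M ^+ 2 * (1 + cm d ^+ 2) * cm d ^+ 4.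
  apply: (le_trans (cmD _ _)); apply: (le_trans (lerD (lexx _) (cmD _ _))).
  rewrite cmN !(cmX, cmM) n4 cm_natr.
  have t1 : cm (g2 z) ^+ 2 <= M ^+ 2 by apply: lerXn2r; rewrite ?nnegrE//; lra.
  have t2 : cm e ^+ 2 <= (M * cm d ^+ 3) ^+ 2.
    by apply: lerXn2r; rewrite ?nnegrE ?cm_ge0// mulr_ge0 ?exprn_ge0 ?ltW//; lra.
  have t3 : cm (g1 z) * cm d * cm e <= M * cm d * (M * cm d ^+ 3).
    apply: ler_pM => //; rewrite ?mulr_ge0 ?cm_ge0//.
    by rewrite ler_wpM2r ?cm_ge0.
  have p4 : 0 <= cm d ^+ 4 by rewrite exprn_ge0 ?cm_ge0.
  have t1' := ler_wpM2r p4 t1.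
  have M2 : 0 <= M ^+ 2 by rewrite sqr_ge0.
  have p6 : 0 <= M ^+ 2 * cm d ^+ 6 by rewrite mulr_ge0// exprn_ge0 ?cm_ge0.
  have q4 : 0 <= M ^+ 2 * cm d ^+ 4 by rewrite mulr_ge0.
  have E2 : (M * cm d ^+ 3) ^+ 2 = M ^+ 2 * cm d ^+ 6 by ring.
  have E3 : M * cm d * (M * cm d ^+ 3) = M ^+ 2 * cm d ^+ 4 by ring.
  have E4 : 4 * M ^+ 2 * (1 + cm d ^+ 2) * cm d ^+ 4 = 4 * (M ^+ 2 * cm d ^+ 4) + 4 * (M ^+ 2 * cm d ^+ 6) by ring.
  rewrite E2 in t2; rewrite E3 in t3; rewrite E4; lra.
rewrite cmM.
have D : cm (G^-1 ^+ 2 * d^-1 ^+ 2) <= 4 / cm d ^+ 4.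
  rewrite cmM !(cmX, cmV).
  have -> : 4 / cm d ^+ 4 = (cm d / 2)^-1 ^+ 2 * (cm d)^-1 ^+ 2.
    by field; rewrite gt_eqF.
  rewrite ler_wpM2r ?sqr_ge0//; apply: lerXn2r; rewrite ?nnegrE ?invr_ge0 ?cm_ge0 ?divr_ge0 ?cm_ge0//.
  by rewrite lef_pV2 ?posrE ?divr_gt0 // cm_gt0.
apply: (le_trans (ler_pM _ _ N D)); rewrite ?cm_ge0//.
rewrite le_eqVlt; apply/orP; left; apply/eqP; field.
by rewrite gt_eqF.
Qed.
End Facts.
End Curve.

Section Potential.
Context {R : realType}.
Local Notation C := R[i].
Implicit Types (z w h u : C) (r m : R).

(** The bounds hold on the whole line, so that [q (Re z)] can be compared with [q t] wherever [Re z]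
    lies. *)
Record density (q : R -> R) (Q L : R) : Prop := Density {
  dn_Q : 0 <= Q;
  dn_L : 0 <= L;
  dn_bd : forall t, `|q t| <= Q;
  dn_lip : forall t s, `|q t - q s| <= L * `|t - s| }.

Lemma dn_cont (q : R -> R) Q L t : density q Q L -> {for t, continuous q}.
Proof.
move=> D; apply/cvgrPdist_lt => e e0.
have p : 0 < L + 1 by have := dn_L D; lra.
exists (e / (L + 1)) => /=; first by rewrite divr_gt0.
move=> s /=; rewrite ltr_pdivlMr// => h; apply: le_lt_trans (dn_lip D _ _) _.
by apply: le_lt_trans h; rewrite mulrC ler_wpM2l// lerDl.
Qed.

Lemma rcont_ofR (t : R) : rcont (fun s : R => s%:C) t.
Proof.
move=> e e0; exists e => // s h.
by rewrite (_ : s%:C - t%:C = (s - t)%:C) ?cmR// cRD cRN.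
Qed.

Lemma strip_ball dl z : strip dl z -> exists2 r : R, 0 < r &
  forall w, cm (w - z) < r -> strip dl w.
Proof.
move=> /andP[h1 h2].
exists (Num.min (1 + dl - `|Re z|) (dl - `|Im z|)); first by rewrite lt_min !subr_gt0 h1.
move=> w; rewrite lt_min => /andP[w1 w2]; apply/andP; split.
- have := ler_normD (Re (w - z)) (Re z); have := Re_le_cm (w - z).
  by rewrite cReB subrK; lra.
- have := ler_normD (Im (w - z)) (Im z); have := Im_le_cm (w - z).
  by rewrite cImB subrK; lra.
Qed.

Lemma strip_cj dl z : strip dl z -> strip dl (cj z).
Proof. by rewrite /strip cReJ cImJ normrN. Qed.

Lemma Im_sub_real z (t : R) : Im (z - t%:C) = Im z.
Proof. by rewrite cImB /= subr0. Qed.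

Lemma Im_le_dist z (t : R) : `|Im z| <= cm (z - t%:C).
Proof. by rewrite -(Im_sub_real z t) Im_le_cm. Qed.

Section Kernels.
Context (g g1 g2 g3 : C -> C) (dl M : R) (q : R -> R) (Q L : R).
Variable H : curve_data g g1 g2 g3 dl M.
Variable D : density q Q L.

(** This is the single layer potential of the curve in the parameter plane; [sg] is its conjugate
    gradient and [sg1] the complex derivative of [sg]. *)
Definition Sp z : R := rI (-1) 1 (fun t => q t * ln (cm (g z - g t%:C))).
Definition sg z : C := cI (-1) 1 (fun t => (q t)%:C * K0 g g1 (g t%:C) z).
Definition sg1 z : C := cI (-1) 1 (fun t => (q t)%:C * K1 g g1 g2 (g t%:C) z).

Lemma rcont_g t : -1 <= t <= 1 -> rcont (fun s : R => g s%:C) t.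
Proof.
move=> tI; apply: (rcont_comp (rcont_ofR t)).
by apply: cd_cont (cv_d1 H _); apply: strip_real => //; exact: cv_dl H.
Qed.

Lemma rcont_q t : rcont (fun s : R => (q s)%:C) t.
Proof. by apply: cts_rcont; exact: dn_cont D. Qed.

Lemma g_sep z t : strip dl z -> -1 <= t <= 1 -> `|Im z| / 2 <= cm (g z - g t%:C).
Proof.
move=> hz tI; have ht : strip dl t%:C by apply: strip_real => //; exact: cv_dl H.
have := cv_lb H ht hz; have := Im_le_dist z t; lra.
Qed.

Lemma g_neq z t : strip dl z -> -1 <= t <= 1 -> Im z != 0 -> g z != g t%:C.
Proof.
move=> hz tI z0; rewrite -subr_eq0 -cm_gt0.
by apply: lt_le_trans (g_sep hz tI); rewrite divr_gt0// normr_gt0.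
Qed.

Lemma rcont_inv z t : strip dl z -> -1 <= t <= 1 -> Im z != 0 ->
  rcont (fun s : R => (g z - g s%:C)^-1) t.
Proof.
move=> hz tI z0; apply: (@rcont_comp _ (fun u => (g z - u)^-1) _ _ (rcont_g tI)).
apply: contV; first by rewrite subr_eq0 g_neq.
by apply: contB; [exact: cont_cst|exact: cont_id].
Qed.

Lemma rcont_K0 z t : strip dl z -> -1 <= t <= 1 -> Im z != 0 ->
  rcont (fun s : R => K0 g g1 (g s%:C) z) t.
Proof.
by move=> hz tI z0; apply: rcontM; [exact: rcont_cst|exact: rcont_inv].
Qed.

Lemma rcont_K1 z t : strip dl z -> -1 <= t <= 1 -> Im z != 0 ->
  rcont (fun s : R => K1 g g1 g2 (g s%:C) z) t.
Proof.
move=> hz tI z0.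
have -> : (fun s : R => K1 g g1 g2 (g s%:C) z) = (fun s => g2 z * (g z - g s%:C)^-1 +
    -1 * (K0 g g1 (g s%:C) z * K0 g g1 (g s%:C) z)).
  by apply/funext => s; rewrite /K1 /K0; ring.
apply: rcontD; first by apply: rcontM; [exact: rcont_cst|exact: rcont_inv].
apply: rcontM; first exact: rcont_cst.
by apply: rcontM; exact: rcont_K0.
Qed.

Lemma citg_K0 z : strip dl z -> Im z != 0 ->
  citg (-1) 1 (fun t => (q t)%:C * K0 g g1 (g t%:C) z).
Proof.
move=> hz z0; apply: citg_cont => t tI; apply: rcontM; first exact: rcont_q.
exact: rcont_K0.
Qed.

Lemma citg_K1 z : strip dl z -> Im z != 0 ->
  citg (-1) 1 (fun t => (q t)%:C * K1 g g1 g2 (g t%:C) z).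
Proof.
move=> hz z0; apply: citg_cont => t tI; apply: rcontM; first exact: rcont_q.
exact: rcont_K1.
Qed.

Lemma itg_ln z : strip dl z -> Im z != 0 ->
  itg (-1) 1 (fun t => q t * ln (cm (g z - g t%:C))).
Proof.
move=> hz z0; apply: itg_cont => t tI.
apply: continuousM; first exact: dn_cont D.
apply: (@continuous_comp _ _ _ (fun t : R => cm (g z - g t%:C)) (@ln R)).
  have c1 : rcont (fun s : R => g z - g s%:C) t.
    apply: (@rcont_comp _ (fun u => g z - u) _ _ (rcont_g tI)).
    by apply: contB; [exact: cont_cst|exact: cont_id].
  apply: (rcont_cts c1) => a b; have := cm_ge_dist a b; have := cm_ge_dist b a.
  by rewrite (cm_dist b) ler_norml; lra.
by apply: continuous_ln; rewrite cm_gt0 subr_eq0 g_neq.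
Qed.

Lemma off_axis z : strip dl z -> Im z != 0 -> exists r m : R,
  [/\ 0 < r, 0 < m, forall w, cm (w - z) < r -> strip dl w /\ Im w != 0 &
   forall w t, cm (w - z) < r -> -1 <= t <= 1 -> m <= cm (g w - g t%:C)].
Proof.
move=> hz z0; have [r r0 Hr] := strip_ball hz.
have iz : 0 < `|Im z| by rewrite normr_gt0.
exists (Num.min r (`|Im z| / 2)), (`|Im z| / 4); split.
- by rewrite lt_min r0 divr_gt0.
- by rewrite divr_gt0.
- move=> w; rewrite lt_min => /andP[w1 w2]; split; first exact: Hr.
  rewrite -normr_gt0; have := Im_le_cm (w - z); rewrite cImB.
  have := ler_normB (Im w) (Im w - Im z); rewrite opprB addrC subrK; lra.
move=> w t; rewrite lt_min => /andP[w1 w2] tI.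
have := g_sep (Hr _ w1) tI; have := Im_le_cm (w - z); rewrite cImB.
have := ler_normB (Im w) (Im w - Im z); rewrite opprB addrC subrK; lra.
Qed.

Lemma lip_of_cd (F F1 : C -> C) z r B w : cm (w - z) < r ->
  (forall x, cm (x - z) < r -> cd F x (F1 x)) ->
  (forall x, cm (x - z) < r -> cm (F1 x) <= B) ->
  cm (F w - F z) <= B * cm (w - z).
Proof.
move=> wr HF HB.
have hs (s : R) : 0 <= s <= 1 -> cm (z + s%:C * (w - z) - z) < r.
  move=> /andP[s0 s1]; apply: le_lt_trans wr.
  by rewrite addrAC subrr add0r cmM cmR ger0_norm// ler_piMl ?cm_ge0.
by apply: (@mvt_cd _ F F1) => s s01; [apply: HF|apply: HB]; exact: hs.
Qed.

Lemma q_bound t : cm (q t)%:C <= Q.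
Proof. by rewrite cmR; exact: dn_bd D t. Qed.

Lemma M_ge0 : 0 <= M. Proof. by have := cv_M H; lra. Qed.

Lemma Sp_gd z : strip dl z -> Im z != 0 -> gd Sp z (sg z).
Proof.
move=> hz z0; have [r [m [r0 m0 Hr Hm]]] := off_axis hz z0.
have Q0 := dn_Q D; have M0 := M_ge0.
have B0 : 0 <= M / m + (M / m) ^+ 2 by rewrite addr_ge0 ?sqr_ge0// divr_ge0// ltW.
apply: (@gd_rI _ (-1) 1 (fun w t => q t * ln (cm (g w - g t%:C)))
   (fun w t => (q t)%:C * K0 g g1 (g t%:C) w) z r (Q * (M / m + (M / m) ^+ 2))) => //.
- exact: mulr_ge0.
- move=> w t wr tI; have [hw w0] := Hr w wr; apply: gdZ.
  have gn : g w - g t%:C != 0 by rewrite subr_eq0 g_neq.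
  have := gd_comp (cdB (cv_d1 H hw) (cd_cst (g t%:C) w)) (gd_lncm gn).
  by rewrite subr0 mulrC.
- move=> w t wr tI; rewrite -mulrBr cmM -mulrA; apply: ler_pM; rewrite ?cm_ge0 ?q_bound//.
  apply: (lip_of_cd (F1 := K1 g g1 g2 (g t%:C)) wr) => x xr; have [hx x0] := Hr x xr.
  + by apply: (K0_cd H) => //; exact: g_neq.
  + by apply: (K1_bound H) => //; exact: Hm.
- by move=> w /Hr[hw w0]; exact: itg_ln.
- exact: citg_K0.
Qed.

Lemma sg_cd z : strip dl z -> Im z != 0 -> cd sg z (sg1 z).
Proof.
move=> hz z0; have [r [m [r0 m0 Hr Hm]]] := off_axis hz z0.
have Q0 := dn_Q D; have M0 := M_ge0.
set B := M / m + 3 * (M / m) ^+ 2 + 2 * (M / m) ^+ 3.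
have Mm : 0 <= M / m by rewrite divr_ge0// ltW.
have B0 : 0 <= B by have := exprn_ge0 2 Mm; have := exprn_ge0 3 Mm; rewrite /B; lra.
apply: (@cd_cI _ (-1) 1 (fun w t => (q t)%:C * K0 g g1 (g t%:C) w)
   (fun w t => (q t)%:C * K1 g g1 g2 (g t%:C) w) z r (Q * B)) => //.
- exact: mulr_ge0.
- move=> w t wr tI; have [hw w0] := Hr w wr; apply: cdZ.
  by apply: (K0_cd H) => //; exact: g_neq.
- move=> w t wr tI; rewrite -mulrBr cmM -mulrA; apply: ler_pM; rewrite ?cm_ge0 ?q_bound//.
  apply: (lip_of_cd (F1 := K2 g g1 g2 g3 (g t%:C)) wr) => x xr; have [hx x0] := Hr x xr.
  + by apply: (K1_cd H) => //; exact: g_neq.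
  + by apply: (K2_bound H) => //; exact: Hm.
- by move=> w /Hr[hw w0]; exact: citg_K0.
- exact: citg_K1.
Qed.

Lemma sg1_cont z : strip dl z -> Im z != 0 -> ccont sg1 z.
Proof.
move=> hz z0; have [r [m [r0 m0 Hr Hm]]] := off_axis hz z0.
have Q0 := dn_Q D; have M0 := M_ge0.
set B := M / m + 3 * (M / m) ^+ 2 + 2 * (M / m) ^+ 3.
have Mm : 0 <= M / m by rewrite divr_ge0// ltW.
have B0 : 0 <= B by have := exprn_ge0 2 Mm; have := exprn_ge0 3 Mm; rewrite /B; lra.
move=> e e0; have p : 0 < Q * B * 2 + 1 by rewrite ltr_wpDl// !mulr_ge0.
exists (Num.min r (e / (Q * B * 2 + 1))); first by rewrite lt_min r0 divr_gt0.
move=> w; rewrite lt_min => /andP[wr we].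
have [hw w0] := Hr w wr.
rewrite /sg1 -cIB; [|exact: citg_K1|exact: citg_K1].
apply: (@le_lt_trans _ _ (Q * B * cm (w - z) * (1 - -1))).
  apply: cI_bound; [lra|by apply: citgB; exact: citg_K1|].
  move=> t tI; rewrite -mulrBr cmM -mulrA; apply: ler_pM; rewrite ?cm_ge0 ?q_bound//.
  apply: (lip_of_cd (F1 := K2 g g1 g2 g3 (g t%:C)) wr) => x xr; have [hx x0] := Hr x xr.
  + by apply: (K1_cd H) => //; exact: g_neq.
  + by apply: (K2_bound H) => //; exact: Hm.
rewrite ltr_pdivlMr// in we; have := cm_ge0 (w - z); lra.
Qed.

(* [Rk] is the kernel of [sg] minus the Cauchy kernel; it stays bounded up to the axis. *)
Definition Rk z (t : R) := K0 g g1 (g t%:C) z - (z - t%:C)^-1.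
Definition om z : C := cI (-1) 1 (fun t => (q t)%:C * Rk z t).
Definition Ct z : C := cI (-1) 1 (fun t => (q t)%:C * (z - t%:C)^-1).

Lemma z_sub_neq0 z (t : R) : Im z != 0 -> z - t%:C != 0.
Proof. by move=> z0; apply: contra z0 => /eqP zt; rewrite -(Im_sub_real z t) zt. Qed.

Lemma rcont_pole z (t : R) : Im z != 0 -> rcont (fun s : R => (z - s%:C)^-1) t.
Proof.
move=> z0; apply: (@rcont_comp _ (fun u => (z - u)^-1) _ _ (rcont_ofR t)).
apply: contV; first exact: z_sub_neq0.
by apply: contB; [exact: cont_cst|exact: cont_id].
Qed.

Lemma citg_pole z : Im z != 0 -> citg (-1) 1 (fun t => (q t)%:C * (z - t%:C)^-1).
Proof.
move=> z0; apply: citg_cont => t tI; apply: rcontM; first exact: rcont_q.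
exact: rcont_pole.
Qed.

Lemma rcont_Rk z t : strip dl z -> -1 <= t <= 1 -> Im z != 0 -> rcont (Rk z) t.
Proof.
move=> hz tI z0.
have -> : Rk z = (fun s => K0 g g1 (g s%:C) z + -1 * (z - s%:C)^-1).
  by apply/funext => s; rewrite /Rk mulN1r.
apply: rcontD; first exact: rcont_K0.
by apply: rcontM; [exact: rcont_cst|exact: rcont_pole].
Qed.

Lemma citg_Rk z : strip dl z -> Im z != 0 -> citg (-1) 1 (fun t => (q t)%:C * Rk z t).
Proof.
move=> hz z0; apply: citg_cont => t tI; apply: rcontM; first exact: rcont_q.
exact: rcont_Rk.
Qed.

Lemma sg_split z : strip dl z -> Im z != 0 -> sg z = Ct z + om z.
Proof.
move=> hz z0; rewrite /Ct /om -cID; [|exact: citg_pole|exact: citg_Rk].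
by apply: cI_ext => t _; rewrite /Rk; ring.
Qed.

(** It is the bound of [K1_regular] for distances at most five, which gives [1 + 5 ^+ 2]. *)
Definition Bk := 16 * (26 * M ^+ 2).

Lemma Bk_ge0 : 0 <= Bk. Proof. by rewrite /Bk; have := sqr_ge0 M; lra. Qed.

Lemma Rk_cd z t : strip dl z -> strip dl t%:C -> z != t%:C ->
  cd (fun w => Rk w t) z (K1 g g1 g2 (g t%:C) z + (z - t%:C)^-1 ^+ 2).
Proof.
move=> hz tI z0.
have zt : z - t%:C != 0 by rewrite subr_eq0.
have gn : g z != g t%:C by apply: contra z0 => /eqP /(cv_inj H hz tI) ->.
have := cdB (K0_cd H hz gn) (@cdV _ (fun w => w - t%:C) _ _ zt (cdB (cd_id z) (cd_cst t%:C z))).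
by congr cd; rewrite subr0 mulNr opprK mul1r exprVn.
Qed.

Lemma Rk_bound z t : strip dl z -> -1 - dl < t < 1 + dl -> z != t%:C ->
  cm (K1 g g1 g2 (g t%:C) z + (z - t%:C)^-1 ^+ 2) <= Bk.
Proof.
move=> hz tI zt.
have ht : strip dl t%:C.
  by rewrite /strip /= normr0 (cv_dl H) andbT ltr_norml; lra.
apply: (le_trans (K1_regular H hz ht zt)).
have dl1 := cv_dl1 H.
have cz : cm (z - t%:C) <= 5.
  move: hz => /andP[]; rewrite !ltr_norml => h1 h2.
  apply: (le_trans (cm_le_ReIm _)); rewrite Im_sub_real cReB /=.
  have a1 : `|Re z - t| <= 4 by rewrite ler_norml; lra.
  have a2 : `|Im z| <= 1 by rewrite ler_norml; lra.
  lra.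
have c2 : cm (z - t%:C) ^+ 2 <= 25.
  have -> : 25 = 5 ^+ 2 :> R by rewrite expr2; lra.
  by apply: lerXn2r; rewrite ?nnegrE ?cm_ge0.
have := sqr_ge0 M; rewrite /Bk => M2; nra.
Qed.

Lemma real_strip (t : R) : -1 - dl < t < 1 + dl -> strip dl t%:C.
Proof.
by move=> tI; rewrite /strip /= normr0 (cv_dl H) andbT ltr_norml; lra.
Qed.

(* The bound also holds for points on opposite sides of the axis, the segment meeting the axis away from [t]. *)
Lemma Rk_lip z w t : strip dl z -> strip dl w -> -1 - dl < t < 1 + dl ->
  (forall s : R, 0 <= s <= 1 -> z + s%:C * (w - z) != t%:C) ->
  cm (Rk w t - Rk z t) <= Bk * cm (w - z).
Proof.
move=> hz hw tI zt.
apply: (@mvt_cd _ (fun x => Rk x t) (fun x => K1 g g1 g2 (g t%:C) x + (x - t%:C)^-1 ^+ 2)) => s s01.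
- by apply: Rk_cd; [exact: strip_seg|exact: real_strip|exact: zt].
- by apply: Rk_bound; [exact: strip_seg|by []|exact: zt].
Qed.

Lemma Im_seg z w (s : R) : Im (z + s%:C * (w - z)) = Im z + s * (Im w - Im z).
Proof. by rewrite !cE /= mul0r addr0. Qed.

Lemma Re_seg z w (s : R) : Re (z + s%:C * (w - z)) = Re z + s * (Re w - Re z).
Proof. by rewrite !cE /= mul0r subr0. Qed.

Lemma om_lip z w : strip dl z -> strip dl w -> 0 < Im z * Im w ->
  cm (om w - om z) <= 2 * Q * Bk * cm (w - z).
Proof.
move=> hz hw zw; have Q0 := dn_Q D.
have z0 : Im z != 0 by apply: contraTneq zw => ->; rewrite mul0r ltxx.
have w0 : Im w != 0 by apply: contraTneq zw => ->; rewrite mulr0 ltxx.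
rewrite /om -cIB; [|exact: citg_Rk|exact: citg_Rk].
have -> : 2 * Q * Bk * cm (w - z) = Q * (Bk * cm (w - z)) * (1 - -1) by ring.
apply: cI_bound; [lra|by apply: citgB; exact: citg_Rk|].
move=> t tI; rewrite -mulrBr cmM; apply: ler_pM; rewrite ?cm_ge0 ?q_bound//.
have d0 := cv_dl H.
apply: Rk_lip => //; first by apply/andP; split; lra.
move=> s /andP[s0 s1]; apply: contraTneq zw => E.
have : Im (z + s%:C * (w - z)) = 0 by rewrite E.
rewrite Im_seg => h; rewrite -leNgt.
nra.
Qed.

(** The remainder [om] has no jump at the axis, so the jump of the normal derivative of the
    potential comes from the Cauchy integral [Ct] alone. *)
Lemma om_cross z : strip dl z -> Im z != 0 ->
  cm (om z - om (cj z)) <= 4 * Q * Bk * `|Im z|.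
Proof.
move=> hz z0; have Q0 := dn_Q D; have B0 := Bk_ge0.
have hj := strip_cj hz.
have j0 : Im (cj z) != 0 by rewrite cImJ oppr_eq0.
have zj : cm (z - cj z) = 2 * `|Im z|.
  have -> : z - cj z = iC * (2 * Im z)%:C by apply: c_eqP; rewrite !cE /=; ring.
  by rewrite cmM cm_i mul1r cmR normrM gtr0_norm.
rewrite /om -cIB; [|exact: citg_Rk|exact: citg_Rk].
have -> : 4 * Q * Bk * `|Im z| = Q * (Bk * (2 * `|Im z|)) * (1 - -1) by ring.
apply: cI_bound; [lra|by apply: citgB; exact: citg_Rk|].
move=> t tI; rewrite -mulrBr cmM; apply: ler_pM; rewrite ?cm_ge0 ?q_bound//.
have d0 := cv_dl H.
have off s : -1 - dl < s < 1 + dl -> s != Re z ->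
    cm (Rk z s - Rk (cj z) s) <= Bk * (2 * `|Im z|).
  move=> sI sz; rewrite -zj; apply: Rk_lip => // u _.
  apply: contra sz => /eqP E.
  have : Re (cj z + u%:C * (z - cj z)) = s by rewrite E.
  by rewrite Re_seg cReJ subrr mulr0 addr0 => ->.
(* Only [t = Re z] puts the pole on the segment from [cj z] to [z]. That value is approached by
   [t + k], which may exceed one; hence the range beyond [[-1, 1]] in [Rk_lip]. *)
have [tz|tz] := eqVneq t (Re z); last by apply: off => //; apply/andP; split; lra.
apply/ler_addgt0Pl => e e0.
have cR : rcont (fun s => Rk z s + -1 * Rk (cj z) s) t.
  apply: rcontD; first exact: rcont_Rk.
  by apply: rcontM; [exact: rcont_cst|exact: rcont_Rk].
have [d dd Hd] := cR e e0.
pose k := Num.min (d / 2) (dl / 2).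
have k0 : 0 < k by rewrite /k lt_min !divr_gt0.
have kd : k < d by rewrite /k gt_min; apply/orP; left; lra.
have kl : k < dl by rewrite /k gt_min; apply/orP; right; lra.
have ktk : `|t + k - t| < d by rewrite addrAC subrr add0r gtr0_norm.
have := Hd (t + k) ktk; rewrite !mulN1r => h1.
have h2 : cm (Rk z (t + k) - Rk (cj z) (t + k)) <= Bk * (2 * `|Im z|).
  apply: off; first by apply/andP; split; lra.
  by rewrite -tz -subr_eq0 addrAC subrr add0r gt_eqF.
move: h1 h2; set A := Rk z (t + k) - _; set B := Rk z t - _ => h1 h2.
have := cmB A (A - B); have -> : A - (A - B) = B by ring.
lra.
Qed.
End Kernels.
End Potential.

(** * Boundary behaviour of the potential *)

Section UpperLimit.
Context {R : realType}.
Local Notation C := R[i].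
Implicit Types (z w l : C) (F G : C -> C).

Definition uplim F z l := forall e : R, 0 < e -> exists2 d : R, 0 < d &
  forall w, cm (w - z) < d -> 0 < Im w -> cm (F w - l) < e.

Lemma uplimD F G z l m : uplim F z l -> uplim G z m -> uplim (fun w => F w + G w) z (l + m).
Proof.
move=> hF hG e e0; have e2 : 0 < e / 2 by rewrite divr_gt0.
have [d d0 H] := hF _ e2; have [d' d'0 H'] := hG _ e2.
exists (Num.min d d'); first by rewrite lt_min d0.
move=> w; rewrite lt_min => /andP[w1 w2] w0.
have -> : F w + G w - (l + m) = (F w - l) + (G w - m) by ring.
by apply: le_lt_trans (cmD _ _) _; have := H w w1 w0; have := H' w w2 w0; lra.
Qed.

Lemma uplimM F G z l m : uplim F z l -> uplim G z m -> uplim (fun w => F w * G w) z (l * m).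
Proof.
move=> hF hG e e0.
have a0 : 0 < cm m + 1 by have := cm_ge0 m; lra.
have b0 : 0 < cm l + 1 by have := cm_ge0 l; lra.
have [d d0 H] := hF (e / 2 / (cm m + 1)) ltac:(by rewrite !divr_gt0).
have [d' d'0 H'] := hG (Num.min 1 (e / 2 / (cm l + 1))) ltac:(by rewrite lt_min !divr_gt0 // ltr01).
exists (Num.min d d'); first by rewrite lt_min d0.
move=> w; rewrite lt_min => /andP[w1 w2] w0.
have := H w w1 w0; have := H' w w2 w0; rewrite lt_min !ltr_pdivlMr// => /andP[h1 h2] h3.
have -> : F w * G w - l * m = (F w - l) * G w + l * (G w - m) by ring.
apply: le_lt_trans (cmD _ _) _; rewrite !cmM.
have h4 : cm (G w) <= cm m + 1.
  by have := cmD (G w - m) m; rewrite subrK; lra.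
have h5 : cm (F w - l) * cm (G w) <= cm (F w - l) * (cm m + 1) by rewrite ler_wpM2l ?cm_ge0.
have := cm_ge0 (G w - m); lra.
Qed.

Lemma uplim_cont F z : ccont F z -> uplim F z (F z).
Proof. by move=> cF e /cF[d d0 H]; exists d => // w /H. Qed.

Lemma uplimN F z l : uplim F z l -> uplim (fun w => - F w) z (- l).
Proof.
move=> H e /H[d d0 Hd]; exists d => // w wd w0.
have -> : - F w - - l = - (F w - l) by ring.
by rewrite cmN Hd.
Qed.

Lemma uplim_ext F G z l (r : R) : 0 < r ->
  (forall w, cm (w - z) < r -> 0 < Im w -> F w = G w) -> uplim F z l -> uplim G z l.
Proof.
move=> r0 FG H e /H[d d0 Hd]; exists (Num.min d r); first by rewrite lt_min d0.
by move=> w; rewrite lt_min => /andP[wd wr] w0; rewrite -FG//; exact: Hd.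
Qed.

Lemma uplim_ReIm F z l : uplim (fun w => (Re (F w))%:C) z (Re l)%:C ->
  uplim (fun w => (Im (F w))%:C) z (Im l)%:C -> uplim F z l.
Proof.
move=> h1 h2.
have := uplimD h1 (uplimM (uplim_cont (cont_cst iC z)) h2).
rewrite -cm_split; apply: uplim_ext ltr01 _ => w _ _.
by rewrite -cm_split.
Qed.

End UpperLimit.

Section CauchyKernel.
Context {R : realType}.
Local Notation C := R[i].
Implicit Types (z w l : C).

Lemma cVE (a b : R) : (a +i* b)^-1 = (a / (a ^+ 2 + b ^+ 2)) +i* (- (b / (a ^+ 2 + b ^+ 2))).
Proof. by []. Qed.

(** This is the Poisson kernel of the upper half-plane multiplied by [pi]. *)
Definition pk (x y t : R) := y / ((x - t) ^+ 2 + y ^+ 2).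

Lemma pk_den (x y t : R) : 0 < y -> 0 < (x - t) ^+ 2 + y ^+ 2.
Proof. by move=> y0; rewrite ltr_wpDl ?sqr_ge0// exprn_gt0. Qed.

Lemma pk_ge0 (x y t : R) : 0 < y -> 0 <= pk x y t.
Proof. by move=> y0; rewrite divr_ge0 ?ltW// pk_den. Qed.

Lemma Im_pole z (t : R) : Im (z - t%:C)^-1 = - pk (Re z) (Im z) t.
Proof. by case: z => x y; rewrite /pk /= !subr0. Qed.

Lemma pk_cont (x y t : R) : 0 < y -> {for t, continuous (pk x y)}.
Proof.
move=> y0; apply: continuousM; first exact: cst_continuous.
apply: continuousV; first by rewrite gt_eqF// pk_den.
by apply: derive_continuous; exact: is_derive_shift_sqr.
Qed.

Lemma pk_rI (x y : R) : 0 < y ->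
  rI (-1) 1 (pk x y) = atan ((1 - x) / y) + atan ((1 + x) / y).
Proof.
move=> y0.
have dF (t : R) : is_derive t 1 (fun s => atan ((s - x) / y)) (pk x y t).
  have d0 : is_derive t 1 (fun s => (s - x) / y) (y^-1).
    apply: is_derive_eps => e e0; exists 1 => // h _.
    have -> : (t + h - x) / y - (t - x) / y - y^-1 * h = 0 by ring.
    by rewrite normr0 mulr_ge0// ltW.
  have := @is_derive1_comp _ (@atan R) (fun s => (s - x) / y) _ _ _ (is_derive1_atan _) d0.
  congr is_derive; rewrite /pk; field.
  by rewrite !gt_eqF// pk_den.
rewrite (@FTC _ (-1) 1 (fun s => atan ((s - x) / y)) (pk x y) ltac:(lra) (fun t _ => dF t)
  (fun t _ => @pk_cont x y t y0)).
have -> : (-1 - x) / y = - ((1 + x) / y) by ring.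
by rewrite atanN opprK.
Qed.

Lemma itg_pk (x y : R) : 0 < y -> itg (-1) 1 (pk x y).
Proof. by move=> y0; apply: itg_cont => t _; exact: pk_cont. Qed.

Lemma pk_le_pi (x y : R) : 0 < y -> rI (-1) 1 (pk x y) <= pi.
Proof.
move=> y0; rewrite pk_rI//.
have := atan_ltpi2 ((1 - x) / y); have := atan_ltpi2 ((1 + x) / y); lra.
Qed.

Lemma atan_large (e : R) : 0 < e -> exists2 A : R, 0 < A & forall u, A <= u -> pi / 2 - e < atan u.
Proof.
move=> e0; have /cvgrPdist_lt /(_ _ e0) [A [_ HA]] := @cvgy_atan R.
exists (Num.max 1 (A + 1)); first by rewrite lt_max ltr01.
move=> u; rewrite ge_max => /andP[u1 u2].
have /HA : A < u by lra.
by move=> /=; rewrite ltr_norml => /andP[_]; lra.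
Qed.

Lemma pk_mass (x0 e : R) : -1 < x0 < 1 -> 0 < e -> exists2 d : R, 0 < d &
  forall x y, `|x - x0| < d -> 0 < y < d -> `|rI (-1) 1 (pk x y) - pi| <= e.
Proof.
move=> xI e0; have [A A0 HA] := @atan_large (e / 2) ltac:(by rewrite divr_gt0).
pose s := Num.min (1 - x0) (1 + x0).
have s0 : 0 < s by rewrite lt_min; apply/andP; split; lra.
have s1 : s <= 1 - x0 by rewrite ge_min lexx.
have s2 : s <= 1 + x0 by rewrite ge_min lexx orbT.
exists (Num.min (s / 2) (s / 2 / A)); first by rewrite lt_min !divr_gt0.
move=> x y; rewrite !lt_min ltr_norml => /andP[/andP[h1 h2] _] /andP[y0 /andP[_]].
rewrite ltr_pdivlMr// => yA.
rewrite ler_norml; apply/andP; split; last by have := pk_le_pi x y0; lra.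
rewrite pk_rI//.
have a1 : A <= (1 - x) / y by rewrite ler_pdivlMr//; lra.
have a2 : A <= (1 + x) / y by rewrite ler_pdivlMr//; lra.
have := HA _ a1; have := HA _ a2; lra.
Qed.

Section Density.
Context (q : R -> R) (Q L : R).
Variable D : density q Q L.

Lemma Im_Ct z : Im z != 0 -> Im (Ct q z) = - rI (-1) 1 (fun t => q t * pk (Re z) (Im z) t).
Proof.
move=> z0; rewrite /Ct Im_cI -[RHS]mulN1r -rIZ.
  by apply: rI_ext => t _; rewrite cImM [Re (_%:C)]/= [Im (_%:C)]/= Im_pole; ring.
have [_] := citg_pole D z0 => /itgN; congr (itg _ _ _); apply/funext => t.
by rewrite cImM [Re (_%:C)]/= [Im (_%:C)]/= Im_pole; ring.
Qed.

Lemma itg_q_pk (x y : R) : 0 < y -> itg (-1) 1 (fun t => q t * pk x y t).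
Proof.
move=> y0; apply: itg_cont => t _; apply: continuousM; first exact: dn_cont D.
exact: pk_cont.
Qed.

(** The inequality [|t - x| <= s + (x - t) ^+ 2 / s] splits the Lipschitz bound without cutting the
    interval: the first term meets the mass of the kernel, at most [pi], and in the second the
    kernel times [(x - t) ^+ 2] is at most [y]. *)
Lemma q_pk_sub (x y s : R) : 0 < y -> 0 < s ->
  `|rI (-1) 1 (fun t => q t * pk x y t) - q x * rI (-1) 1 (pk x y)| <= L * (s * pi + 2 * y / s).
Proof.
move=> y0 s0; have L0 := dn_L D.
have iq := itg_q_pk x y0; have ip := itg_pk x y0.
rewrite -rIZ// -rIB//; last exact: itgZ.
have i1 : itg (-1) 1 (fun t => L * (s * pk x y t + y / s)).
  by apply: itgZ; apply: itgD; [exact: itgZ|exact: itg_cst].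
have ia : itg (-1) 1 (fun t => q t * pk x y t - q x * pk x y t).
  by apply: itgB => //; exact: itgZ.
apply: (le_trans (rI_abs ia)).
apply: (@le_trans _ _ (rI (-1) 1 (fun t => L * (s * pk x y t + y / s)))).
  apply: rI_le => //; first exact: itg_abs.
  move=> t _; rewrite -mulrBl normrM (ger0_norm (pk_ge0 _ _ y0)).
  apply: (le_trans (ler_wpM2r (pk_ge0 _ _ y0) (dn_lip D _ _))).
  rewrite -mulrA ler_wpM2l//.
  have b1 : `|t - x| <= s + (x - t) ^+ 2 / s.
    have -> : (x - t) ^+ 2 = `|t - x| ^+ 2 by rewrite real_normK ?num_real//; ring.
    set a := `|t - x|; have a0 : 0 <= a by exact: normr_ge0.
    have -> : s + a ^+ 2 / s = a + ((a - s) ^+ 2 + a * s) / s by field; rewrite gt_eqF.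
    rewrite lerDl; apply: divr_ge0; last exact: ltW.
    by apply: addr_ge0; [exact: sqr_ge0|apply: mulr_ge0 => //; exact: ltW].
  apply: (le_trans (ler_wpM2r (pk_ge0 _ _ y0) b1)).
  rewrite mulrDl lerD2l /pk.
  have -> : (x - t) ^+ 2 / s * (y / ((x - t) ^+ 2 + y ^+ 2)) =
     ((x - t) ^+ 2 / ((x - t) ^+ 2 + y ^+ 2)) * (y / s).
    by field; rewrite !gt_eqF// pk_den.
  apply: ler_piMl; first by rewrite divr_ge0 ?ltW.
  by rewrite ler_pdivrMr ?pk_den// mul1r lerDl sqr_ge0.
rewrite rIZ; last by apply: itgD; [exact: itgZ|exact: itg_cst].
rewrite rID; [|exact: itgZ|exact: itg_cst].
rewrite rIZ// rI_cst; last lra.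
rewrite ler_wpM2l//.
have := ler_wpM2l (ltW s0) (pk_le_pi x y0); lra.
Qed.

Lemma mul_quarter (p e : R) : 0 < p -> p * (e / (4 * p)) = e / 4.
Proof. by move=> /gt_eqF p0; field; rewrite p0. Qed.

Lemma Im_Ct_lim (x0 : R) : -1 < x0 < 1 ->
  uplim (fun z => (Im (Ct q z))%:C) x0%:C (- (pi * q x0))%:C.
Proof.
move=> xI e e0; have L0 := dn_L D; have Q0 := dn_Q D; have pi0 := pi_gt0 R.
(* The scale [s] is fixed first, to make [L * s * pi] at most [e / 4]; the height is then taken
   small in comparison with [s]. *)
pose s := e / (4 * (L * pi + 1)).
have Lp : 0 < L * pi + 1 by have := mulr_ge0 L0 (ltW pi0); lra.
have s0 : 0 < s by rewrite divr_gt0// mulr_gt0.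
have [d d0 Hd] := @pk_mass x0 (e / (4 * (Q + 1))) xI ltac:(by rewrite divr_gt0// mulr_gt0//; lra).
pose k := Num.min (Num.min d (e * s / (8 * (L + 1)))) (e / (4 * (L * pi + 1))).
have L1 : 0 < L + 1 by lra.
have k0 : 0 < k by rewrite !lt_min d0 /=; apply/andP; split; apply: divr_gt0 => //; apply: mulr_gt0.
exists k => // z zk z0.
have x1 : `|Re z - x0| < k by apply: le_lt_trans zk; have := Re_le_cm (z - x0%:C); rewrite cReB.
have y1 : Im z < k by apply: le_lt_trans zk; have := Im_le_dist z x0; rewrite gtr0_norm.
have kd : k <= d by rewrite /k !ge_min lexx.
have kL : k <= e * s / (8 * (L + 1)) by rewrite /k !ge_min lexx orbT.
have kl : k <= e / (4 * (L * pi + 1)) by rewrite /k !ge_min lexx !orbT.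
rewrite Im_Ct ?gt_eqF// -!cRN -cRD cmR opprK.
set x := Re z in x1 *; set y := Im z in z0 y1 *.
have h1 := q_pk_sub x z0 s0.
have h2 := Hd x y ltac:(lra) ltac:(lra).
have h3 := dn_lip D x x0.
set I := rI _ _ _ in h1 *; set J := rI _ _ (pk x y) in h1 h2.
have -> : - I + pi * q x0 = - (I - q x * J) - q x * (J - pi) - pi * (q x - q x0) by ring.
have n1 := ler_normB (- (I - q x * J) - q x * (J - pi)) (pi * (q x - q x0)).
have n2 := ler_normB (- (I - q x * J)) (q x * (J - pi)).
rewrite normrN in n2; rewrite normrM in n2; rewrite normrM (gtr0_norm pi0) in n1.
have b1 : L * (s * pi + 2 * y / s) <= e / 2.
  have -> : L * (s * pi + 2 * y / s) = L * pi * s + 2 * L * (y / s) by field; rewrite gt_eqF.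
  have c1 : L * pi * s <= e / 4.
    have : (L * pi + 1) * s = e / 4 by rewrite /s mul_quarter.
    lra.
  have c2 : y / s <= e / (8 * (L + 1)).
    rewrite ler_pdivrMr//; have -> : e / (8 * (L + 1)) * s = e * s / (8 * (L + 1)) by ring.
    lra.
  have c3 : (L + 1) * (e / (8 * (L + 1))) = e / 8 by field; rewrite gt_eqF//; lra.
  have c4 : 0 <= e / (8 * (L + 1)) by rewrite divr_ge0 ?mulr_ge0//; lra.
  have c5 := ler_wpM2l L0 c2.
  lra.
have b2 : `|q x| * `|J - pi| < e / 4.
  have c1 := dn_bd D x.
  have c2 : (Q + 1) * (e / (4 * (Q + 1))) = e / 4 by field; rewrite gt_eqF//; lra.
  have c3 : 0 < e / (4 * (Q + 1)) by rewrite divr_gt0 ?mulr_gt0//; lra.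
  have c4 : `|q x| * `|J - pi| <= Q * (e / (4 * (Q + 1))) by apply: ler_pM.
  lra.
have b3 : pi * `|q x - q x0| <= e / 4.
  have c1 : pi * `|q x - q x0| <= pi * (L * `|x - x0|) by rewrite ler_wpM2l// ltW.
  have c2 : pi * L * `|x - x0| <= pi * L * k.
    by apply: ler_wpM2l; [apply: mulr_ge0 => //|]; exact: ltW.
  have c3 : (L * pi + 1) * k <= e / 4.
    have := mul_quarter e Lp.
    by have := ler_wpM2l (ltW Lp) kl; lra.
  lra.
lra.
Qed.
End Density.
End CauchyKernel.

(** * The vertical derivative of the Cauchy integral *)

Section CauchyDerivative.
Context {R : realType}.
Local Notation C := R[i].
Implicit Types (z w l : C).

(** For the straight segment [sg] is the Cauchy integral [Ct], so the differentiation of [sg] also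
    covers [Ct]. *)
Lemma curve_id : @curve_data R id (fun=> 1) (fun=> 0) (fun=> 0) 1 1.
Proof.
split => //; try lra.
- by move=> z _; exact: cd_id.
- by move=> z _; exact: cd_cst.
- by move=> z _; exact: cd_cst.
- by move=> z _; rewrite cm1.
- by move=> z _; rewrite cm0.
- by move=> z _; rewrite cm0.
- by move=> z _ /=; lra.
Qed.

Context (q : R -> R) (Q L : R).
Variable D : density q Q L.

Definition Ct1 z : C := cI (-1) 1 (fun t => (q t)%:C * - ((z - t%:C)^-1 ^+ 2)).

Lemma Ct_cd z : strip 1 z -> Im z != 0 -> cd (Ct q) z (Ct1 z).
Proof.
move=> hz z0; have := sg_cd curve_id D hz z0.
rewrite (_ : sg _ _ _ = Ct q); last first.
  by apply/funext => w; apply: cI_ext => t _; rewrite /K0 mul1r.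
congr cd; apply: cI_ext => t _; rewrite /K1 mul0r sub0r mul1r.
by [].
Qed.

Lemma rcont_pole2 z (t : R) : Im z != 0 -> rcont (fun s : R => - ((z - s%:C)^-1 ^+ 2)) t.
Proof.
move=> z0; have h := @rcont_pole _ z t z0.
have -> : (fun s : R => - ((z - s%:C)^-1 ^+ 2)) = (fun s => -1 * ((z - s%:C)^-1 * (z - s%:C)^-1)).
  by apply/funext => s; rewrite mulN1r expr2.
by apply: rcontM; [exact: rcont_cst|exact: rcontM].
Qed.

Lemma citg_pole2 z : Im z != 0 -> citg (-1) 1 (fun s : R => - ((z - s%:C)^-1 ^+ 2)).
Proof. by move=> z0; apply: citg_cont => t _; exact: rcont_pole2. Qed.

Lemma citg_q_pole2 z : Im z != 0 -> citg (-1) 1 (fun t : R => (q t)%:C * - ((z - t%:C)^-1 ^+ 2)).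
Proof.
move=> z0; apply: citg_cont => t _; apply: rcontM; last exact: rcont_pole2.
exact: (rcont_q D).
Qed.

Lemma cI_pole2 z : Im z != 0 ->
  cI (-1) 1 (fun s : R => - ((z - s%:C)^-1 ^+ 2)) = (z + 1)^-1 - (z - 1)^-1.
Proof.
move=> z0.
rewrite (@cFTC _ (-1) 1 (fun s : R => - (z + s%:C * -1)^-1)); first last.
- by move=> t _; exact: rcont_pole2.
- move=> t _; have zt := @z_sub_neq0 _ z t z0.
  have E : z + t%:C * -1 = z - t%:C by ring.
  have := cd_rd (cdN (@cdV _ id (z + t%:C * -1) 1 _ (cd_id (z + t%:C * -1)))).
  rewrite E => /(_ zt); rewrite [X in rd _ _ X -> _](_ : _ = - ((z - t%:C)^-1 ^+ 2))//.
  by rewrite mulrN1 opprK mulNr mul1r exprVn.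
- lra.
by rewrite addrC opprK; congr (_^-1 + - _^-1); apply: c_eqP; rewrite !cE /=; ring.
Qed.

Lemma Im_pole2 z (t : R) : 0 < Im z -> Im (- ((z - t%:C)^-1 ^+ 2)) =
  2 * (Re z - t) * Im z / ((Re z - t) ^+ 2 + Im z ^+ 2) ^+ 2.
Proof.
case: z => x y; rewrite [Im (_ +i* _)]/= [Re (_ +i* _)]/= => y0; have b0 := pk_den x t y0.
have -> : (x +i* y) - t%:C = (x - t) +i* y by apply: c_eqP; rewrite !cE /=; ring.
rewrite cVE cImN expr2 cImM /=.
move: b0; set a := x - t; set b := a ^+ 2 + y ^+ 2 => b0.
by field; rewrite gt_eqF.
Qed.

(* Only the imaginary part is bounded: [|z - t|^-2 |q t - q x|] alone would give a logarithm. *)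
Lemma Im_Ct1_bound z (r : R) : 0 < Im z -> 0 < r -> `|Re z| <= 1 - r ->
  `|Im (Ct1 z)| <= 2 * L * pi + Q * (2 / r).
Proof.
move=> z0 r0 zr; have zn : Im z != 0 by rewrite gt_eqF.
have L0 := dn_L D; have Q0 := dn_Q D.
set x := Re z in zr; set y := Im z in z0.
pose P t := - ((z - t%:C)^-1 ^+ 2).
have iP : citg (-1) 1 P by exact: citg_pole2.
have iqP : citg (-1) 1 (fun t => (q t)%:C * P t) by exact: citg_q_pole2.
(* Subtracting [q x] lets the Lipschitz bound remove one power of the singularity, leaving [2 * L]
   times the Poisson kernel. The subtracted integral is explicit and bounded, as [Re z] keeps
   distance [r] from both ends. *)
have E : Ct1 z = cI (-1) 1 (fun t => (q t)%:C * P t - (q x)%:C * P t) + (q x)%:C * cI (-1) 1 P.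
  by rewrite cIB ?cIZ ?subrK//; exact: citgZ.
have ib : citg (-1) 1 (fun t => (q t)%:C * P t - (q x)%:C * P t).
  by apply: citgB => //; exact: citgZ.
rewrite E cImD; apply: (le_trans (ler_normD _ _)); apply: lerD.
  rewrite Im_cI; apply: (le_trans (rI_abs ib.2)).
  have i2 : itg (-1) 1 (fun t => 2 * L * pk x y t) by apply: itgZ; exact: itg_pk.
  apply: (@le_trans _ _ (rI (-1) 1 (fun t => 2 * L * pk x y t))).
    apply: rI_le => //; first exact: itg_abs ib.2.
    move=> t _; rewrite -mulrBl -cRN -cRD cImM [Im _%:C]/= mul0r addr0 [Re _%:C]/= normrM.
    rewrite /P Im_pole2// -/x -/y.
    have b0 := pk_den x t z0; rewrite /pk.
    move: b0; set b := (x - t) ^+ 2 + y ^+ 2 => b0.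
    have -> : `|2 * (x - t) * y / b ^+ 2| = 2 * `|x - t| * y / b ^+ 2.
      by rewrite !normrM normfV (ger0_norm (sqr_ge0 b)) (gtr0_norm z0) ger0_norm.
    have h1 := dn_lip D t x; rewrite distrC in h1 *.
    have p : 0 <= 2 * `|x - t| * y / b ^+ 2.
      by apply: divr_ge0; [apply: mulr_ge0; [apply: mulr_ge0|exact: ltW]|exact: sqr_ge0].
    apply: (le_trans (ler_wpM2r p h1)).
    have -> : L * `|t - x| * (2 * `|x - t| * y / b ^+ 2) = 2 * L * ((x - t) ^+ 2 / b) * (y / b).
      rewrite [`|t - x|]distrC -[(x - t) ^+ 2]real_normK ?num_real//.
      by field; rewrite gt_eqF.
    apply: ler_wpM2r; first by apply: divr_ge0; exact: ltW.
    apply: ler_piMr; first by rewrite mulr_ge0.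
    by rewrite ler_pdivrMr// mul1r lerDl sqr_ge0.
  rewrite rIZ; last exact: itg_pk.
  by rewrite ler_wpM2l ?mulr_ge0 ?pk_le_pi.
rewrite cImM [Im _%:C]/= mul0r addr0 [Re _%:C]/= normrM.
apply: ler_pM => //; first exact: dn_bd D x.
rewrite cI_pole2//; apply: (le_trans (Im_le_cm _)); apply: (le_trans (cmB _ _)).
have iv w : r <= `|Re w| -> cm w^-1 <= r^-1.
  move=> h; have h2 := Re_le_cm w; rewrite cmV lef_pV2 ?posrE//; lra.
have a1 : cm (z + 1)^-1 <= r^-1.
  apply: iv; rewrite cReD /= -/x; move: zr; rewrite ler_norml => /andP[h1 h2].
  rewrite ger0_norm; lra.
have a2 : cm (z - 1)^-1 <= r^-1.
  apply: iv; rewrite cReB /= -/x; move: zr; rewrite ler_norml => /andP[h1 h2].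
  rewrite ler0_norm; lra.
have -> : 2 / r = r^-1 + r^-1 by ring.
by apply: lerD.
Qed.

(** Moving vertically, [Re Ct] changes at the rate [- Im Ct1], which is the part of [Ct1] that stays
    bounded. *)
Lemma Re_Ct_vert (x y y' r : R) : 0 < r -> `|x| <= 1 - r -> 0 < y -> y <= y' -> y' < 1 ->
  `|Re (Ct q (x +i* y')) - Re (Ct q (x +i* y))| <= (2 * L * pi + Q * (2 / r)) * (y' - y).
Proof.
move=> r0 xr y0 yy y1.
have E : (x +i* y') - (x +i* y) = (y' - y)%:C * iC by apply: c_eqP; rewrite !cE /=; ring.
have hs (s : R) : 0 <= s <= 1 -> let w := (x +i* y) + s%:C * ((x +i* y') - (x +i* y)) in
    [/\ Re w = x, 0 < Im w & Im w < 1].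
  move=> /andP[s0 s1] w; rewrite /w Im_seg Re_seg /= subrr mulr0 addr0.
  have h : 0 <= s * (y' - y) by rewrite mulr_ge0// subr_ge0.
  have h' : s * (y' - y) <= y' - y by rewrite ler_piMl// subr_ge0.
  by split => //; lra.
have [|s s01 ->] := @mvt_gd_ex _ (fun w => Re (Ct q w)) Ct1 (x +i* y) (x +i* y').
  move=> s /hs[h1 h2 h3]; apply: cd_gdRe; apply: Ct_cd; last by rewrite gt_eqF.
  by rewrite /strip h1; apply/andP; split; [lra|rewrite gtr0_norm].
have [h1 h2 h3] := hs s ltac:(lra).
set w := _ + _ in h1 h2 h3 *.
rewrite E.
have -> : Re (Ct1 w * ((y' - y)%:C * iC)) = - (Im (Ct1 w) * (y' - y)) by rewrite !cE /=; ring.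
rewrite normrN normrM [X in _ * X <= _]ger0_norm ?subr_ge0// ler_wpM2r ?subr_ge0//.
by apply: Im_Ct1_bound => //; rewrite h1.
Qed.

End CauchyDerivative.

Section VerticalLimit.
Context {R : realType}.
Local Notation C := R[i].
Implicit Types (z w l : C).

(* [u (x0 + i y) + B y] is nondecreasing in [y], hence converges to its infimum. *)
Lemma vertical_lim (u : C -> R) (x0 r B : R) : 0 < r -> 0 <= B ->
  (forall x y y', `|x - x0| < r -> 0 < y -> y <= y' -> y' < r ->
     `|u (x +i* y') - u (x +i* y)| <= B * (y' - y)) ->
  (forall y, 0 < y -> y < r -> ccont (fun w => (u w)%:C) (x0 +i* y)) ->
  exists l : R, uplim (fun w => (u w)%:C) x0%:C l%:C.
Proof.
move=> r0 B0 Hv Hc.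
have x00 : `|x0 - x0| < r by rewrite subrr normr0.
pose E := [set v : R | exists2 y, 0 < y < r & v = u (x0 +i* y) + B * y].
have r2 : 0 < r / 2 < r by apply/andP; split; lra.
have lbE : lbound E (u (x0 +i* (r / 2)) - B * r).
  move=> v [y /andP[y0 yr] ->].
  have [h|h] := leP y (r / 2).
  - have := Hv x0 y (r / 2) x00 y0 h ltac:(lra); rewrite ler_norml => /andP[_].
    have : B * (r / 2 - y) <= B * r by rewrite ler_wpM2l//; lra.
    have : 0 <= B * y by rewrite mulr_ge0// ltW.
    lra.
  - have := Hv x0 (r / 2) y x00 ltac:(lra) (ltW h) yr; rewrite ler_norml => /andP[+ _].
    have : B * (y - r / 2) <= B * r by rewrite ler_wpM2l//; lra.
    have : 0 <= B * y by rewrite mulr_ge0// ltW.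
    lra.
have hE : has_inf E.
  split; first by exists (u (x0 +i* (r / 2)) + B * (r / 2)); exists (r / 2).
  by exists (u (x0 +i* (r / 2)) - B * r).
pose l := inf E.
have Hl y : 0 < y -> y < r -> `|u (x0 +i* y) - l| <= B * y.
  move=> y0 yr; rewrite ler_norml; apply/andP; split.
    have : l <= u (x0 +i* y) + B * y.
      by apply: ge_inf; [exact: hE.2|exists y => //; rewrite y0].
    lra.
  apply/ler_addgt0Pl => e e0.
  have [v [y2 /andP[y20 y2r] ->] vl] := inf_adherent e0 hE.
  rewrite -/l in vl.
  have [h|h] := leP y2 y.
  - have := Hv x0 y2 y x00 y20 h yr; rewrite ler_norml => /andP[_].
    have : 0 <= B * y2 by rewrite mulr_ge0// ltW.
    lra.
  - have := Hv x0 y y2 x00 y0 (ltW h) y2r; rewrite ler_norml => /andP[+ _].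
    have : 0 <= B * y by rewrite mulr_ge0// ltW.
    lra.
exists l => e e0.
have B1 : 0 < B + 1 by lra.
(* A point near [x0] is compared with the limit through the fixed height [y1]: up along its
   vertical, across by continuity at [x0 +i* y1], and down over [x0]. *)
pose y1 := Num.min (r / 2) (e / (4 * (B + 1))).
have y10 : 0 < y1 by rewrite lt_min; apply/andP; split; [lra|apply: divr_gt0 => //; exact: mulr_gt0].
have y1r : y1 <= r / 2 by rewrite ge_min lexx.
have y1e : y1 <= e / (4 * (B + 1)) by rewrite ge_min lexx orbT.
have By : B * y1 <= e / 4.
  have := ler_wpM2l (ltW B1) y1e; rewrite mul_quarter//; lra.
have [d d0 Hd] := Hc y1 y10 ltac:(lra) (e / 2) ltac:(lra).
clearbody y1; exists (Num.min (Num.min r d) y1); first by rewrite !lt_min r0 d0.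
move=> w; rewrite !lt_min => /andP[/andP[wr wd] wy] w0.
have hx : `|Re w - x0| < r by apply: le_lt_trans wr; have := Re_le_cm (w - x0%:C); rewrite cReB.
have hxd : `|Re w - x0| < d by apply: le_lt_trans wd; have := Re_le_cm (w - x0%:C); rewrite cReB.
have hy : Im w < y1 by apply: le_lt_trans wy; have := Im_le_dist w x0; rewrite gtr0_norm.
have h1 := Hv (Re w) (Im w) y1 hx w0 (ltW hy) ltac:(lra).
have h2 := Hl y1 y10 ltac:(lra).
have := Hd (Re w +i* y1).
have -> : Re w +i* y1 - x0 +i* y1 = (Re w - x0)%:C by apply: c_eqP; rewrite !cE /=; ring.
rewrite cmR => /(_ hxd); rewrite -!cRN -!cRD !cmR => h3.
have Ew : w = Re w +i* Im w by case: w {wr wd wy w0 hx hxd hy h1 h3}.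
rewrite {1}Ew.
have h4 : B * (y1 - Im w) <= B * y1 by rewrite ler_wpM2l//; lra.
move: h1 h2 h3; set a := u (Re w +i* y1); set b := u _; set c := u _ => h1 h2 h3.
have -> : b - l = (c - l) + (a - c) - (a - b) by ring.
have n1 := ler_normB ((c - l) + (a - c)) (a - b); have n2 := ler_normD (c - l) (a - c).
lra.
Qed.
End VerticalLimit.

Section Boundary.
Context {R : realType}.
Local Notation C := R[i].
Implicit Types (z w l : C).

Lemma cI_cj (f : R -> C) : citg (-1) 1 f -> cI (-1) 1 (fun t => cj (f t)) = cj (cI (-1) 1 f).
Proof.
move=> [_ h]; apply: c_eqP => //=.
by rewrite -[RHS]mulN1r -rIZ//; apply: rI_ext => t _; rewrite mulN1r.
Qed.

Context (g g1 g2 g3 : C -> C) (dl M : R) (q : R -> R) (Q L : R).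
Variable H : curve_data g g1 g2 g3 dl M.
Variable D : density q Q L.

Lemma Ct_cj z : Im z != 0 -> Ct q (cj z) = cj (Ct q z).
Proof.
move=> z0; rewrite /Ct -cI_cj; last exact: (citg_pole D).
apply: cI_ext => t _; rewrite cJM cJR; congr (_ * _).
have -> : cj z - t%:C = cj (z - t%:C) by rewrite cJB cJR.
case: (z - t%:C) => a b; rewrite /cj /= !cVE /= sqrrN.
by apply: c_eqP => //=; ring.
Qed.

(* Symmetrising in [z] and [cj z] makes [Tp] even across the axis, so that the jump of its normal derivative
   is shared equally by the two sides: [Im (tau z)] tends to [- q] from above. *)
Definition tau z : C := ((2 * pi)^-1)%:C * (sg g g1 q z + cj (sg g g1 q (cj z))).
Definition tau1 z : C := ((2 * pi)^-1)%:C * (sg1 g g1 g2 q z + cj (sg1 g g1 g2 q (cj z))).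
Definition Tp z : R := (2 * pi)^-1 * (Sp g q z + Sp g q (cj z)).

Lemma Im_cj_neq0 z : Im z != 0 -> Im (cj z) != 0.
Proof. by rewrite cImJ oppr_eq0. Qed.

Lemma Tp_gd z : strip dl z -> Im z != 0 -> gd Tp z (tau z).
Proof.
move=> hz z0; apply: gdZ; apply: gdD; first exact: Sp_gd H D _ hz z0.
by apply: gd_conj; apply: (Sp_gd H D); [exact: strip_cj|exact: Im_cj_neq0].
Qed.

Lemma tau_cd z : strip dl z -> Im z != 0 -> cd tau z (tau1 z).
Proof.
move=> hz z0; apply: cdZ; apply: cdD; first exact: sg_cd H D _ hz z0.
by apply: cd_conj; apply: (sg_cd H D); [exact: strip_cj|exact: Im_cj_neq0].
Qed.

Lemma cont_cj z : ccont (@cj R) z.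
Proof. by move=> e e0; exists e => // w; rewrite -cJB cmJ. Qed.

Lemma tau1_cont z : strip dl z -> Im z != 0 -> ccont tau1 z.
Proof.
move=> hz z0; apply: contM; first exact: cont_cst.
apply: contD; first exact: (sg1_cont H D).
apply: (@cont_comp _ (@cj R) (fun w => sg1 g g1 g2 q (cj w))); last exact: cont_cj.
apply: (@cont_comp _ (sg1 g g1 g2 q) (@cj R)); first exact: cont_cj.
by apply: (sg1_cont H D); [exact: strip_cj|exact: Im_cj_neq0].
Qed.

(** The Cauchy integral commutes with conjugation, so symmetrising doubles it. In the imaginary part
    the two values of [om] enter as a difference, which tends to zero by [om_cross]. *)
Lemma tau_Ct z : strip dl z -> Im z != 0 ->
  tau z = ((2 * pi)^-1)%:C * (2%:C * Ct q z + (om g g1 q z + cj (om g g1 q (cj z)))).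
Proof.
move=> hz z0; rewrite /tau !(sg_split H D)//; first last.
- exact: Im_cj_neq0.
- exact: strip_cj.
rewrite (Ct_cj z0) cJD cJK; congr (_ * _).
by apply: c_eqP; rewrite !cE /=; ring.
Qed.

Lemma strip_near (x0 : R) : -1 < x0 < 1 -> exists2 r : R, 0 < r & [/\ r <= 1 / 2, r <= dl,
  r <= 1 - x0 & r <= 1 + x0] /\ (forall z, cm (z - x0%:C) < r -> strip dl z).
Proof.
move=> xI; have d0 := cv_dl H.
have [r r0 Hr] := strip_ball (strip_real d0 (ltac:(lra) : -1 <= x0 <= 1)).
exists (Num.min (Num.min r (Num.min (1 / 2) dl)) (Num.min ((1 - x0) / 2) ((1 + x0) / 2))).
  by rewrite !lt_min r0 d0 /= -!andbA; apply/and3P; split; lra.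
set k := Num.min _ _.
have k1 : k <= 1 / 2 by rewrite !ge_min lexx !orbT.
have k2 : k <= dl by rewrite !ge_min lexx !orbT.
have k3 : k <= (1 - x0) / 2 by rewrite !ge_min lexx !orbT.
have k4 : k <= (1 + x0) / 2 by rewrite !ge_min lexx !orbT.
have k5 : k <= r by rewrite !ge_min lexx.
by split; [split => //; lra|move=> z zk; apply: Hr; lra].
Qed.

Lemma Re_tau z : strip dl z -> Im z != 0 -> Re (tau z) =
  (2 * pi)^-1 * (2 * Re (Ct q z) + (Re (om g g1 q z) + Re (om g g1 q (cj z)))).
Proof. by move=> hz z0; rewrite tau_Ct// !cE /=; ring. Qed.

Lemma Im_tau z : strip dl z -> Im z != 0 -> Im (tau z) =
  (2 * pi)^-1 * (2 * Im (Ct q z) + Im (om g g1 q z - om g g1 q (cj z))).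
Proof. by move=> hz z0; rewrite tau_Ct// !cE /=; ring. Qed.

Lemma Im_tau_lim (x0 : R) : -1 < x0 < 1 ->
  uplim (fun z => (Im (tau z))%:C) x0%:C (- q x0)%:C.
Proof.
move=> xI; have [r r0 [_ Hr]] := strip_near xI; have p0 := pi_gt0 R.
have A := Im_Ct_lim D xI.
have B : uplim (fun z => (Im (om g g1 q z - om g g1 q (cj z)))%:C) x0%:C 0.
  have Q0 := dn_Q D; have B0 := Bk_ge0 M.
  set K := 4 * Q * Bk M; have K0 : 0 <= K by apply: mulr_ge0 => //; apply: mulr_ge0.
  move=> e e0; exists (Num.min r (e / (K + 1))).
    by rewrite lt_min r0 divr_gt0//; lra.
  move=> w; rewrite lt_min => /andP[wr we] w0; rewrite subr0 cmR.
  have := om_cross H D (Hr w wr) (ltac:(by rewrite gt_eqF) : Im w != 0).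
  have := Im_le_cm (om g g1 q w - om g g1 q (cj w)).
  have := Im_le_dist w x0.
  have K1 : 0 < K + 1 by lra.
  rewrite ltr_pdivlMr// in we; rewrite -/K => h1 h2 h3.
  have := ler_wpM2l K0 h1; have := cm_ge0 (w - x0%:C); lra.
have := uplimD (uplimM (uplim_cont (cont_cst (pi^-1)%:C x0%:C)) A)
   (uplimM (uplim_cont (cont_cst ((2 * pi)^-1)%:C x0%:C)) B).
rewrite mulr0 addr0 -cRM mulrN mulKf ?gt_eqF//.
apply: uplim_ext r0 _ => w wr w0.
rewrite -!cRM -cRD Im_tau; [|exact: Hr|by rewrite gt_eqF].
by congr (_%:C); rewrite invfM; move: (pi^-1) => p; field.
Qed.

(** The real part of the limit is the tangential derivative; its value is left unidentified, and its
    existence comes from [vertical_lim]. *)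
Lemma tau_lim (x0 : R) : -1 < x0 < 1 -> exists l : R, uplim tau x0%:C (l +i* (- q x0)).
Proof.
move=> xI; have [r r0 [[r1 r2 r3 r4] Hr]] := strip_near xI; have p0 := pi_gt0 R.
have Q0 := dn_Q D; have L0 := dn_L D; have B0 := Bk_ge0 M.
set K := 2 * Q * Bk M; have K0 : 0 <= K by apply: mulr_ge0 => //; apply: mulr_ge0.
set N := 2 * L * pi + Q * (2 / (r / 2)).
have N0 : 0 <= N.
  by apply: addr_ge0; apply: mulr_ge0 => //; [apply: mulr_ge0| exact: ltW|apply: divr_ge0 => //; lra].
have c0 : 0 < (2 * pi)^-1 :> R by rewrite invr_gt0 mulr_gt0.
have hb (x y : R) : `|x - x0| < r / 2 -> 0 < y < r / 2 -> strip dl (x +i* y).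
  move=> h1 /andP[h2 h3]; apply: Hr; apply: (le_lt_trans (cm_le_ReIm _)).
  by rewrite Im_sub_real cReB /= (gtr0_norm h2); lra.
have [l Hl] : exists l : R, uplim (fun w => (Re (tau w))%:C) x0%:C l%:C.
  apply: (@vertical_lim _ (fun w => Re (tau w)) x0 (r / 2) ((2 * pi)^-1 * (2 * N + 2 * K))).
  - lra.
  - by apply: mulr_ge0; [exact: ltW|lra].
  - move=> x y y' xr y0 yy yr; have y'0 : 0 < y' by exact: lt_le_trans yy.
    have s1 : strip dl (x +i* y) by apply: hb => //; apply/andP; split; lra.
    have s2 : strip dl (x +i* y') by apply: hb => //; apply/andP; split; lra.
    have n1 : Im (x +i* y) != 0 by rewrite /= gt_eqF.
    have n2 : Im (x +i* y') != 0 by rewrite /= gt_eqF.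
    rewrite !Re_tau// -mulrBr normrM (gtr0_norm c0) -mulrA; apply: ler_wpM2l; first exact: ltW.
    have E : cm ((x +i* y') - (x +i* y)) = y' - y.
      have -> : (x +i* y') - (x +i* y) = iC * (y' - y)%:C by apply: c_eqP; rewrite !cE /=; ring.
      by rewrite cmM cm_i mul1r cmR ger0_norm// subr_ge0.
    have b1 : `|Re (Ct q (x +i* y')) - Re (Ct q (x +i* y))| <= N * (y' - y).
      apply: (Re_Ct_vert D) => //; [lra| |lra].
      by move: xr; rewrite ltr_norml => /andP[h1 h2]; rewrite ler_norml; apply/andP; split; lra.
    have b2 : `|Re (om g g1 q (x +i* y')) - Re (om g g1 q (x +i* y))| <= K * (y' - y).
      rewrite -cReB; apply: (le_trans (Re_le_cm _)); rewrite -E.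
      by apply: (om_lip H D) => //=; exact: mulr_gt0.
    have b3 : `|Re (om g g1 q (cj (x +i* y'))) - Re (om g g1 q (cj (x +i* y)))| <= K * (y' - y).
      rewrite -cReB; apply: (le_trans (Re_le_cm _)); rewrite -E -[X in _ <= _ * X]cmJ cJB.
      apply: (om_lip H D); [exact: strip_cj|exact: strip_cj|].
      by rewrite /= mulrNN mulr_gt0.
    move: b1 b2 b3; set a := Re _; set a' := Re _; set b := Re _; set b' := Re _.
    set c := Re _; set c' := Re _ => b1 b2 b3; clearbody a a' b b' c c'.
    have -> : 2 * a + (b + c) - (2 * a' + (b' + c')) = 2 * (a - a') + (b - b') + (c - c') by ring.
    have m1 := ler_normD (2 * (a - a') + (b - b')) (c - c').
    have m2 := ler_normD (2 * (a - a')) (b - b').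
    have m3 : `|2 * (a - a')| = 2 * `|a - a'| by rewrite normrM ger0_norm.
    lra.
  - move=> y y0 yr.
    have s1 : strip dl (x0 +i* y) by apply: hb; [rewrite subrr normr0; lra|apply/andP; split].
    have n1 : Im (x0 +i* y) != 0 by rewrite /= gt_eqF.
    move=> e e0; have [d d0 Hd] := cd_cont (tau_cd s1 n1) e0.
    exists d => // w /Hd; apply: le_lt_trans; rewrite -cRN -cRD cmR -cReB; exact: Re_le_cm.
exists l; apply: uplim_ReIm => //; exact: Im_tau_lim.
Qed.

Definition Tb (x : R) : R := pi^-1 * rI (-1) 1 (fun t => q t * ln (cm (g x%:C - g t%:C))).

(** Distances along the curve and between parameters are comparable by [cv_lb] and [cv_ub]. The
    majorant does not depend on the height [y], as dominated convergence requires. *)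
Lemma ln_sep_bound (x y t : R) : -1 <= x <= 1 -> -1 <= t <= 1 -> `|y| <= 1 -> strip dl (x +i* y) ->
  t != x -> `|ln (cm (g (x +i* y) - g t%:C))| <= 5 * M + 2 + `|ln `|x - t| |.
Proof.
move=> xI tI y1 hz tx; have ht : strip dl t%:C by apply: strip_real (cv_dl H) tI.
have xt : 0 < `|x - t| by rewrite normr_gt0 subr_eq0 eq_sym.
have h1 := cv_lb H ht hz; have h2 := cv_ub H ht hz; have M1 := cv_M H.
have h3 := Re_le_cm ((x +i* y) - t%:C); rewrite cReB /= in h3.
have h4 := cm_le_ReIm ((x +i* y) - t%:C); rewrite cReB Im_sub_real /= in h4.
have h5 : `|x - t| <= 2 by rewrite ler_norml; apply/andP; split; lra.
set c := cm (g _ - _) in h1 h2 *.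
have c0 : 0 < c by lra.
have c1 : c <= 5 * M.
  apply: (le_trans h2); rewrite mulrC ler_wpM2r; lra.
have u : ln c <= 5 * M by apply: ltW; apply: lt_le_trans (ln_sublinear c0) c1.
have lo : ln (`|x - t| / 2) <= ln c.
  by rewrite ler_ln ?posrE ?divr_gt0//; lra.
rewrite lnM ?posrE// lnV ?posrE// in lo.
have l2 : ln 2 < 2 :> R by apply: ln_sublinear.
have a1 := ler_norm (- ln `|x - t|); rewrite normrN in a1.
have a0 := normr_ge0 (ln `|x - t|).
by rewrite ler_norml; apply/andP; split; lra.
Qed.

Lemma inv_natS (n : nat) : 0 < (n.+1%:R^-1 : R) <= 1.
Proof.
by apply/andP; split; [rewrite invr_gt0 ltr0n|rewrite -[leRHS]invr1 lef_pV2 ?posrE ?ltr0n// ler1n].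
Qed.

Lemma measurable_log (x0 : R) :
  measurable_fun (`[(-1), 1]%classic : set R) (fun t : R => q t * ln (cm (g x0%:C - g t%:C))).
Proof.
apply: measurable_funM.
  apply: measurable_funTS; apply: continuous_measurable_fun => t; exact: dn_cont D.
apply: (measurableT_comp (f := @ln R)); first exact: measurable_ln.
apply: subspace_continuous_measurable_fun => //.
apply: cvg_within_all => t; rewrite /= in_itv /= => tI.
have c1 : rcont (fun s : R => g x0%:C - g s%:C) t.
  apply: (@rcont_comp _ (fun u => g x0%:C - u) _ _ (rcont_g H tI)).
  by apply: contB; [exact: cont_cst|exact: cont_id].
apply: (rcont_cts c1) => a b; have := cm_ge_dist a b; have := cm_ge_dist b a.
by rewrite (cm_dist b) ler_norml; lra.
Qed.

Lemma Tp_vert (x0 : R) (y : nat -> R) : -1 < x0 < 1 ->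
  (forall n, y n != 0 /\ strip dl (x0 +i* y n)) -> y @ \oo --> 0 ->
  (fun n => Sp g q (x0 +i* y n)) @ \oo --> rI (-1) 1 (fun t => q t * ln (cm (g x0%:C - g t%:C))).
Proof.
move=> xI Hy y0; have Q0 := dn_Q D.
have hx : strip dl x0%:C by apply: strip_real (cv_dl H) _; lra.
have inx (t : R) : -1 <= t <= 1 -> t != x0 -> g x0%:C != g t%:C.
  move=> tI; apply: contra => /eqP /(cv_inj H hx (strip_real (cv_dl H) tI)) E.
  by case: E => ->.
have yl n : `|y n| <= 1.
  have [_ /andP[_ /=]] := Hy n; have := cv_dl1 H; lra.
have [] := @rI_dominated _ (-1) 1 (fun n t => q t * ln (cm (g (x0 +i* y n) - g t%:C)))
   (fun t => q t * ln (cm (g x0%:C - g t%:C)))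
   (fun t => Q * (5 * M + 2 + `|ln `|x0 - t| |)) x0; last by [].
- by move=> n; have [n1 n2] := Hy n; exact: (itg_ln H D).
- exact: measurable_log.
- apply: itgZ; apply: itgD; first exact: itg_cst.
  by apply: itg_abs; apply: itg_ln_dist; lra.
- move=> t tI tx; apply: cvgM; first exact: cvg_cst.
  have cf : {for 0, continuous (fun s : R => ln (cm (g (x0 +i* s) - g t%:C)))}.
    apply: (@continuous_comp _ _ _ (fun s : R => cm (g (x0 +i* s) - g t%:C)) (@ln R)).
      have c1 : rcont (fun s : R => g (x0 +i* s) - g t%:C) 0.
        have c0 : rcont (fun s : R => x0 +i* s) 0.
          move=> e e0; exists e => // h hh.
          have -> : x0 +i* h - x0 +i* 0 = iC * h%:C by apply: c_eqP; rewrite !cE /=; ring.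
          by rewrite cmM cm_i mul1r cmR; rewrite subr0 in hh.
        apply: (@rcont_comp _ (fun u => g u - g t%:C) _ _ c0).
        apply: contB; last exact: cont_cst.
        by apply: (cd_cont (cv_d1 H _)).
      apply: (rcont_cts c1) => a b; have := cm_ge_dist a b; have := cm_ge_dist b a.
      by rewrite (cm_dist b) ler_norml; lra.
    by apply: continuous_ln; rewrite cm_gt0 subr_eq0; exact: inx.
  exact: (cvg_comp _ _ y0 cf).
- move=> n t tI tx; rewrite normrM; apply: ler_pM => //; first exact: dn_bd D t.
  have [n1 n2] := Hy n.
  by apply: ln_sep_bound => //; lra.
Qed.

(** The gradient [tau] has a limit at [x0], so it is bounded on a half-disc and [Tp] is Lipschitz
    there. The limit along one vertical sequence is then the limit from the whole upper
    half-plane. *)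
Lemma Tp_lim (x0 : R) : -1 < x0 < 1 -> uplim (fun z => (Tp z)%:C) x0%:C (Tb x0)%:C.
Proof.
move=> xI; have [r r0 [_ Hr]] := strip_near xI; have p0 := pi_gt0 R.
have [l Hl] := tau_lim xI.
have [d d0 Hd] := Hl 1 ltr01.
set lam := l +i* _ in Hd; set B := cm lam + 1.
have B0 : 0 < B by have := cm_ge0 lam; rewrite /B; lra.
pose k := Num.min r d; have k0 : 0 < k by rewrite lt_min r0.
have kr : k <= r by rewrite ge_min lexx.
have kd : k <= d by rewrite ge_min lexx orbT.
have lip z w : cm (z - x0%:C) < k -> 0 < Im z -> cm (w - x0%:C) < k -> 0 < Im w ->
    `|Tp w - Tp z| <= B * cm (w - z).
  move=> hz z0 hw w0.
  have hs (s : R) : 0 <= s <= 1 -> let v := z + s%:C * (w - z) in cm (v - x0%:C) < k /\ 0 < Im v.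
    move=> /andP[s0 s1] v; split.
      have -> : v - x0%:C = (1 - s)%:C * (z - x0%:C) + s%:C * (w - x0%:C).
        by rewrite /v cRD cRN; ring.
      apply: (le_lt_trans (cmD _ _)); rewrite !cmM !cmR !ger0_norm ?subr_ge0//.
      have [s00|s00] := eqVneq s 0; first by rewrite s00; lra.
      have sp : 0 < s by rewrite lt_def s00.
      have h1 : s * cm (w - x0%:C) < s * k by rewrite ltr_pM2l.
      have h2 : (1 - s) * cm (z - x0%:C) <= (1 - s) * k by rewrite ler_wpM2l ?subr_ge0// ltW.
      lra.
    rewrite /v Im_seg; have [s00|s00] := eqVneq s 0; first by rewrite s00; lra.
    have sp : 0 < s by rewrite lt_def s00.
    have h1 : 0 < s * Im w by rewrite mulr_gt0.
    have h2 : 0 <= (1 - s) * Im z by rewrite mulr_ge0 ?subr_ge0// ltW.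
    lra.
  apply: (@mvt_gd _ Tp tau) => s /hs[h1 h2].
    by apply: Tp_gd; [apply: Hr; lra|rewrite gt_eqF].
  have := Hd _ (lt_le_trans h1 kd) h2; set t := tau _.
  have := cmD (t - lam) lam; rewrite subrK /B; lra.
pose y n : R := k / 2 * n.+1%:R^-1.
have yP n : 0 < y n <= k / 2.
  have /andP[n1 n2] := inv_natS n; have k2 : 0 < k / 2 by lra.
  by apply/andP; split; [exact: mulr_gt0|rewrite /y ler_piMr// ltW].
have ycv : y @ \oo --> 0.
  rewrite -(mulr0 (k / 2)); apply: cvgM; first exact: cvg_cst.
  exact: cvg_harmonic.
have cE1 (s : R) : cm (x0 +i* s - x0%:C) = `|s|.
  have -> : x0 +i* s - x0%:C = iC * s%:C by apply: c_eqP; rewrite !cE /=; ring.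
  by rewrite cmM cm_i mul1r cmR.
have yk n : cm (x0 +i* y n - x0%:C) < k by rewrite cE1 gtr0_norm; have := yP n; lra.
have T1 := @Tp_vert x0 y xI _ ycv.
have {}T1 := T1 ltac:(move=> n; split; [by have /andP[/gt_eqF ->] := yP n|apply: Hr; have := yk n; lra]).
have yNcv : (fun n => - y n) @ \oo --> 0 by rewrite -oppr0; apply: cvgN.
have T2 := @Tp_vert x0 (fun n => - y n) xI _ yNcv.
have {}T2 := T2 ltac:(move=> n; split; [by rewrite oppr_eq0; have /andP[/gt_eqF ->] := yP n|
  by apply: Hr; have := yk n; rewrite !cE1 normrN; lra]).
have T : (fun n => Tp (x0 +i* y n)) @ \oo --> Tb x0.
  rewrite /Tb; set I := rI _ _ _ in T1 T2 *.
  have -> : pi^-1 * I = (2 * pi)^-1 * (I + I) by rewrite invfM; move: (pi^-1) => p; field.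
  by apply: cvgM; [exact: cvg_cst|exact: cvgD].
move=> e e0.
have e2 : 0 < e / 2 by lra.
move/cvgrPdist_lt : T => /(_ _ e2)[N _ HN].
pose d1 := e / (4 * B).
have d10 : 0 < d1 by rewrite divr_gt0// mulr_gt0.
have Bd : B * d1 = e / 4 by rewrite /d1 mul_quarter.
move/cvgrPdist_lt : ycv => /(_ _ d10)[N' _ HN'].
pose n := maxn N N'.
have a1 := HN n (leq_maxl _ _); have := HN' n (leq_maxr _ _).
rewrite /= sub0r normrN => a2.
exists (Num.min k d1); first by rewrite lt_min k0.
move=> w; rewrite lt_min => /andP[wk wd] w0; rewrite -cRN -cRD cmR.
have yn0 : 0 < Im (x0 +i* y n) by rewrite /=; have := yP n; lra.
have h1 := lip _ _ (yk n) yn0 wk w0.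
have h2 : cm (w - x0 +i* y n) <= cm (w - x0%:C) + `|y n|.
  rewrite -cE1; have -> : w - x0 +i* y n = (w - x0%:C) - (x0 +i* y n - x0%:C) by ring.
  exact: cmB.
have h3 : B * cm (w - x0 +i* y n) <= B * (cm (w - x0%:C) + `|y n|) by rewrite ler_wpM2l// ltW.
have h4 : B * (cm (w - x0%:C) + `|y n|) < B * (d1 + d1).
  by rewrite ltr_pM2l//; lra.
move: a1; rewrite /= distrC => a1.
have -> : Tp w - Tb x0 = (Tp w - Tp (x0 +i* y n)) + (Tp (x0 +i* y n) - Tb x0) by ring.
have := ler_normD (Tp w - Tp (x0 +i* y n)) (Tp (x0 +i* y n) - Tb x0); lra.
Qed.
End Boundary.

(** * The curve and its density *)

Section CurveExists.
Context {R : realType}.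
Local Notation C := R[i].
Implicit Types (z w l : C) (F f : R -> R).

(* The [k]-th derivative of the parametrisation [z + i F(z)] of the curve. *)
Definition gam F k z : C := match k with
  | 0 => z + iC * dext 0 F z
  | 1 => 1 + iC * dext 1 F z
  | k => iC * dext k F z end.
#[local] Arguments dext : simpl never.

Lemma dext0_real (W : set R) F (a : R) : real_analytic_on W F -> W a -> dext 0 F a%:C = (F a)%:C.
Proof. exact: aext_real. Qed.

Lemma dext1_real (W : set R) F (a : R) : open W -> real_analytic_on W F -> W a ->
  is_derive a 1 F (Re (dext 1 F a%:C)) /\ Im (dext 1 F a%:C) = 0.
Proof.
move=> oW FW Wa; have [r r0 Hr] := dext_cd 0 oW FW Wa.
have a0 : cm (a%:C - a%:C) < r by rewrite subrr cm0.
have dF := Hr _ a0.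
have [e /= e0 He] : \forall y \near a, W y by exact: open_nbhs_nbhs.
have near e' : 0 < e' -> exists2 d : R, 0 < d & forall h : R, `|h| < d ->
    cm ((F (a + h) - F a)%:C - dext 1 F a%:C * h%:C) <= e' * `|h|.
  move=> /dF[d d0 Hd]; exists (Num.min d e); first by rewrite lt_min d0.
  move=> h; rewrite lt_min => /andP[hd hi].
  have Wah : W (a + h) by apply: He; rewrite /= opprD addrA subrr add0r normrN.
  have := Hd h%:C; rewrite !cmR => /(_ hd).
  by rewrite -cRD !(dext0_real FW)// cRD cRN.
split.
  apply: is_derive_eps => e' /near[d d0 Hd]; exists d => // h hd.
  apply: le_trans (Hd h hd); apply: le_trans (Re_le_cm _).
  by rewrite cReB cReM /= mulr0 subr0.
(* The increments of [F] are real, so the imaginary part of the first-order remainder is, up to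
   sign, that of the derivative times the step. *)
apply/eqP; rewrite -normr_eq0 eq_le normr_ge0 andbT; apply/ler_addgt0Pl => e' e'0; rewrite addr0.
have [d d0 Hd] := near _ e'0.
have d2 : `|d / 2| < d by rewrite gtr0_norm; lra.
have := Hd _ d2; have := Im_le_cm ((F (a + d / 2) - F a)%:C - dext 1 F a%:C * (d / 2)%:C).
rewrite cImB cImM /= mulr0 !add0r normrN normrM => h1 h2.
have dp : 0 < `|d / 2| by rewrite gtr0_norm; lra.
by rewrite -(ler_pM2r dp); apply: le_trans h2.
Qed.

Lemma cont_near (f : C -> C) z (e : R) : ccont f z -> 0 < e -> exists2 d : R, 0 < d &
  forall w, cm (w - z) < d -> cm (f w - f z) <= e /\ cm (f w) <= 1 + cm (f z).
Proof.
move=> cf e0; have [d d0 H] := cf (Num.min 1 e) ltac:(by rewrite lt_min ltr01).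
exists d => // w /H; rewrite lt_min => /andP[h1 h2]; split; first exact: ltW.
by have := cmD (f w - f z) (f z); rewrite subrK; lra.
Qed.

Lemma Im_dist z w : Im w = 0 -> `|Im z| <= cm (z - w).
Proof. by move=> w0; have := Im_le_cm (z - w); rewrite cImB w0 subr0. Qed.

Opaque dext.
(** The derivative of the extension is real on [[-1, 1]], so near it the imaginary part is at most
    one half in modulus, and [Re (gam F 1)] is one minus that part. Compactness of the segment,
    taken as a rectangle of height zero, makes this uniform; [P] speaks of whole balls in order to
    reach points off the axis. *)
Lemma curve_exists (W : set R) F : open W -> `[-1, 1] `<=` W -> real_analytic_on W F ->
  exists dl M, curve_data (gam F 0) (gam F 1) (gam F 2) (gam F 3) dl M.
Proof.
move=> oW KW FW.
pose P (i : R) (w : C) := forall v : C, cm (v - w) < i ->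
  [/\ forall k, (k < 3)%N -> cd (dext k F) v (dext k.+1 F v),
      forall k, (0 < k < 4)%N -> cm (dext k F v) <= i^-1 & `|Im (dext 1 F v)| <= 1 / 2].
have [e e0 He] : exists2 e : R, 0 < e & forall z, -1 <= Re z <= 1 -> 0 <= Im z <= 0 -> P e z.
  apply: rect_compact => -[a y] /= aI; rewrite -eq_le => /eqP <-.
  have Wa : W a by apply: KW; rewrite /= in_itv.
  have [_ Ia] := dext1_real oW FW Wa.
  have [r0 r00 H0] := dext_cd 0 oW FW Wa.
  have [r1 r10 H1] := dext_cd 1 oW FW Wa.
  have [r2 r20 H2] := dext_cd 2 oW FW Wa.
  have [r3 r30 H3] := dext_cd 3 oW FW Wa.
  have aa r : 0 < r -> cm (a%:C - a%:C) < r by rewrite subrr cm0.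
  have [d1 d10 D1] := cont_near (cd_cont (H1 _ (aa _ r10))) (ltac:(lra) : 0 < 1 / 2 :> R).
  have [d2 d20 D2] := cont_near (cd_cont (H2 _ (aa _ r20))) ltr01.
  have [d3 d30 D3] := cont_near (cd_cont (H3 _ (aa _ r30))) ltr01.
  have [B [B0 B1 B2 B3]] : exists B : R, [/\ 0 < B, 1 + cm (dext 1 F a%:C) <= B,
      1 + cm (dext 2 F a%:C) <= B & 1 + cm (dext 3 F a%:C) <= B].
    exists (1 + cm (dext 1 F a%:C) + cm (dext 2 F a%:C) + cm (dext 3 F a%:C)).
    have := cm_ge0 (dext 1 F a%:C); have := cm_ge0 (dext 2 F a%:C).
    have := cm_ge0 (dext 3 F a%:C); move: (cm (dext 1 F _)) (cm (dext 2 F _)) (cm (dext 3 F _)) => x y' z.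
    by split; lra.
  pose r := Num.min (Num.min (Num.min r0 r1) r2) (Num.min (Num.min d1 d2) d3).
  have rp : 0 < r by rewrite !lt_min r00 r10 r20 d10 d20.
  exists (Num.min (r / 2) B^-1); first by rewrite lt_min invr_gt0 B0 divr_gt0.
  move=> w i; rewrite !lt_min => /andP[w1 w2] /andP[i0 /andP[i1 i2]] v vi.
  have va : cm (v - a%:C) < r.
    have -> : v - a%:C = (v - w) + (w - a%:C) by ring.
    by apply: (le_lt_trans (cmD _ _)); rewrite -[_ +i* _]/(a%:C) in w1; lra.
  move: va; rewrite /r !lt_min => /andP[/andP[/andP[v0 v1] v2] /andP[/andP[u1 u2] u3]].
  have Bi : B <= i^-1.
    by rewrite -[B]invrK lef_pV2 ?posrE ?invr_gt0//; exact: ltW.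
  split.
  - by move=> [|[|[|k]]] //= _; [exact: H0|exact: H1|exact: H2].
  - have [_ b1] := D1 _ u1; have [_ b2] := D2 _ u2; have [_ b3] := D3 _ u3.
    by move=> [|[|[|[|k]]]] //= _; apply: le_trans Bi;
      [apply: le_trans b1 B1|apply: le_trans b2 B2|apply: le_trans b3 B3].
  - have [b _] := D1 _ u1; apply: le_trans b.
    exact: Im_dist.
(* A point of the strip is within [dl] of [[-1, 1]] horizontally and less than [dl] from the axis
   vertically, so [2 * dl <= e] keeps it in the ball about the clamped point [t]. *)
pose dl := Num.min (e / 2) 1.
have dl0 : 0 < dl by rewrite lt_min ltr01 divr_gt0.
have dle : dl <= e / 2 by rewrite ge_min lexx.
have dl1 : dl <= 1 by rewrite ge_min lexx orbT.
have ei : 0 < e^-1 by rewrite invr_gt0.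
have HP z : strip dl z -> [/\ forall k, (k < 3)%N -> cd (dext k F) z (dext k.+1 F z),
      forall k, (0 < k < 4)%N -> cm (dext k F z) <= e^-1 & `|Im (dext 1 F z)| <= 1 / 2].
  move=> /andP[z1 z2].
  pose t := Num.max (-1) (Num.min 1 (Re z)).
  have tI : -1 <= t <= 1 by rewrite /t le_max lexx /= ge_max ge_min lexx /= andbT; lra.
  have tz : `|Re z - t| <= dl.
    rewrite /t; move: z1; rewrite ltr_norml => /andP[h1 h2].
    have [p|p] := leP 1 (Re z).
      by rewrite max_r; [rewrite ger0_norm; lra|lra].
    by have [p'|p'] := leP (-1) (Re z); rewrite ler_norml; apply/andP; split; lra.
  apply: (He t%:C) => //=; first by rewrite lexx.
  apply: (le_lt_trans (cm_le_ReIm _)); rewrite Im_sub_real cReB /=; lra.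
exists dl, (1 + e^-1).
split => //.
- lra.
- move=> z /HP[H _ _]; apply: cdD; first exact: cd_id.
  by apply: cdZ; exact: (H 0%N).
- move=> z /HP[H _ _] /=; have := cdD (cd_cst 1 z) (cdZ iC (H 1%N isT)).
  by rewrite add0r.
- by move=> z /HP[H _ _]; apply: cdZ; exact: (H 2%N).
- move=> z /HP[_ H _] /=; apply: (le_trans (cmD _ _)).
  by rewrite cm1 cmM cm_i mul1r lerD2l; exact: (H 1%N).
- move=> z /HP[_ H _] /=; rewrite cmM cm_i mul1r.
  have := H 2%N isT; lra.
- move=> z /HP[_ H _] /=; rewrite cmM cm_i mul1r.
  have := H 3%N isT; lra.
- move=> z /HP[_ _] /=; rewrite !cE /= mul0r mul1r sub0r ler_norml => /andP[h1 h2]; lra.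
Qed.

Transparent dext.
End CurveExists.
Arguments gam : simpl never.
Arguments dext : simpl never.

(** * The Lipschitz density and the integral in [H_fun] *)

Section Density.
Context {R : realType}.
Local Notation C := R[i].
Local Notation mu := (@lebesgue_measure R).
Implicit Types (z w l : C) (F f : R -> R).

Lemma cm_lip z w : `|cm z - cm w| <= cm (z - w).
Proof.
have := cm_ge_dist z w; have := cm_ge_dist w z; rewrite (cm_dist w) ler_norml.
by move=> ? ?; apply/andP; split; lra.
Qed.

Lemma lip_mul (a b u v d B L M : R) : 0 <= B -> 0 <= L -> 0 <= u -> u <= M ->
  `|a - b| <= L * d -> `|b| <= B -> `|u - v| <= M * d -> `|a * u - b * v| <= (L * M + B * M) * d.
Proof.
move=> B0 L0 u0 uM h1 h2 h3.
have -> : a * u - b * v = (a - b) * u + b * (u - v) by ring.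
apply: (le_trans (ler_normD _ _)); rewrite !normrM (ger0_norm u0) mulrDl; apply: lerD.
- have -> : L * M * d = (L * d) * M by ring.
  exact: ler_pM.
- have -> : B * M * d = B * (M * d) by ring.
  exact: ler_pM.
Qed.

Definition clamp (t : R) : R := Num.max (-1) (Num.min 1 t).

Lemma clampI t : -1 <= clamp t <= 1.
Proof.
by rewrite /clamp; case: (leP 1 t) => a; [case: (leP (-1) 1) => b|case: (leP (-1) t) => b];
  apply/andP; split; lra.
Qed.

Lemma clamp_id t : -1 <= t <= 1 -> clamp t = t.
Proof.
move=> /andP[a b]; rewrite /clamp min_r// max_r//.
Qed.

Lemma clamp_lip t s : `|clamp t - clamp s| <= `|t - s|.
Proof.
rewrite /clamp; have a0 := ler_norm (t - s); have a1 := ler_norm (- (t - s)); rewrite normrN in a1.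
have a2 := normr_ge0 (t - s); rewrite ler_norml.
have l11 : -1 <= 1 :> R by lra.
case: (leP 1 t) => a; case: (leP 1 s) => c; rewrite ?(max_r l11);
  [|case: (leP (-1) s) => d|case: (leP (-1) t) => b|case: (leP (-1) t) => b; case: (leP (-1) s) => d];
  apply/andP; split; lra.
Qed.

(** The continuous extension of the derivative is bounded on the closed interval, and the mean value
    theorem only evaluates the derivative inside. *)
Lemma C1_lip f : C1_itvcc (-1) 1 f -> exists B L : R, [/\ 0 <= B, 0 <= L,
  forall t, -1 <= t <= 1 -> `|f t| <= B &
  forall t s, -1 <= t <= 1 -> -1 <= s <= 1 -> `|f t - f s| <= L * `|t - s|].
Proof.
move=> [cf df [G [GE cG]]].
have l11 : -1 <= 1 :> R by lra.
have bd (k : R -> R) : {within `[-1, 1], continuous k} ->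
    exists2 B : R, 0 <= B & forall t, -1 <= t <= 1 -> `|k t| <= B.
  move=> ck; have [c1 _ h1] := EVT_max l11 ck; have [c2 _ h2] := EVT_min l11 ck.
  exists (`|k c1| + `|k c2|) => // t tI.
  have tI' : t \in `[-1, 1]%R by rewrite in_itv.
  have := h1 t tI'; have := h2 t tI'.
  have := ler_norm (k c1); have := ler_norm (- k c2); rewrite normrN.
  have := normr_ge0 (k c1); have := normr_ge0 (k c2).
  by move=> ? ? ? ? ? ?; rewrite ler_norml; apply/andP; split; lra.
have [B B0 HB] := bd _ cf; have [L L0 HL] := bd _ cG.
exists B, L; split => //.
have key t s : -1 <= t -> t < s -> s <= 1 -> `|f s - f t| <= L * `|s - t|.
  move=> t1 ts s1.
  have [||c cI ->] := @MVT _ f (derive1 f) t s ts.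
  - move=> x; rewrite in_itv /= => xI.
    have xI' : x \in `]-1, 1[%R by rewrite in_itv /=; apply/andP; split; lra.
    by rewrite derive1E; apply: DeriveDef => //; exact: df.
  - apply: continuous_subspaceW cf => x /=; rewrite !in_itv /= => /andP[h1 h2].
    by apply/andP; split; lra.
  rewrite normrM; apply: ler_wpM2r => //.
  move: cI; rewrite in_itv /= => cI.
  have cI' : c \in `]-1, 1[%R by rewrite in_itv /=; apply/andP; split; lra.
  rewrite -GE; last by rewrite inE.
  by apply: HL; lra.
move=> t s /andP[t1 t2] /andP[s1 s2].
have [ts|st|->] := ltgtP t s.
- by rewrite distrC [`|t - s|]distrC; exact: key.
- exact: key.
- by rewrite !subrr normr0 mulr0.
Qed.

Context (W : set R) (Psi F g h : R -> R) (dl M : R).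
Variables (oW : open W) (KW : `[-1, 1] `<=` W) (FW : real_analytic_on W F).
Variable FE : {in `[-1, 1]%classic, F =1 Psi}.
Variable H : curve_data (gam F 0) (gam F 1) (gam F 2) (gam F 3) dl M.

Lemma FPsi t : -1 <= t <= 1 -> F t = Psi t.
Proof. by move=> tI; apply: FE; rewrite inE /= in_itv. Qed.

Lemma inW t : -1 <= t <= 1 -> W t.
Proof. by move=> tI; apply: KW; rewrite /= in_itv. Qed.

Lemma gam_real t : -1 <= t <= 1 -> gam F 0 t%:C = t +i* Psi t.
Proof.
move=> tI; rewrite /gam (dext0_real FW (inW tI)) FPsi//.
by apply: c_eqP; rewrite !cE /=; ring.
Qed.

Lemma gam1_real t : -1 < t < 1 -> gam F 1 t%:C = 1 +i* derive1 Psi t.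
Proof.
move=> tI; have tI' : -1 <= t <= 1 by lra.
have [dF iF] := dext1_real oW FW (inW tI').
have -> : derive1 Psi t = Re (dext 1 F t%:C).
  rewrite derive1E -(@near_eq_derive _ _ _ F); first by case: dF.
  have tI2 : t \in `]-1, 1[%R by rewrite in_itv.
  near=> s; apply: FPsi.
  have : s \in `]-1, 1[%R by near: s; exact: near_in_itvoo tI2.
  by rewrite in_itv /= => /andP[? ?]; apply/andP; split; lra.
by apply: c_eqP; rewrite /gam !cE ?iF /=; ring.
Unshelve. all: by end_near. Qed.

(* The density [h |gamma'|], continued by constants to a Lipschitz function on the line. *)
Definition qd t : R := h (clamp t) * cm (gam F 1 (clamp t)%:C).

Lemma qd_density : C1_itvcc (-1) 1 h -> exists Q L, density qd Q L.
Proof.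
move=> /C1_lip[B [L [B0 L0 HB HL]]].
have M0 : 0 <= M by exact: M_ge0 H.
have st t : strip dl (clamp t)%:C by apply: strip_real (cv_dl H) (clampI t).
have gM t : cm (gam F 1 (clamp t)%:C) <= M by exact: cv_b1 H _ (st t).
exists (B * M), (L * M + B * M); split.
- exact: mulr_ge0.
- by apply: addr_ge0; exact: mulr_ge0.
- move=> t; rewrite normrM (ger0_norm (cm_ge0 _)); apply: ler_pM; rewrite ?cm_ge0//.
  exact: HB (clampI t).
- move=> t s; rewrite /qd.
  have h1 := HL _ _ (clampI t) (clampI s).
  have h2 : cm (gam F 1 (clamp t)%:C - gam F 1 (clamp s)%:C) <= M * `|clamp t - clamp s|.
    have -> : `|clamp t - clamp s| = cm ((clamp t)%:C - (clamp s)%:C) by rewrite -cRN -cRD cmR.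
    apply: (@mvt_cd _ (gam F 1) (gam F 2)) => u u01.
    + by apply: (cv_d2 H); exact: strip_seg.
    + by apply: (cv_b2 H); exact: strip_seg.
  apply: lip_mul => //; [exact: cm_ge0| | |].
  + by apply: (le_trans h1); apply: ler_wpM2l => //; exact: clamp_lip.
  + exact: HB (clampI s).
  + apply: (le_trans (cm_lip _ _)); apply: (le_trans h2).
    by apply: ler_wpM2l => //; exact: clamp_lip.
Qed.

(** On the axis the parametrisation runs through the graph, so the modulus of a difference is the
    distance under the logarithm, and [|gamma'|] is the arc length factor. The integrands agree on
    the open interval only. *)
Lemma H_funE (Q L x : R) : density qd Q L -> -1 < x < 1 ->
  H_fun Psi g h x = g x - Tb (gam F 0) qd x.
Proof.
move=> D xI; rewrite /H_fun /Tb; congr (_ - _ * _).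
have mq := measurable_log H D x.
have E : {in `]-1, 1[%R, (fun t => qd t * ln (cm (gam F 0 x%:C - gam F 0 t%:C))) =1
  (fun t => h t * Num.sqrt (1 + derive1 Psi t ^+ 2) *
       ln (Num.sqrt ((x - t) ^+ 2 + (Psi x - Psi t) ^+ 2)))}.
  move=> t; rewrite in_itv /= => tI; rewrite /qd clamp_id; last by lra.
  rewrite gam1_real// !gam_real; [|by lra|by lra].
  rewrite !cmE cReB cImB [Re (_ +i* _)]/= [Im (_ +i* _)]/= expr1n.
  by rewrite [Re _]/= [Im _]/= [Re _]/= [Im _]/=.
exact: (rI_eq_open mq E).
Qed.
End Density.

(** * Functions on the plane *)

Section Plane.
Context {R : realType}.
Local Notation C := R[i].
Implicit Types (z w l : C) (p v : R * R) (u k : R * R -> R) (A G : set (R * R)).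

Definition toC p : C := p.1 +i* p.2.
Definition ofC z : R * R := (Re z, Im z).
Definition uC u z : R := u (ofC z).

Lemma toCK : cancel toC ofC. Proof. by case. Qed.
Lemma ofCK : cancel ofC toC. Proof. by case. Qed.

Lemma nbhs_cm p (P : set (R * R)) : nbhs p P <->
  exists2 d : R, 0 < d & forall p', cm (toC p' - toC p) < d -> P p'.
Proof.
split.
- move=> /nbhs_ballP[d /= d0 H]; exists d => // p' hp; apply: H.
  split => /=; apply: le_lt_trans hp; rewrite distrC.
  + by have := Re_le_cm (toC p' - toC p); rewrite cReB.
  + by have := Im_le_cm (toC p' - toC p); rewrite cImB.
- move=> [d d0 H]; apply/nbhs_ballP; exists (d / 2) => /=; first by rewrite divr_gt0.
  move=> p' [/= h1 h2]; apply: H; apply: (le_lt_trans (cm_le_ReIm _)).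
  rewrite cReB cImB [Re _]/= [Im _]/= [Re _]/= [Im _]/=.
  rewrite /ball /= in h1 h2.
  by rewrite distrC [X in _ + X]distrC; lra.
Qed.

Lemma contP k p : {for p, continuous k} <-> forall e : R, 0 < e -> exists2 d : R, 0 < d &
  forall p', cm (toC p' - toC p) < d -> `|k p' - k p| < e.
Proof.
split.
- move=> /cvgrPdist_lt H e /H /nbhs_cm[d d0 Hd]; exists d => // p' /Hd /=.
  by rewrite distrC.
- move=> H; apply/cvgrPdist_lt => e /H[d d0 Hd]; apply/nbhs_cm.
  by exists d => // p' /Hd; rewrite distrC.
Qed.

Lemma withinP A k p (l : R) : k p' @[p' --> within A (nbhs p)] --> l <->
  forall e : R, 0 < e -> exists2 d : R, 0 < d &
    forall p', A p' -> cm (toC p' - toC p) < d -> `|k p' - l| < e.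
Proof.
split.
- move=> /cvgrPdist_lt H e /H /nbhs_cm[d d0 Hd]; exists d => // p' Ap /Hd /(_ Ap).
  by rewrite distrC.
- move=> H; apply/cvgrPdist_lt => e /H[d d0 Hd]; apply/nbhs_cm.
  by exists d => // p' hp Ap; rewrite distrC; exact: Hd.
Qed.

Lemma within_contP A k : {within A, continuous k} <-> forall p, A p ->
  forall e : R, 0 < e -> exists2 d : R, 0 < d &
    forall p', A p' -> cm (toC p' - toC p) < d -> `|k p' - k p| < e.
Proof.
split.
- by move=> /subspace_continuousP H p /H /withinP.
- by move=> H; apply/subspace_continuousP => p /H; rewrite -withinP.
Qed.

(** Adherence of [p] to [A] makes the filter proper, without which [lim] would not be determined by
    convergence. *)
Lemma boundary_valueE A k p (l : R) :
  (forall d : R, 0 < d -> exists2 p', A p' & cm (toC p' - toC p) < d) ->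
  k p' @[p' --> within A (nbhs p)] --> l -> boundary_value A k p = l.
Proof.
move=> cl h; rewrite /boundary_value.
have PF : ProperFilter (within A (nbhs p)).
  apply: within_nbhs_proper => B /nbhs_cm[d d0 Hd].
  by have [p' Ap hp] := cl _ d0; exists p'; split => //; exact: Hd.
exact: cvg_lim.
Qed.

Lemma vec10 p (h : R) : p + h *: (1, 0) = (p.1 + h, p.2).
Proof. by rewrite [LHS](_ : _ = (p.1 + h * 1, p.2 + h * 0))// mulr1 mulr0 addr0. Qed.

Lemma vec01 p (h : R) : p + h *: (0, 1) = (p.1, p.2 + h).
Proof. by rewrite [LHS](_ : _ = (p.1 + h * 0, p.2 + h * 1))// mulr1 mulr0 addr0. Qed.

Lemma is_derive_vec u p v (l : R) :
  (forall e : R, 0 < e -> exists2 d : R, 0 < d & forall h : R, `|h| < d ->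
     `|u (p + h *: v) - u p - l * h| <= e * `|h|) -> is_derive p v u l.
Proof.
move=> H.
have C0 : h^-1 *: (u (h *: v + p) - u p) @[h --> 0^'] --> l.
  apply/cvgrPdist_le => e e0; have [d d0 Hd] := H _ e0.
  exists d => //= h /=; rewrite sub0r normrN => hd h0.
  have := Hd _ hd; rewrite [p + _]addrC => h1.
  rewrite -[h^-1 *: _]/(h^-1 * _).
  have -> : l - h^-1 * (u (h *: v + p) - u p) = - (h^-1 * (u (h *: v + p) - u p - l * h)).
    by field.
  by rewrite normrN normrM normfV mulrC ler_pdivrMr ?normr_gt0.
split; first by apply/cvg_ex; exists l.
exact/cvg_lim.
Qed.

Lemma derivable_vec u p v : derivable u p v ->
  forall e : R, 0 < e -> exists2 d : R, 0 < d & forall h : R, `|h| < d ->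
     `|u (p + h *: v) - u p - 'D_v u p * h| <= e * `|h|.
Proof.
move=> du e e0.
have /cvgrPdist_le /(_ _ e0)[d /= d0 Hd] : h^-1 *: (u (h *: v + p) - u p) @[h --> 0^'] --> 'D_v u p.
  exact: du.
exists d => // h hd; have [->|h0] := eqVneq h 0.
  by rewrite scale0r addr0 subrr mulr0 subr0 normr0 mulr0.
have := Hd h; rewrite /= sub0r normrN => /(_ hd h0).
rewrite -[h^-1 *: _]/(h^-1 * _) [_ + p]addrC.
have -> : 'D_v u p - h^-1 * (u (p + h *: v) - u p) = - (h^-1 * (u (p + h *: v) - u p - 'D_v u p * h)).
  by field.
by rewrite normrN normrM normfV mulrC ler_pdivrMr ?normr_gt0.
Qed.

Lemma gd_partials u p l : gd (uC u) (toC p) l ->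
  [/\ derivable u p (1, 0), derivable u p (0, 1), partial1 u p = Re l & partial2 u p = - Im l].
Proof.
move=> H.
have d1 : is_derive p (1, 0) u (Re l).
  apply: is_derive_vec => e /H[d d0 Hd]; exists d => // h hd.
  have := Hd h%:C; rewrite cmR => /(_ hd).
  rewrite /uC toCK; congr (`|u _ - _ - _| <= _).
    by rewrite vec10 /ofC !cE /= addr0.
  by rewrite cReM /= mulr0 subr0.
have d2 : is_derive p (0, 1) u (- Im l).
  apply: is_derive_vec => e /H[d d0 Hd]; exists d => // h hd.
  have := Hd (iC * h%:C); rewrite cmM cm_i mul1r cmR => /(_ hd).
  rewrite /uC toCK; congr (`|u _ - _ - _| <= _).
    by rewrite vec01 /ofC !cE /=; congr pair; ring.
  by rewrite !cE /=; ring.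
by split; [case: d1|case: d2|case: d1|case: d2].
Qed.

End Plane.

Section Smooth.
Context {R : realType}.
Local Notation C := R[i].
Implicit Types (z w l : C) (p v : R * R) (u k : R * R -> R) (A G : set (R * R)).

Lemma mvt_vec u p v (h : R) : (forall s : R, 0 <= s <= 1 -> derivable u (p + (s * h) *: v) v) ->
  exists2 s : R, 0 < s < 1 & u (p + h *: v) - u p = 'D_v u (p + (s * h) *: v) * h.
Proof.
move=> H.
pose f (s : R) := u (p + (s * h) *: v).
have df (s : R) : 0 <= s <= 1 -> is_derive s 1 f ('D_v u (p + (s * h) *: v) * h).
  move=> /H/derivable_vec Hs; apply: is_derive_eps => e e0.
  have h1 : 0 < `|h| + 1 by have := normr_ge0 h; lra.
  have [d d0 Hd] := Hs (e / (`|h| + 1)) ltac:(by rewrite divr_gt0).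
  exists (d / (`|h| + 1)); first by rewrite divr_gt0.
  move=> t; rewrite ltr_pdivlMr// => td.
  have tb : `|t * h| <= `|t| * (`|h| + 1) by rewrite normrM ler_wpM2l// lerDl.
  have := Hd (t * h) (le_lt_trans tb td).
  have -> : p + (s * h) *: v + (t * h) *: v = p + ((s + t) * h) *: v.
    by rewrite -addrA -scalerDl -mulrDl.
  move=> /le_trans ht.
  rewrite /f -mulrA [h * t]mulrC; apply: ht.
  apply: (le_trans (ler_wpM2l _ tb)); first by rewrite divr_ge0 ?ltW.
  by rewrite mulrCA mulrC divfK ?gt_eqF// mulrC.
have [|||s sI E] := @MVT R f (fun s => 'D_v u (p + (s * h) *: v) * h) 0 1.
- by [].
- move=> x; rewrite in_itv /= => /andP[x0 x1]; apply: df; lra.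
- by apply: cvg_within_all => x; rewrite /= in_itv /= => x01; apply: derive_continuous (df _ x01).
exists s; first by rewrite in_itv in sI.
by move: E; rewrite /f subr0 mulr1 mul1r mul0r scale0r addr0.
Qed.

Lemma open_cm A p : open A -> A p -> exists2 r : R, 0 < r &
  forall p', cm (toC p' - toC p) < r -> A p'.
Proof. by move=> oA Ap; apply/nbhs_cm; exact: open_nbhs_nbhs. Qed.

Lemma toC_sub p p' : toC p' - toC p = (p'.1 - p.1) +i* (p'.2 - p.2).
Proof. by []. Qed.

(** The increment is split into a vertical and a horizontal leg, each with its own mean value point;
    continuity of the partial derivatives bounds the two errors. *)
Lemma C1_gd A u p : open A -> C1_on A u -> A p ->
  gd (uC u) (toC p) (partial1 u p +i* (- partial2 u p)).
Proof.
move=> oA [cu du c1 c2] Ap e e0; have e2 : 0 < e / 2 by lra.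
have [r r0 Hr] := open_cm oA Ap.
have [d1 d10 H1] := (contP _ _).1 (c1 p Ap) _ e2.
have [d2 d20 H2] := (contP _ _).1 (c2 p Ap) _ e2.
pose d := Num.min r (Num.min d1 d2); have d0 : 0 < d by rewrite !lt_min r0 d10.
exists (d / 2) => [|h hd]; first by lra.
have hx := Re_le_cm h; have hy := Im_le_cm h.
have near (x y : R) : `|x| <= `|Re h| -> `|y| <= `|Im h| ->
   [/\ A (p.1 + x, p.2 + y), `|partial1 u (p.1 + x, p.2 + y) - partial1 u p| <= e / 2 &
      `|partial2 u (p.1 + x, p.2 + y) - partial2 u p| <= e / 2].
  move=> hx' hy'.
  have : cm (toC (p.1 + x, p.2 + y) - toC p) < d.
    rewrite toC_sub /= [p.1 + x]addrC [p.2 + y]addrC !addrK.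
    by apply: (le_lt_trans (cm_RI _ _)); lra.
  rewrite !lt_min => /andP[k1 /andP[k2 k3]]; split; first exact: Hr.
  - exact: ltW (H1 _ k2).
  - exact: ltW (H2 _ k3).
have s1 (s : R) x : 0 <= s <= 1 -> `|s * x| <= `|x|.
  by move=> /andP[a b]; rewrite normrM ger0_norm// ler_piMl.
have [|s sI E1] := @mvt_vec u (p.1, p.2 + Im h) (1, 0) (Re h).
  move=> s sI; rewrite vec10 /=.
  by have [q _ _] := near _ _ (s1 s (Re h) sI) (lexx _); exact: (du _ q).1.
have [|t tI E2] := @mvt_vec u p (0, 1) (Im h).
  move=> t tI; rewrite vec01 /=.
  have [q _ _] := near 0 _ (ltac:(by rewrite normr0)) (s1 t (Im h) tI).
  by rewrite addr0 in q; exact: (du _ q).2.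
rewrite vec10 vec10 /= in E1; rewrite vec01 vec01 /= in E2.
rewrite /uC toCK.
have -> : ofC (toC p + h) = (p.1 + Re h, p.2 + Im h) by rewrite /ofC cReD cImD.
have [_ b1 _] := near _ _ (s1 s (Re h) ltac:(lra)) (lexx `|Im h|).
have [_ _ b2] := near 0 _ (ltac:(by rewrite normr0)) (s1 t (Im h) ltac:(lra)).
rewrite addr0 in b2.
have E : u (p.1 + Re h, p.2 + Im h) - u p - Re ((partial1 u p -i* partial2 u p) * h) =
   (partial1 u (p.1 + s * Re h, p.2 + Im h) - partial1 u p) * Re h +
   (partial2 u (p.1, p.2 + t * Im h) - partial2 u p) * Im h.
  rewrite cReM [Re (_ +i* _)]/= [Im (_ +i* _)]/=.
  have -> : u (p.1 + Re h, p.2 + Im h) - u p =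
     (u (p.1 + Re h, p.2 + Im h) - u (p.1, p.2 + Im h)) + (u (p.1, p.2 + Im h) - u p) by ring.
  rewrite E1 E2 /partial1 /partial2; ring.
rewrite E; apply: (le_trans (ler_normD _ _)); rewrite !normrM.
have -> : e * cm h = e / 2 * cm h + e / 2 * cm h by field.
by apply: lerD; apply: ler_pM => //; exact: normr_ge0.
Qed.

(* The second difference of [u], estimated along both sides of a small square. *)
Lemma clairaut (u : C -> R) (D : C -> C) z l m (r : R) : 0 < r ->
  (forall w, cm (w - z) < r -> gd u w (D w)) ->
  gd (fun w => Re (D w)) z l -> gd (fun w => Im (D w)) z m -> Im l = Re m.
Proof.
move=> r0 Hu Hl Hm.
apply/eqP; rewrite -subr_eq0 -normr_eq0 eq_le normr_ge0 andbT.
apply/ler_addgt0Pl => e e0; rewrite addr0.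
(* Four values of the gradient enter, each with an error of [e / 8 * (2 * t)], which makes [e * t]
   altogether. *)
have e6 : 0 < e / 8 by lra.
have [d1 d10 H1] := Hl _ e6; have [d2 d20 H2] := Hm _ e6.
pose t := Num.min r (Num.min d1 d2) / 3.
have m0 : 0 < Num.min r (Num.min d1 d2) by rewrite !lt_min r0 d10.
have t0 : 0 < t by rewrite divr_gt0.
have tr : 2 * t < r by have : Num.min r (Num.min d1 d2) <= r; [rewrite ge_min lexx|rewrite /t; lra].
have t1 : 2 * t < d1.
  by have : Num.min r (Num.min d1 d2) <= d1; [rewrite !ge_min lexx orbT|rewrite /t; lra].
have t2 : 2 * t < d2.
  by have : Num.min r (Num.min d1 d2) <= d2; [rewrite !ge_min lexx !orbT|rewrite /t; lra].
have sq (x y : R) : 0 <= x <= t -> 0 <= y <= t -> cm (x +i* y) <= 2 * t.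
  by move=> hx hy; apply: (le_trans (cm_RI _ _)); rewrite !ger0_norm; lra.
have shift F w a lm : gd F (w + a) lm -> gd (fun w => F (w + a)) w lm.
  by move=> H e' /H[d d0 Hd]; exists d => // h /Hd; have -> : w + a + h = w + h + a by ring.
have gdB' (F K : C -> R) w a b : gd F w a -> gd K w b -> gd (fun w => F w - K w) w (a - b).
  exact: gdB.
have seg (v : C) s : z + s%:C * (z + v - z) = z + s%:C * v by rewrite [z + v]addrC addrK.
have [|s sI E1] := @mvt_gd_ex _ (fun w => u (w + iC * t%:C) - u w)
    (fun w => D (w + iC * t%:C) - D w) z (z + t%:C).
  move=> s sI; rewrite seg; have h1 : 0 <= s * t <= t.
    by have := mulr_ge0 (ltac:(lra) : 0 <= s) (ltW t0); have : s * t <= t; [rewrite ler_piMl; lra|lra].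
  apply: gdB'; [apply: shift|]; apply: Hu.
    have -> : z + s%:C * t%:C + iC * t%:C - z = (s * t) +i* t by apply: c_eqP; rewrite !cE /=; ring.
    by apply: (le_lt_trans (sq _ _ _ _)) => //; lra.
  have -> : z + s%:C * t%:C - z = (s * t) +i* 0 by apply: c_eqP; rewrite !cE /=; ring.
  by apply: (le_lt_trans (sq _ _ _ _)) => //; lra.
have [|s' s'I E2] := @mvt_gd_ex _ (fun w => u (w + t%:C) - u w)
    (fun w => D (w + t%:C) - D w) z (z + iC * t%:C).
  move=> s' s'I; rewrite seg; have h1 : 0 <= s' * t <= t.
    by have := mulr_ge0 (ltac:(lra) : 0 <= s') (ltW t0); have : s' * t <= t; [rewrite ler_piMl; lra|lra].
  apply: gdB'; [apply: shift|]; apply: Hu.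
    have -> : z + s'%:C * (iC * t%:C) + t%:C - z = t +i* (s' * t) by apply: c_eqP; rewrite !cE /=; ring.
    by apply: (le_lt_trans (sq _ _ _ _)) => //; lra.
  have -> : z + s'%:C * (iC * t%:C) - z = 0 +i* (s' * t) by apply: c_eqP; rewrite !cE /=; ring.
  by apply: (le_lt_trans (sq _ _ _ _)) => //; lra.
have h1 : 0 <= s * t <= t.
  by have := mulr_ge0 (ltac:(lra) : 0 <= s) (ltW t0); have : s * t <= t; [rewrite ler_piMl; lra|lra].
have h2 : 0 <= s' * t <= t.
  by have := mulr_ge0 (ltac:(lra) : 0 <= s') (ltW t0); have : s' * t <= t; [rewrite ler_piMl; lra|lra].
have n1 (x y : R) : 0 <= x <= t -> 0 <= y <= t ->
    `|Re (D (z + (x +i* y))) - Re (D z) - (Re l * x - Im l * y)| <= e / 8 * (2 * t).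
  move=> hx hy; rewrite -[Re l * x - _](cReM l (x +i* y)); apply: (le_trans (H1 _ _)); first by apply: le_lt_trans (sq _ _ hx hy) t1.
  by apply: ler_wpM2l; [exact: ltW|exact: sq].
have n2 (x y : R) : 0 <= x <= t -> 0 <= y <= t ->
    `|Im (D (z + (x +i* y))) - Im (D z) - (Re m * x - Im m * y)| <= e / 8 * (2 * t).
  move=> hx hy; rewrite -[Re m * x - _](cReM m (x +i* y)); apply: (le_trans (H2 _ _)); first by apply: le_lt_trans (sq _ _ hx hy) t2.
  by apply: ler_wpM2l; [exact: ltW|exact: sq].
have tt : 0 <= t <= t by lra.
have t00 : (0 : R) <= 0 <= t by rewrite lexx ltW.
have a1 := n1 (s * t) t h1 tt; have a2 := n1 (s * t) 0 h1 t00.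
have b1 := n2 t (s' * t) tt h2; have b2 := n2 0 (s' * t) t00 h2.
rewrite !seg in E1 E2.
have e1 : z + s%:C * t%:C + iC * t%:C = z + (s * t +i* t) by apply: c_eqP; rewrite !cE /=; ring.
have e2 : z + s%:C * t%:C = z + (s * t +i* 0) by apply: c_eqP; rewrite !cE /=; ring.
have e3 : z + s'%:C * (iC * t%:C) + t%:C = z + (t +i* (s' * t)) by apply: c_eqP; rewrite !cE /=; ring.
have e4 : z + s'%:C * (iC * t%:C) = z + (0 +i* (s' * t)) by apply: c_eqP; rewrite !cE /=; ring.
rewrite e1 e2 in E1; rewrite e3 e4 in E2.
have e5 : z + t%:C + iC * t%:C = z + iC * t%:C + t%:C by ring.
rewrite e5 in E1.
have e7 (v : C) : z + v - z = v by rewrite addrC addKr.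
rewrite e7 in E1; rewrite e7 in E2.
rewrite cReM cReB cImB [Re t%:C]/= [Im t%:C]/= mulr0 subr0 in E1.
have e8 (a b : C) : Re ((a - b) * (iC * t%:C)) = - ((Im a - Im b) * t) by rewrite !cE /=; ring.
rewrite e8 in E2.
move: a1 a2 b1 b2 E1 E2.
set X1 := Re (D _); set X2 := Re (D (z + (s * t +i* 0))); set X0 := Re (D z).
set Y1 := Im (D _); set Y2 := Im (D (z + (0 +i* (s' * t)))); set Y0 := Im (D z).
move: (u _) (u _) (u _) (u _) => u1 u2 u3 u4.
clearbody X1 X2 X0 Y1 Y2 Y0.
move: (Re l) (Im l) (Re m) (Im m) => l1 l2 m1 m2 a1 a2 b1 b2 E1 E2.
have E : (X1 - X2) * t = - ((Y1 - Y2) * t) by rewrite -E1 -E2; ring.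
have {}E : X1 - X2 = - (Y1 - Y2).
  by apply: (mulIf (lt0r_neq0 t0)); rewrite E mulNr.
have : `|(l2 - m1) * t| <= e * t.
  move: a1 a2 b1 b2; rewrite !ler_norml => /andP[a1 a1'] /andP[a2 a2'] /andP[b1 b1'] /andP[b2 b2'].
  apply/andP; split; lra.
by rewrite normrM (gtr0_norm t0) ler_pM2r.
Qed.

Lemma ccont_pair (a b : R * R -> R) p : {for p, continuous a} -> {for p, continuous b} ->
  ccont (fun z => (a (ofC z)) +i* (- b (ofC z))) (toC p).
Proof.
move=> c1 c2 e e0; have e2 : 0 < e / 2 by lra.
have [d1 d10 H1] := (contP _ _).1 c1 _ e2.
have [d2 d20 H2] := (contP _ _).1 c2 _ e2.
exists (Num.min d1 d2); first by rewrite lt_min d10.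
move=> w; rewrite lt_min -{1 2}(ofCK w) => /andP[w1 w2].
apply: (le_lt_trans (cm_le_ReIm _)); rewrite toCK /= -opprD normrN.
by have := H1 _ w1; have := H2 _ w2; lra.
Qed.

Definition fgrad u z : C := (partial1 u (ofC z)) +i* (- partial2 u (ofC z)).
Definition fgrad1 u z : C := (partial1 (partial1 u) (ofC z)) +i* (- partial2 (partial1 u) (ofC z)).

Opaque partial1 partial2.
(** Of the two Cauchy-Riemann equations for the conjugate gradient, one is the vanishing of the
    Laplacian and the other the symmetry of second derivatives, supplied by [clairaut]. *)
Lemma harmonic_hol A u p : open A -> C2_on A u -> (forall p, A p -> laplacian u p = 0) -> A p ->
  [/\ gd (uC u) (toC p) (fgrad u (toC p)), cd (fgrad u) (toC p) (fgrad1 u (toC p)) &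
      ccont (fgrad1 u) (toC p)].
Proof.
move=> oA [C1u C11 C12] lap Ap.
have gu q : A q -> gd (uC u) (toC q) (fgrad u (toC q)).
  by move=> Aq; rewrite /fgrad toCK; exact: (C1_gd oA).
have g1 : gd (fun w => Re (fgrad u w)) (toC p) (fgrad1 u (toC p)).
  by have := C1_gd oA C11 Ap; rewrite /fgrad1 toCK.
have g2 : gd (fun w => Im (fgrad u w)) (toC p)
   ((- partial1 (partial2 u) p) +i* (partial2 (partial2 u) p)).
  have := gdZ (-1) (C1_gd oA C12 Ap).
  rewrite (_ : (-1)%:C * _ = (- partial1 (partial2 u) p) +i* (partial2 (partial2 u) p)); last first.
    by apply: c_eqP; rewrite !cE /=; ring.
  by rewrite (_ : (fun w => -1 * _ w) = (fun w => Im (fgrad u w)))//; apply/funext => w; rewrite mulN1r.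
split; first exact: gu.
- apply: gd_cd => //; move: (g2); congr gd.
  have [r r0 Hr] := open_cm oA Ap.
  have H : forall w, cm (w - toC p) < r -> gd (uC u) w (fgrad u w).
    by move=> w wr; rewrite -(ofCK w); apply: gu; apply: Hr; rewrite ofCK.
  have E := clairaut r0 H g1 g2.
  have L := lap p Ap; rewrite /laplacian in L.
  move: E; rewrite /fgrad1 toCK [Re (_ +i* _)]/= [Im (_ +i* _)]/= => E.
  move: L E; move: (partial1 (partial1 u) p) (partial2 (partial2 u) p) (partial2 (partial1 u) p).
  move: (partial1 (partial2 u) p) => a b c d L E.
  by apply: c_eqP; rewrite !cE /=; lra.
- by have [_ _ c1 c2] := C11; apply: ccont_pair; [exact: c1|exact: c2].
Qed.
End Smooth.

(** * From a holomorphic conjugate gradient to a [C^2] harmonic function, and extension to the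
    boundary *)

Section Holomorphic.
Context {R : realType}.
Local Notation C := R[i].
Implicit Types (z w l : C) (p v : R * R) (u k : R * R -> R) (A G : set (R * R)).

Lemma cont_proj A k (F : C -> C) (pr : C -> R) p : open A -> A p ->
  (forall a b, `|pr a - pr b| <= cm (a - b)) ->
  (forall q, A q -> k q = pr (F (toC q))) -> ccont F (toC p) -> {for p, continuous k}.
Proof.
move=> oA Ap lip kE cF; apply/contP => e e0.
have [r r0 Hr] := open_cm oA Ap; have [d d0 Hd] := cF e e0.
exists (Num.min r d); first by rewrite lt_min r0.
move=> q; rewrite lt_min => /andP[qr qd].
by rewrite (kE q (Hr q qr)) (kE p Ap); apply: le_lt_trans (lip _ _) (Hd _ qd).
Qed.

Lemma Re_lip (a b : C) : `|Re a - Re b| <= cm (a - b).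
Proof. by rewrite -cReB; exact: Re_le_cm. Qed.

Lemma NIm_lip (a b : C) : `|- Im a - - Im b| <= cm (a - b).
Proof. by rewrite -opprD normrN -cImB; exact: Im_le_cm. Qed.

Lemma gd_proj A k (g : C -> R) p l : open A -> A p -> (forall q, A q -> k q = g (toC q)) ->
  gd g (toC p) l -> gd (uC k) (toC p) l.
Proof.
move=> oA Ap kE; have [r r0 Hr] := open_cm oA Ap.
have h (z : C) : cm (z - toC p) < r -> uC k z = g z.
  by move=> zr; rewrite /uC kE ?ofCK//; apply: Hr; rewrite ofCK.
move=> H e /H[d d0 Hd]; exists (Num.min d r); first by rewrite lt_min d0.
move=> x; rewrite lt_min => /andP[xd xr].
by rewrite !h ?subrr ?cm0 ?Hd//; rewrite addrAC subrr add0r.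
Qed.

Section C2.
Context (A : set (R * R)) (u : R * R -> R) (f f1 : C -> C).
Hypothesis oA : open A.
Hypothesis H : forall p, A p ->
  [/\ gd (uC u) (toC p) (f (toC p)), cd f (toC p) (f1 (toC p)) & ccont f1 (toC p)].

Lemma hol_partials p : A p ->
  partial1 u p = Re (f (toC p)) /\ partial2 u p = - Im (f (toC p)).
Proof. by move=> /H[/gd_partials[_ _ -> ->]]. Qed.

Lemma hol_gd1 p : A p -> gd (uC (partial1 u)) (toC p) (f1 (toC p)).
Proof.
move=> Ap; have [_ /cd_gdRe h _] := H Ap; apply: (gd_proj oA Ap) h.
by move=> q /hol_partials[].
Qed.

Lemma hol_gd2 p : A p -> gd (uC (partial2 u)) (toC p) (iC * f1 (toC p)).
Proof.
move=> Ap; have [_ /cd_gdIm h _] := H Ap; have := gdZ (-1) h.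
rewrite (_ : (-1)%:C * (- iC * f1 (toC p)) = iC * f1 (toC p)).
  by apply: (gd_proj oA Ap) => q /hol_partials[_ ->]; rewrite mulN1r.
by apply: c_eqP; rewrite !cE /=; ring.
Qed.

Lemma hol_laplacian p : A p -> laplacian u p = 0.
Proof.
move=> Ap; rewrite /laplacian.
have [_ _ -> _] := gd_partials (hol_gd1 Ap); have [_ _ _ ->] := gd_partials (hol_gd2 Ap).
by rewrite !cE /=; ring.
Qed.

Lemma hol_C2 : C2_on A u.
Proof.
have E1 q : A q -> partial1 (partial1 u) q = Re (f1 (toC q)) /\
    partial2 (partial1 u) q = - Im (f1 (toC q)).
  by move=> /hol_gd1/gd_partials[_ _ -> ->].
have E2 q : A q -> partial1 (partial2 u) q = - Im (f1 (toC q)) /\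
    partial2 (partial2 u) q = - Re (f1 (toC q)).
  move=> /hol_gd2/gd_partials[_ _ -> ->]; rewrite !cE /=; split; ring.
have NRe_lip (a b : C) : `|- Re a - - Re b| <= cm (a - b).
  by rewrite -opprD normrN; exact: Re_lip.
have cf q : A q -> ccont f (toC q) by move=> /H[_ /cd_cont].
have cf1 q : A q -> ccont f1 (toC q) by move=> /H[].
split; split.
- move=> p Ap; apply/contP => e e0; have [/gd_local[d d0 Hd] _ _] := H Ap.
  have K : 0 < cm (f (toC p)) + 1 by have := cm_ge0 (f (toC p)); lra.
  exists (Num.min d (e / (cm (f (toC p)) + 1))); first by rewrite lt_min d0 divr_gt0.
  move=> q; rewrite lt_min ltr_pdivlMr// => /andP[qd qe].
  have := Hd _ qd; rewrite /uC [toC p + _]addrC subrK !toCK => /le_lt_trans; apply.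
  by rewrite mulrC.
- by move=> p /H[/gd_partials[]].
- by move=> p Ap; apply: (cont_proj oA Ap Re_lip _ (cf p Ap)) => q /hol_partials[].
- by move=> p Ap; apply: (cont_proj oA Ap NIm_lip _ (cf p Ap)) => q /hol_partials[].
- by move=> p Ap; apply: (cont_proj oA Ap Re_lip _ (cf p Ap)) => q /hol_partials[].
- by move=> p /hol_gd1/gd_partials[].
- by move=> p Ap; apply: (cont_proj oA Ap Re_lip _ (cf1 p Ap)) => q /E1[].
- by move=> p Ap; apply: (cont_proj oA Ap NIm_lip _ (cf1 p Ap)) => q /E1[].
- by move=> p Ap; apply: (cont_proj oA Ap NIm_lip _ (cf p Ap)) => q /hol_partials[].
- by move=> p /hol_gd2/gd_partials[].
- by move=> p Ap; apply: (cont_proj oA Ap NIm_lip _ (cf1 p Ap)) => q /E2[].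
- by move=> p Ap; apply: (cont_proj oA Ap NRe_lip _ (cf1 p Ap)) => q /E2[].
Qed.
End C2.

(* A limit at each point of [G] depends continuously on the point, being a limit of values taken on [A]. *)
Lemma glue_continuous A G k (L : R * R -> R) : open A -> (forall p, G p -> ~ A p) ->
  C0_on A k ->
  (forall p, G p -> forall d : R, 0 < d -> exists2 q, A q & cm (toC q - toC p) < d) ->
  (forall p, G p -> k q @[q --> within A (nbhs p)] --> L p) ->
  {within A `|` G, continuous (fun p => if p \in A then k p else L p)}.
Proof.
move=> oA GA ck cl H; apply/within_contP => p.
have inA q : A q -> (q \in A) = true by exact: mem_set.
have inG q : G q -> (q \in A) = false by move=> /GA; exact: memNset.
case=> [Ap|Gp] e e0.
  have [r r0 Hr] := open_cm oA Ap.
  have [d d0 Hd] := (contP _ _).1 (ck p Ap) e e0.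
  exists (Num.min r d); first by rewrite lt_min r0.
  by move=> q _; rewrite lt_min => /andP[/Hr Aq /Hd]; rewrite !inA.
have e2 : 0 < e / 2 by lra.
have [d d0 Hd] := (withinP _ _ _ _).1 (H p Gp) _ e2.
exists (d / 2); first by lra.
move=> q [Aq|Gq] qd; rewrite (inG p)//.
  by rewrite inA//; have := Hd q Aq ltac:(lra); lra.
rewrite inG//.
have e4 : 0 < e / 2 by lra.
have [d' d'0 Hd'] := (withinP _ _ _ _).1 (H q Gq) _ e4.
have [q' Aq'] := cl q Gq (Num.min (d / 2) d') ltac:(by rewrite lt_min d'0 andbT; lra).
rewrite lt_min => /andP[h1 h2].
have a1 := Hd' q' Aq' h2.
have a2 : `|k q' - L p| < e / 2.
  apply: Hd => //; have := cmD (toC q' - toC q) (toC q - toC p).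
  by rewrite addrA subrK; lra.
have := ler_normB (k q' - L p) (k q' - L q).
have -> : k q' - L p - (k q' - L q) = L q - L p by ring.
lra.
Qed.

Lemma glue_extends A G k (L : R * R -> R) : open A -> (forall p, G p -> ~ A p) ->
  C0_on A k ->
  (forall p, G p -> forall d : R, 0 < d -> exists2 q, A q & cm (toC q - toC p) < d) ->
  (forall p, G p -> k q @[q --> within A (nbhs p)] --> L p) ->
  extends_continuously A (A `|` G) k.
Proof.
move=> oA GA ck cl H; exists (fun p => if p \in A then k p else L p); split.
  by move=> p ->.
exact: glue_continuous.
Qed.

Lemma extends_lim A G k p : extends_continuously A (A `|` G) k -> G p ->
  exists l : R, k q @[q --> within A (nbhs p)] --> l.
Proof.
move=> [F [FE cF]] Gp; exists (F p); apply/withinP => e e0.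
have [d d0 Hd] := (within_contP _ _).1 cF p (or_intror Gp) e e0.
exists d => // q Aq qd; rewrite -FE; last exact: mem_set.
by apply: Hd => //; left.
Qed.
End Holomorphic.

(** * Necessity of analyticity *)

Section Reflection.
Context {R : realType}.
Local Notation C := R[i].
Implicit Types (z w l : C).

Definition prim (c : nat -> C) : nat -> C := fun n => if n is m.+1 then c m / m.+1%:R else 0.

Lemma dcoef_prim c : dcoef (prim c) = c.
Proof.
apply/funext => n; by rewrite /dcoef /= mulrCA mulfV ?mulr1// pnatr_eq0.
Qed.

Lemma csumn_prim0 c N : csumn (prim c) 0 N = 0.
Proof.
rewrite /csumn big1// => -[[|i] hi] _; first by rewrite mul0r.
by rewrite exprS mul0r mulr0.
Qed.

Lemma csumn_prim_cd c z N : cd (fun h => csumn (prim c) h N.+1) z (csumn c z N).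
Proof. by have := csumn_cd (prim c) z N; rewrite dcoef_prim. Qed.

Lemma csumn_prim_Re c (s : R) N : Re (csumn (prim c) s%:C N) =
  \sum_(n < N) Re (prim c n) * s ^+ n.
Proof.
rewrite csumn_Re; apply: eq_bigr => i _.
have -> : (s%:C : C) ^+ i = (s ^+ i)%:C by rewrite rmorphXn.
by rewrite cReM /= mulr0 subr0.
Qed.

Context (phi phi1 : C -> C) (w : C -> R) (x0 r : R) (H psi : R -> R).
Hypothesis r0 : 0 < r.
Hypothesis Hphi : forall z, cm (z - x0%:C) < r -> 0 < Im z ->
  [/\ cd phi z (phi1 z), ccont phi1 z & gd w z (phi z)].
Hypothesis Hpsi : forall t, `|t - x0| < r -> uplim phi t%:C (psi t)%:C.
Hypothesis HH : forall t, `|t - x0| < r -> uplim (fun z => (w z)%:C) t%:C (H t)%:C.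

(* Schwarz reflection; [psi] is the boundary value of [phi], which is real. *)
Definition refl z : C := if 0 < Im z then phi z else
  if Im z < 0 then cj (phi (cj z)) else (psi (Re z))%:C.
Definition refl1 z : C := if 0 < Im z then phi1 z else cj (phi1 (cj z)).

Lemma reflR (t : R) : refl t%:C = (psi t)%:C.
Proof. by rewrite /refl /= ltxx. Qed.

Lemma half_near (z : C) : 0 < Im z -> forall v, cm (v - z) < Im z -> 0 < Im v.
Proof.
move=> z0 v; have := Im_le_cm (v - z); rewrite cImB ler_norml => /andP[h _]; lra.
Qed.

Lemma half_near' (z : C) : Im z < 0 -> forall v, cm (v - z) < - Im z -> Im v < 0.
Proof.
move=> z0 v; have := Im_le_cm (v - z); rewrite cImB ler_norml => /andP[_ h]; lra.
Qed.

Lemma cj_dist z : cm (cj z - x0%:C) = cm (z - x0%:C).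
Proof. by rewrite -cmJ cJB cJK cJR. Qed.

Lemma refl_cd z : cm (z - x0%:C) < r -> Im z != 0 -> cd refl z (refl1 z) /\ ccont refl1 z.
Proof.
move=> zr; have [z0 _|z0 _|z0] := ltgtP 0 (Im z); last by [].
- have [h1 h2 _] := Hphi zr z0; split.
    rewrite /refl1 z0; apply: (cd_ext z0 _ h1) => v /(half_near z0) v0.
    by rewrite /refl v0.
  by apply: (cont_ext z0 _ h2) => v /(half_near z0) v0; rewrite /refl1 v0.
- have j0 : 0 < Im (cj z) by rewrite cImJ oppr_gt0.
  have [h1 h2 _] := Hphi (ltac:(by rewrite cj_dist) : cm (cj z - x0%:C) < r) j0.
  have nz : 0 < - Im z by rewrite oppr_gt0.
  split.
    rewrite /refl1 ltNge ltW//=; apply: (cd_ext nz _ (cd_conj h1)) => v /(half_near' z0) v0.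
    by rewrite /refl v0 ltNge ltW.
  apply: (cont_ext (F := fun v => cj (phi1 (cj v))) nz) => [v /(half_near' z0) v0|].
    by rewrite /refl1 ltNge ltW.
  apply: (@cont_comp _ (@cj R) (fun v => phi1 (cj v))); last exact: cont_cj.
  by apply: (@cont_comp _ phi1 (@cj R)); first exact: cont_cj.
Qed.

Lemma refl_cont_axis (t : R) : `|t - x0| < r -> ccont refl t%:C.
Proof.
move=> tr e e0; have e2 : 0 < e / 2 by lra.
have [d d0 Hd] := Hpsi tr e2.
pose k := Num.min (d / 2) (r - `|t - x0|).
have k0 : 0 < k by rewrite lt_min subr_gt0 tr andbT; lra.
exists k => // v; rewrite lt_min => /andP[vd vr].
rewrite reflR /refl; case: (ltgtP 0 (Im v)) => v0.
- by apply: (lt_trans (Hd v _ v0)); lra.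
- have j0 : 0 < Im (cj v) by rewrite cImJ oppr_gt0.
  have -> : cj (phi (cj v)) - (psi t)%:C = cj (phi (cj v) - (psi t)%:C) by rewrite cJB cJR.
  have jd : cm (cj v - t%:C) < d by rewrite -cmJ cJB cJK cJR; lra.
  by rewrite cmJ; apply: (lt_trans (Hd _ jd j0)); lra.
(* Continuity of [psi] along the axis is not assumed: the values at [s] and [t] are compared through
   one point just above [s], close enough for both limits. *)
- have vE : v = (Re v)%:C by apply: c_eqP => //=.
  set s := Re v in vE *; rewrite vE -cRN -cRD cmR in vd vr.
  have sr : `|s - x0| < r.
    have := ler_normD (s - t) (t - x0); rewrite addrA subrK; lra.
  have [d' d'0 Hd'] := Hpsi sr e2.
  pose y := Num.min (d / 2) d' / 2.
  have m0 : 0 < Num.min (d / 2) d' by rewrite lt_min d'0 andbT; lra.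
  have y0 : 0 < y by rewrite /y; lra.
  have y1 : y < d / 2 by have : Num.min (d / 2) d' <= d / 2; [rewrite ge_min lexx|rewrite /y; lra].
  have y2 : y < d' by have : Num.min (d / 2) d' <= d'; [rewrite ge_min lexx orbT|rewrite /y; lra].
  have E : cm ((s +i* y) - s%:C) = y.
    have -> : (s +i* y) - s%:C = iC * y%:C by apply: c_eqP; rewrite !cE /=; ring.
    by rewrite cmM cm_i mul1r cmR gtr0_norm.
  have a1 : cm (phi (s +i* y) - (psi s)%:C) < e / 2 by apply: Hd' => //; rewrite E.
  have a2 : cm (phi (s +i* y) - (psi t)%:C) < e / 2.
    apply: Hd => //.
    have -> : (s +i* y) - t%:C = ((s +i* y) - s%:C) + (s - t)%:C by rewrite cRD cRN; ring.
    by apply: (le_lt_trans (cmD _ _)); rewrite E cmR; lra.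
  have := cmB (phi (s +i* y) - (psi t)%:C) (phi (s +i* y) - (psi s)%:C).
  have -> : phi (s +i* y) - (psi t)%:C - (phi (s +i* y) - (psi s)%:C) = (psi s)%:C - (psi t)%:C.
    by ring.
  lra.
Qed.

Lemma refl_cont z : cm (z - x0%:C) < r -> ccont refl z.
Proof.
move=> zr; have [z0|z0] := eqVneq (Im z) 0; last first.
  by have [/cd_cont] := refl_cd zr z0.
have -> : z = (Re z)%:C by apply: c_eqP => //=.
apply: refl_cont_axis; apply: le_lt_trans zr.
by have := Re_le_cm (z - x0%:C); rewrite cReB.
Qed.

Lemma refl_series : exists (c : nat -> C) (K : R), 0 <= K /\
  forall h, cm h < r / 8 -> forall N, cm (refl (x0%:C + h) - csumn c h N) <= K / 2 ^+ N.
Proof.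
have inr h : insq (2 * (r / 4)) h -> cm (x0%:C + h - x0%:C) < r.
  move=> /andP[h1 h2]; rewrite addrAC subrr add0r.
  by apply: (le_lt_trans (cm_le_ReIm _)); lra.
have sh (F : C -> C) h : ccont F (x0%:C + h) -> ccont (fun h => F (x0%:C + h)) h.
  move=> cF; apply: (@cont_comp _ F (fun h => x0%:C + h)) => //.
  by apply: contD; [exact: cont_cst|exact: cont_id].
have rr : 0 < r / 4 by rewrite divr_gt0.
have [h /inr hr|h /inr hr h0|c [K [K0 HK]]] := @cauchy_series _ (fun h => refl (x0%:C + h))
    (fun h => refl1 (x0%:C + h)) (r / 4) 0 rr.
- by apply: sh; exact: refl_cont.
- have i0 : Im (x0%:C + h) != 0 by rewrite cImD /= add0r.
  have [h1 h2] := refl_cd hr i0; split; last exact: sh.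
  have := cd_comp (cdD (cd_cst x0%:C h) (cd_id h)) h1.
  by rewrite add0r mulr1.
exists c, K; split => // h hr N; apply: HK; lra.
Qed.

(** The gradient relation for [w] holds only above the axis. The primitive of the reflected series
    is therefore compared with [w] along a horizontal segment at height [y], and [y] is sent to
    zero; the rate [K / 2 ^+ N] does not depend on [y]. *)
Lemma upper_analytic : exists (c : nat -> R) (rho : R), 0 < rho /\
  forall x, `|x - x0| < rho -> pseries c (x - x0) @ \oo --> H x.
Proof.
have rr := r0.
have [c [K [K0 HK]]] := refl_series.
pose P N z := csumn (prim c) z N.+1.
have key N (s : R) : `|s| < r / 8 -> `|H (x0 + s) - H x0 - Re (P N s%:C)| <= K / 2 ^+ N * `|s|.
  move=> sr; set B := K / 2 ^+ N.
  have B0 : 0 <= B by rewrite divr_ge0 ?exprn_ge0.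
  apply/ler_addgt0Pl => e e0.
  have e4 : 0 < e / 4 by lra.
  have sr1 : `|x0 + s - x0| < r by rewrite addrAC subrr add0r; lra.
  have sr0 : `|x0 - x0| < r by rewrite subrr normr0.
  have [d1 d10 H1] := HH sr1 e4; have [d2 d20 H2] := HH sr0 e4.
  have [d3 d30 H3] := cd_cont (csumn_prim_cd c s%:C N) e4.
  have [d4 d40 H4] := cd_cont (csumn_prim_cd c 0 N) e4.
  pose m := Num.min (Num.min (Num.min d1 d2) (Num.min d3 d4)) (r / 8 - `|s|).
  have m0 : 0 < m by rewrite !lt_min d10 d20 d30 d40 subr_gt0.
  pose y := m / 2; have y0 : 0 < y by rewrite /y; lra.
  have : y < m by rewrite /y; lra.
  rewrite !lt_min => /andP[/andP[/andP[y1 y2] /andP[y3 y4]] y5].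
  have ty (t : R) : cm ((t +i* y) - t%:C) = y.
    have -> : (t +i* y) - t%:C = iC * y%:C by apply: c_eqP; rewrite !cE /=; ring.
    by rewrite cmM cm_i mul1r cmR gtr0_norm.
  pose W z := w (x0%:C + z) - Re (P N z).
  have inh (t : R) : 0 <= t <= 1 -> let v := (0 +i* y) + t%:C * ((s +i* y) - (0 +i* y)) in
      cm v < r / 8 /\ 0 < Im v.
    move=> /andP[t0 t1] v; rewrite /v Im_seg /= subrr mulr0 addr0; split => //.
    have -> : (0 +i* y) + t%:C * ((s +i* y) - (0 +i* y)) = (t * s) +i* y.
      by apply: c_eqP; rewrite !cE /=; ring.
    apply: (le_lt_trans (cm_RI _ _)); rewrite normrM (ger0_norm t0) (gtr0_norm y0).
    have : t * `|s| <= `|s| by rewrite ler_piMl.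
    lra.
  have E : cm ((s +i* y) - (0 +i* y)) = `|s|.
    by rewrite (_ : _ - _ = s%:C) ?cmR//; apply: c_eqP; rewrite !cE /=; ring.
  have b : `|W (s +i* y) - W (0 +i* y)| <= B * `|s|.
    rewrite -E; apply: (@mvt_gd _ W (fun z => phi (x0%:C + z) - csumn c z N)) => t /inh[].
      set v := _ + _ => vr v0.
      have vr' : cm (x0%:C + v - x0%:C) < r by rewrite addrAC subrr add0r; lra.
      have v0' : 0 < Im (x0%:C + v) by rewrite cImD /= add0r.
      have [_ _ gw] := Hphi vr' v0'; apply: gdB; last exact: cd_gdRe (csumn_prim_cd _ _ _).
      by have := gd_comp (cdD (cd_cst x0%:C v) (cd_id v)) gw; rewrite add0r mulr1.
    set v := _ + _ => vr v0.
    have v0' : 0 < Im (x0%:C + v) by rewrite cImD /= add0r.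
    by have := HK v vr N; rewrite /refl v0'.
  have a1 := H1 (x0%:C + (s +i* y)) ltac:(by rewrite cRD (_ : _ - _ = (s +i* y) - s%:C) ?ty//; ring)
     ltac:(by rewrite cImD /= add0r).
  have a2 := H2 (x0%:C + (0 +i* y)) ltac:(by rewrite (_ : _ - _ = (0 +i* y) - 0%:C) ?ty// /=; ring)
     ltac:(by rewrite cImD /= add0r).
  have a3 := H3 (s +i* y) ltac:(by rewrite ty).
  have a4 := H4 (0 +i* y) ltac:(by rewrite -[0 in X in cm (_ - X)]/(0%:C) ty).
  rewrite csumn_prim0 subr0 in a4.
  rewrite -cRN -cRD cmR in a1; rewrite -cRN -cRD cmR in a2.
  have a5 := Re_le_cm (P N (s +i* y) - P N s%:C); rewrite cReB in a5.
  have a6 := Re_le_cm (P N (0 +i* y)).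
  rewrite -/(P N _) in a3 a4; rewrite -/(P N _) in a3.
  move: b; rewrite /W.
  move: (w _) (w _) a1 a2 => w1 w2 a1 a2.
  move: (Re (P N (s +i* y))) (Re (P N s%:C)) a5 => p1 p2 a5.
  move: (Re (P N (0 +i* y))) a6 => p3 a6 b.
  have {}a5 : `|p1 - p2| <= e / 4 by apply: ltW; exact: le_lt_trans a3.
  have {}a6 : `|p3| <= e / 4 by apply: ltW; exact: le_lt_trans a4.
  move: a1 a2 a5 a6 b; rewrite !ltr_norml !ler_norml.
  move=> /andP[? ?] /andP[? ?] /andP[? ?] /andP[? ?] /andP[? ?].
  by apply/andP; split; lra.
(* The constant lost in differentiation is [H x0]; as [H] is real, the real parts of the primitive's
   coefficients give the rest. *)
pose c' n := if n is m.+1 then Re (prim c m.+1) else H x0.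
exists c', (r / 8); split; first lra.
move=> x xr; rewrite -cvg_shiftS /=; apply/cvgrPdist_le => e e0.
set s := x - x0 in xr *.
have xE : x0 + s = x by rewrite /s addrC subrK.
have sE n : pseries c' s n.+1 = H x0 + Re (P n s%:C).
  rewrite /P csumn_prim_Re /pseries /series /= big_mkord !big_ord_recl /= expr0 mulr1 mul0r add0r.
  by [].
have [N HN] : exists N : nat, forall n, (N <= n)%N -> K / 2 ^+ n * `|s| <= e.
  exists (Num.bound (K * `|s| / e)) => n Nn.
  have Ks : 0 <= K * `|s| by rewrite mulr_ge0.
  have := archi_boundP (divr_ge0 Ks (ltW e0)); rewrite ltr_pdivrMr// => h.
  have p2 : 0 < 2 ^+ n :> R by rewrite exprn_gt0.
  rewrite mulrAC ler_pdivrMr//; apply: (le_trans (ltW h)); rewrite mulrC ler_pM2l//.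
  by rewrite -natrX ler_nat; apply: (leq_trans Nn); apply: ltnW; exact: ltn_expl.
exists N => // n /= Nn; rewrite sE.
by have := key n s xr; rewrite xE opprD addrA => /le_trans; apply; exact: HN.
Qed.
End Reflection.

(** * The sides of the graph in terms of the parameter *)

Section Geometry.
Context {R : realType}.
Local Notation C := R[i].
Implicit Types (z w l : C) (p : R * R).
Context (W : set R) (Psi F g h : R -> R) (dl M : R).
Variables (oW : open W) (KW : `[-1, 1] `<=` W) (FW : real_analytic_on W F).
Variable FE : {in `[-1, 1]%classic, F =1 Psi}.
Variable H : curve_data (gam F 0) (gam F 1) (gam F 2) (gam F 3) dl M.
Local Notation ga := (gam F 0).

Let gaE t : -1 <= t <= 1 -> ga t%:C = t +i* Psi t.
Proof. exact: (gam_real KW FW FE). Qed.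

Lemma Psi_lip t s : -1 <= t <= 1 -> -1 <= s <= 1 -> `|Psi t - Psi s| <= M * `|t - s|.
Proof.
move=> tI sI; have d0 := cv_dl H.
have := cv_ub H (strip_real d0 sI) (strip_real d0 tI).
rewrite !gaE// -cRN -cRD cmR => /(le_trans _); apply.
by have := Im_le_cm ((t +i* Psi t) - (s +i* Psi s)); rewrite cImB.
Qed.

(* [ga z - ga t] is vertical for [t = Re (ga z)], so [cv_lb_re] compares the height above the curve with [Im z]. *)
Lemma height_sign z : strip dl z -> -1 <= Re (ga z) <= 1 ->
  2^-1 * cm (z - (Re (ga z))%:C) ^+ 2 <= (Im (ga z) - Psi (Re (ga z))) * Im z.
Proof.
move=> hz tI; set t := Re (ga z) in tI *.
have := cv_lb_re H (strip_real (cv_dl H) tI) hz; rewrite (gaE tI).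
move=> /le_trans; apply.
have -> : ga z - (t +i* Psi t) = 0 +i* (Im (ga z) - Psi t).
  by apply: c_eqP; rewrite ?cReB ?cImB //= -/t subrr.
by rewrite cReM cReJ cImJ Im_sub_real /= mulr0 sub0r mulNr opprK mulrC.
Qed.

(** By the Lipschitz bound on [Psi], a nearby point of the subgraph puts [p] below the graph up to a
    multiple of the distance. Limits may have abscissa [-1] or [1], hence the closed interval. *)
Lemma closure_subgraph p : closure (subgraph Psi) p -> -1 <= p.1 <= 1 /\ p.2 <= Psi p.1.
Proof.
move=> cp.
have near (d : R) : 0 < d -> exists q, [/\ -1 < q.1 < 1, q.2 < Psi q.1,
    `|q.1 - p.1| <= d & `|q.2 - p.2| <= d].
  move=> d0; have [q [[/= q1 q2] qd]] := cp [set q | cm (toC q - toC p) < d]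
    ((nbhs_cm _ _).2 (ex_intro2 _ _ d d0 (fun p' h => h))).
  exists q; split => //; apply: ltW; apply: le_lt_trans qd.
  - by have := Re_le_cm (toC q - toC p); rewrite cReB.
  - by have := Im_le_cm (toC q - toC p); rewrite cImB.
have p1 : -1 <= p.1 <= 1.
  apply/andP; split; apply/ler_addgt0Pl => e /near[q [q1 _ qd _]];
    move: qd; rewrite ler_norml => /andP[? ?]; lra.
split => //; apply/ler_addgt0Pl => e e0.
have M1 := cv_M H; have M0 : 0 < M + 1 by lra.
have [q [q1 q2 d1 d2]] := near (e / (M + 1)) ltac:(by rewrite divr_gt0).
have L := @Psi_lip q.1 p.1 ltac:(lra) p1.
have L2 : M * `|q.1 - p.1| <= M * (e / (M + 1)) by rewrite ler_wpM2l//; lra.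
have E : M * (e / (M + 1)) + e / (M + 1) = e by field; rewrite gt_eqF.
move: L d2; rewrite !ler_norml => /andP[_ L] /andP[d2 _]; lra.
Qed.

Lemma subgraph_closure p : -1 < p.1 < 1 -> p.2 <= Psi p.1 -> closure (subgraph Psi) p.
Proof.
move=> p1 p2 B /nbhs_cm[d d0 Hd].
exists (p.1, p.2 - d / 2); split; first by split => //=; lra.
apply: Hd; rewrite toC_sub /= subrr addrAC subrr add0r.
apply: (le_lt_trans (cm_RI _ _)); rewrite normr0 add0r normrN gtr0_norm; lra.
Qed.

Lemma above_notin z : strip dl z -> 0 < Im z -> ~ closure (subgraph Psi) (ofC (ga z)).
Proof.
move=> hz z0 /closure_subgraph[/= h1 h2].
have := height_sign hz h1; rewrite leNgt => /negP; apply.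
set t := Re (ga z) in h1 h2 *.
have : 0 < cm (z - t%:C).
  by rewrite cm_gt0; apply: contraTneq z0 => E; rewrite -(Im_sub_real z t) E ltxx.
move=> c0; have c2 : 0 < cm (z - t%:C) ^+ 2 by rewrite exprn_gt0.
have : (Im (ga z) - Psi t) * Im z <= 0 by rewrite pmulr_lle0// subr_le0.
lra.
Qed.

Lemma below_in z : strip dl z -> -1 < Re (ga z) < 1 -> Im z <= 0 ->
  closure (subgraph Psi) (ofC (ga z)).
Proof.
move=> hz tI z0; apply: subgraph_closure => //=.
have := @height_sign z hz ltac:(lra); set t := Re (ga z) in tI *.
set s := Im _ - _; have c2 := sqr_ge0 (cm (z - t%:C)) => h1.
have [zn|zp|zE] := ltgtP (Im z) 0; last 1 first.
- move: h1; rewrite zE mulr0 => h1.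
  have c0 : cm (z - t%:C) ^+ 2 = 0 by apply/eqP; rewrite eq_le c2 andbT; lra.
  have zt : z = t%:C by apply/eqP; rewrite -subr_eq0 -cm_eq0 -sqrf_eq0 c0.
  by rewrite /ofC /= zt gaE//=; lra.
- have : 0 <= s * Im z by apply: le_trans h1; rewrite mulr_ge0.
  by rewrite nmulr_lge0// /s subr_le0.
- by have := lt_le_trans zp z0; rewrite ltxx.
Qed.

Lemma Gamma_closure p : graph_curve Psi p -> closure (subgraph Psi) p.
Proof. by move=> [p1 p2]; apply: subgraph_closure; rewrite ?p2. Qed.
End Geometry.

Section Forward.
Context {R : realType}.
Local Notation C := R[i].
Implicit Types (z w l : C) (p : R * R).
Context (W : set R) (Psi F g h : R -> R) (dl M Q L : R).
Variables (oW : open W) (KW : `[-1, 1] `<=` W) (FW : real_analytic_on W F).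
Variable FE : {in `[-1, 1]%classic, F =1 Psi}.
Variable H : curve_data (gam F 0) (gam F 1) (gam F 2) (gam F 3) dl M.
Variable D : density (qd F h) Q L.
Local Notation ga := (gam F 0).
Local Notation ga1 := (gam F 1).
Local Notation q := (qd F h).
Local Notation tau := (tau ga ga1 q).
Local Notation S := (closure (subgraph Psi)).

Lemma qdE t : -1 < t < 1 -> q t = h t * Num.sqrt (1 + derive1 Psi t ^+ 2).
Proof.
move=> tI; rewrite /qd clamp_id; last by lra.
by rewrite (gam1_real oW KW FW FE tI) cmE /= expr1n.
Qed.

Lemma normal_derivativeE A (u : R * R -> R) x a b :
  boundary_value A (partial1 u) (x, Psi x) = a -> boundary_value A (partial2 u) (x, Psi x) = b ->
  normal_derivative Psi A u x = (b - a * derive1 Psi x) / Num.sqrt (1 + derive1 Psi x ^+ 2).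
Proof.
move=> ha hb; rewrite /normal_derivative ha hb /unit_normal.
set N := Num.sqrt _.
rewrite [(N^-1 *: _).1](_ : _ = N^-1 * - derive1 Psi x)//.
rewrite [(N^-1 *: _).2](_ : _ = N^-1 * 1)//.
ring.
Qed.

Lemma sqrt_pos x : 0 < Num.sqrt (1 + derive1 Psi x ^+ 2).
Proof. by rewrite sqrtr_gt0 ltr_pwDl// sqr_ge0. Qed.

Context (U : set (R * R)) (u : R * R -> R).
Local Notation A := (U `\` S).
Local Notation Gm := (graph_curve Psi).
Hypothesis oU : open U.
Hypothesis GU : Gm `<=` U.
Hypothesis C2u : C2_on A u.
Hypothesis C1u : C1_up_to A Gm u.
Hypothesis sol : cauchy_solution Psi g h U u.

Lemma open_A : open A.
Proof. by apply: openI => //; apply: closed_openC; exact: closed_closure. Qed.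

Lemma ga_near (t : R) : -1 < t < 1 -> exists2 r : R, 0 < r & forall z, cm (z - t%:C) < r ->
  [/\ strip dl z, -1 < Re z < 1, 0 < Im z -> A (ofC (ga z)) &
      cm (ga z - ga t%:C) <= M * cm (z - t%:C)].
Proof.
move=> tI; have [r r0 [[r1 r2 r3 r4] Hr]] := strip_near H tI.
have tI' : -1 <= t <= 1 by lra.
have Gt : Gm (ofC (ga t%:C)) by rewrite (gam_real KW FW FE tI').
have [d d0 Hd] := open_cm oU (GU Gt); rewrite ofCK in Hd.
have M1 := cv_M H; have Mp : 0 < M by lra.
exists (Num.min r (d / M)); first by rewrite lt_min r0 divr_gt0.
move=> z; rewrite lt_min => /andP[zr zd].
have hz := Hr z zr.
have L1 := cv_ub H (strip_real (cv_dl H) tI') hz.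
have rz : `|Re z - t| < r by apply: le_lt_trans zr; have := Re_le_cm (z - t%:C); rewrite cReB.
split => //; first by move: rz; rewrite ltr_norml => /andP[? ?]; apply/andP; split; lra.
move=> z0; split; last exact: (above_notin KW FW FE H hz z0).
apply: Hd; rewrite ofCK; apply: (le_lt_trans L1).
by rewrite mulrC -ltr_pdivlMr.
Qed.

Lemma A_near (t : R) : -1 < t < 1 -> forall d : R, 0 < d ->
  exists2 p, A p & cm (toC p - toC (t, Psi t)) < d.
Proof.
move=> tI d d0; have [r r0 Hr] := ga_near tI.
have M1 := cv_M H; have Mp : 0 < M by lra.
pose y := Num.min (r / 2) (d / M / 2).
have y0 : 0 < y by rewrite lt_min !divr_gt0.
have E : cm ((t +i* y) - t%:C) = y.
  have -> : (t +i* y) - t%:C = iC * y%:C by apply: c_eqP; rewrite !cE /=; ring.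
  by rewrite cmM cm_i mul1r cmR gtr0_norm.
have yr : y <= r / 2 by rewrite ge_min lexx.
have yd : y <= d / M / 2 by rewrite ge_min lexx orbT.
have [_ _ Az L1] := Hr (t +i* y) ltac:(by rewrite E; lra).
exists (ofC (ga (t +i* y))); first exact: Az.
rewrite ofCK (_ : toC (t, Psi t) = ga t%:C); last by rewrite (gam_real KW FW FE)//; lra.
apply: (le_lt_trans L1); rewrite E mulrC -ltr_pdivlMr//.
have : 0 < d / M by rewrite divr_gt0.
lra.
Qed.

Lemma uplim_ga (k : R * R -> R) (t l : R) : -1 < t < 1 ->
  k p @[p --> within A (nbhs (t, Psi t))] --> l ->
  uplim (fun z => (k (ofC (ga z)))%:C) t%:C l%:C.
Proof.
move=> tI /withinP kl e /kl[d d0 Hd]; have [r r0 Hr] := ga_near tI.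
have M1 := cv_M H; have Mp : 0 < M by lra.
exists (Num.min r (d / M)); first by rewrite lt_min r0 divr_gt0.
move=> z; rewrite lt_min => /andP[/Hr[_ _ Az L1] zd] z0.
rewrite -cRN -cRD cmR; apply: Hd; first exact: Az.
rewrite ofCK (_ : toC (t, Psi t) = ga t%:C); last by rewrite (gam_real KW FW FE)//; lra.
by apply: (le_lt_trans L1); rewrite mulrC -ltr_pdivlMr.
Qed.

(** The Neumann condition, freed of the normalising root, says that [(a - i b) * (1 + i Psi')] has
    imaginary part [- q t]; this is the imaginary part of the limit of [tau]. *)
Lemma fgrad_uplim t : -1 < t < 1 -> exists a b : R, b - a * derive1 Psi t = q t /\
  uplim (fun z => fgrad u (ga z)) t%:C (a +i* (- b)).
Proof.
move=> tI; have [_ _ e1 e2] := C1u.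
have Gt : Gm (t, Psi t) by split.
have [a Ha] := extends_lim e1 Gt; have [b Hb] := extends_lim e2 Gt.
exists a, b; split.
  have [_ _ /(_ t tI)] := sol.
  have cl := A_near tI.
  rewrite (normal_derivativeE (boundary_valueE cl Ha) (boundary_valueE cl Hb)) qdE// => <-.
  by rewrite divfK// gt_eqF// sqrt_pos.
apply: uplim_ReIm => /=; first exact: uplim_ga Ha.
have := uplimM (uplim_cont (cont_cst (-1) t%:C)) (uplim_ga tI Hb).
rewrite -[- b]mulN1r cRM; rewrite (_ : (-1)%:C = -1 :> C); last by rewrite cRN.
by apply: uplim_ext ltr01 _ => z _ _; rewrite mulN1r cRN.
Qed.

Lemma H_fun_analytic : real_analytic_on `]-1, 1[ (H_fun Psi g h).
Proof.
move=> x0; rewrite /= in_itv /= => xI.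
have [r r0 Hr] := ga_near xI.
have lapl p : A p -> laplacian u p = 0 by have [+ _ _] := sol; exact.
have near t : `|t - x0| < r -> -1 < t < 1.
  by move=> tr; have [] := Hr t%:C ltac:(by rewrite -cRN -cRD cmR).
(* This is the conjugate gradient of [w]. Its boundary value [psi] is real because the imaginary
   parts of both terms tend to [- q]. *)
pose phi z := fgrad u (ga z) * ga1 z - tau z.
pose phi1 z := (fgrad1 u (ga z) * ga1 z * ga1 z + fgrad u (ga z) * gam F 2 z) - tau1 ga ga1 (gam F 2) q z.
pose w z := uC u (ga z) - Tp ga q z.
pose psi t := xget 0 [set l : R | uplim phi t%:C l%:C].
have lim_phi t : -1 < t < 1 -> uplim phi t%:C (psi t)%:C.
  move=> tI; apply: (@xgetPex _ (0 : R) [set l : R | uplim phi t%:C l%:C]).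
  have [a [b [E Hf]]] := fgrad_uplim tI; have [l Hl] := tau_lim H D tI.
  exists (a - (- b) * derive1 Psi t - l) => /=.
  have st : strip dl t%:C by apply: strip_real (cv_dl H) _; lra.
  have := uplimD (uplimM Hf (uplim_cont (cd_cont (cv_d2 H st)))) (uplimN Hl).
  rewrite (gam1_real oW KW FW FE tI); congr uplim.
  by apply: c_eqP; rewrite !cE /= -?E; ring.
have lim_w t : -1 < t < 1 -> uplim (fun z => (w z)%:C) t%:C (H_fun Psi g h t)%:C.
  move=> tI; rewrite (H_funE g oW KW FW FE H D tI).
  have [_ /within_contP cu _ _] := C1u.
  have Gt : Gm (t, Psi t) by split.
  have [_ ug _] := sol.
  have lu : u p @[p --> within A (nbhs (t, Psi t))] --> g t.
    apply/withinP => e /(cu _ (or_intror Gt))[d d0 Hd]; exists d => // p Ap pd.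
    by rewrite -(ug t tI); apply: Hd => //; left.
  have := uplimD (uplim_ga tI lu) (uplimN (Tp_lim H D tI)).
  by rewrite -cRN -cRD; apply: uplim_ext ltr01 _ => z _ _; rewrite -cRN -cRD.
apply: (@upper_analytic _ phi phi1 w x0 r (H_fun Psi g h) psi) => //.
- move=> z zr z0; have [hz _ /(_ z0) Az _] := Hr z zr; have zn : Im z != 0 by rewrite gt_eqF.
  have [gu cf cf1] := harmonic_hol open_A C2u lapl Az; rewrite ofCK in gu cf cf1.
  have c0 := cv_d1 H hz; have c1 := cv_d2 H hz; have c2 := cv_d3 H hz.
  split.
  + apply: cdB; last exact: (tau_cd H D).
    exact: cdM (cd_comp c0 cf) c1.
  + apply: contB; last exact: (tau1_cont H D).
    apply: contD; apply: contM.
    * apply: contM; last exact: cd_cont c1.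
      by apply: (@cont_comp _ (fgrad1 u) ga) cf1; exact: cd_cont c0.
    * exact: cd_cont c1.
    * by apply: (@cont_comp _ (fgrad u) ga); [exact: cd_cont c0|exact: cd_cont cf].
    * exact: cd_cont c2.
  + apply: gdB; first exact: gd_comp c0 gu.
    exact: (Tp_gd H D).
- by move=> t /near/lim_phi.
- by move=> t /near/lim_w.
Qed.
End Forward.

(** * Sufficiency of analyticity *)

Section Inverse.
Context {R : realType}.
Local Notation C := R[i].
Implicit Types (z w l : C) (p : R * R).

Lemma rect_compact_set (a b c d : R) : compact (`[a, b]%classic `*` `[c, d]%classic : set (R * R)).
Proof. by apply: compact_setX; exact: segment_compact. Qed.

(* At an interior minimum of [|G - zeta|] the value [zeta] is attained, since a nonzero derivative
   would allow a descent; the lower bound keeps the minimum away from the boundary. *)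
Lemma open_map (G G1 : C -> C) z0 (r : R) : 0 < r ->
  (forall z, cm (z - z0) < r -> cd G z (G1 z) /\ G1 z != 0) ->
  (forall z, cm (z - z0) < r -> cm (z - z0) / 2 <= cm (G z - G z0)) ->
  exists2 d : R, 0 < d & forall zeta, cm (zeta - G z0) < d ->
    exists2 z, cm (z - z0) < r & G z = zeta.
Proof.
move=> r0 HG lb; pose s := r / 4; have s0 : 0 < s by rewrite divr_gt0.
exists (s / 4) => [|zeta hz]; first by rewrite divr_gt0.
pose K : set (R * R) := `[Re z0 - s, Re z0 + s]%classic `*` `[Im z0 - s, Im z0 + s]%classic.
have KP z : K (ofC z) <-> `|Re (z - z0)| <= s /\ `|Im (z - z0)| <= s.
  rewrite /K /= !in_itv /= cReB cImB !ler_norml; split.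
    by move=> [/andP[? ?] /andP[? ?]]; split; apply/andP; split; lra.
  by move=> [/andP[? ?] /andP[? ?]]; split; apply/andP; split; lra.
have Kr z : K (ofC z) -> cm (z - z0) < r.
  by move=> /KP[h1 h2]; apply: (le_lt_trans (cm_le_ReIm _)); rewrite /s in h1 h2; lra.
have Kz0 : K (ofC z0) by apply/KP; rewrite subrr /= normr0; split; exact: ltW.
have cf : {within K, continuous (fun p => cm (G (toC p) - zeta))}.
  apply/within_contP => p Kp e e0.
  have Kp' : K (ofC (toC p)) by rewrite toCK.
  have [/cd_cont cG _] := HG (toC p) (Kr _ Kp').
  have [d d0 Hd] := cG e e0; exists d => // p' _ /Hd; apply: le_lt_trans.
  apply: (le_trans (cm_lip _ _)); rewrite le_eqVlt; apply/orP; left; apply/eqP; congr cm; ring.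
have [c Kc Hc] := compact_EVT_min (ex_intro _ _ Kz0) (@rect_compact_set _ _ _ _) cf.
rewrite inE in Kc.
pose z := toC c; have Kz : K (ofC z) by rewrite toCK.
have zr := Kr _ Kz; exists z => //.
apply/eqP; rewrite -subr_eq0 -cm_eq0; apply/negPn/negP => m0.
set m := cm (G z - zeta) in m0.
have mp : 0 < m by rewrite lt_def m0 cm_ge0.
have mle v : K (ofC v) -> m <= cm (G v - zeta).
  by move=> Kv; have := Hc (ofC v); rewrite inE ofCK; apply.
(* The centre already has a value below [s / 4]; with the lower bound on [G] this forces
   [cm (z - z0) < s], inside the square. *)
have m1 : m < s / 4 by apply: le_lt_trans (mle z0 Kz0) _; rewrite cm_dist.
have zs : cm (z - z0) < s.
  have := lb z zr; have := cmD (G z - zeta) (zeta - G z0); rewrite addrA subrK -/m; lra.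
have [dG G10] := HG z zr.
(* This is the Newton step towards [zeta]. A fraction [t] of it lowers the distance from [m] to at
   most [(1 - t / 2) * m], against minimality. *)
pose h := (zeta - G z) / G1 z.
have ch : cm h = m / cm (G1 z) by rewrite /h cmM cmV cm_dist.
have g1p : 0 < cm (G1 z) by rewrite cm_gt0.
have [d d0 Hd] := dG (cm (G1 z) / 2) ltac:(by rewrite divr_gt0).
have hp : 0 < cm h by rewrite ch divr_gt0.
pose t := Num.min (1 / 2) (Num.min (d / (2 * cm h)) ((s - cm (z - z0)) / cm h)).
have t0 : 0 < t.
  by rewrite !lt_min; apply/and3P; split; [lra|apply: divr_gt0 => //; exact: mulr_gt0|rewrite divr_gt0// subr_gt0].
have t1 : t <= 1 / 2 by rewrite ge_min lexx.
have t2 : t <= d / (2 * cm h) by rewrite !ge_min lexx orbT.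
have t3 : t <= (s - cm (z - z0)) / cm h by rewrite !ge_min lexx !orbT.
rewrite ler_pdivlMr ?mulr_gt0// in t2; rewrite ler_pdivlMr// in t3.
have cth : cm (t%:C * h) = t * cm h by rewrite cmM cmR gtr0_norm.
have Kv : K (ofC (z + t%:C * h)).
  have b : cm (z + t%:C * h - z0) <= s.
    by rewrite addrAC; apply: (le_trans (cmD _ _)); rewrite cth; lra.
  by apply/KP; split; [apply: le_trans (Re_le_cm _) b|apply: le_trans (Im_le_cm _) b].
have := mle _ Kv; rewrite leNgt => /negP; apply.
have := Hd (t%:C * h) ltac:(by rewrite cth; lra).
rewrite cth; have -> : cm (G1 z) / 2 * (t * cm h) = t * m / 2.
  by rewrite ch; field; rewrite gt_eqF.
set E := _ - G1 z * _ => hE.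
have -> : G (z + t%:C * h) - zeta = (1 - t)%:C * (G z - zeta) + E.
  by rewrite /E /h cRD cRN; field.
apply: (le_lt_trans (cmD _ _)); rewrite cmM cmR -/m ger0_norm; last lra.
have : 0 < t * m by rewrite mulr_gt0.
lra.
Qed.

Lemma lip_connected (I : set R) (f : R -> R * R) (K : R) : connected I -> 0 <= K ->
  (forall s t, I s -> I t -> cm (toC (f s) - toC (f t)) <= K * `|s - t|) -> connected (f @` I).
Proof.
move=> cI K0 lip; apply: connected_continuous_connected => //.
apply/subspace_continuousP => t It B /nbhs_cm[d d0 Hd].
have K1 : 0 < K + 1 by lra.
rewrite /within /=; exists (d / (K + 1)) => /=; first by rewrite divr_gt0.
move=> s /=; rewrite distrC ltr_pdivlMr// => st Is; apply: Hd.
apply: (le_lt_trans (lip _ _ Is It)).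
have := normr_ge0 (s - t); lra.
Qed.
End Inverse.

(** * The domain, the inverse parametrisation and the candidate solution *)

Section Backward.
Context {R : realType}.
Local Notation C := R[i].
Implicit Types (z w l : C) (p : R * R).
Context (W : set R) (Psi F g h : R -> R) (dl M Q L : R).
Variables (oW : open W) (KW : `[-1, 1] `<=` W) (FW : real_analytic_on W F).
Variable FE : {in `[-1, 1]%classic, F =1 Psi}.
Variable H : curve_data (gam F 0) (gam F 1) (gam F 2) (gam F 3) dl M.
Variable D : density (qd F h) Q L.
Local Notation ga := (gam F 0).
Local Notation ga1 := (gam F 1).
Local Notation ga2 := (gam F 2).
Local Notation q := (qd F h).
Local Notation tau := (tau ga ga1 q).
Local Notation tau1 := (tau1 ga ga1 ga2 q).
Local Notation S := (closure (subgraph Psi)).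
Local Notation Hf := (H_fun Psi g h).
Local Notation Gm := (graph_curve Psi).
Hypothesis HA : real_analytic_on `]-1, 1[ Hf.

Definition good z := strip dl z /\
  [/\ cd (dext 0 Hf) z (dext 1 Hf z), cd (dext 1 Hf) z (dext 2 Hf z) & ccont (dext 2 Hf) z].

Lemma good_near (a : R) : -1 < a < 1 -> exists2 r : R, 0 < r &
  forall z, cm (z - a%:C) < r -> good z.
Proof.
move=> aI; have [r r0 [_ Hr]] := strip_near H aI.
have oI : open (`]-1, 1[%classic : set R) by exact: interval_open.
have aI' : `]-1, 1[%classic a by rewrite /= in_itv.
have [r0' r00 H0] := dext_cd 0 oI HA aI'.
have [r1 r10 H1] := dext_cd 1 oI HA aI'.
have [r2 r20 H2] := dext_cd 2 oI HA aI'.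
exists (Num.min (Num.min r r0') (Num.min r1 r2)); first by rewrite !lt_min r0 r00 r10.
move=> z; rewrite !lt_min => /andP[/andP[h1 h2] /andP[h3 h4]]; split; first exact: Hr.
by split; [exact: H0|exact: H1|exact: cd_cont (H2 _ h4)].
Qed.

(* The inverse of the parametrisation; [0] outside its range. *)
Definition zi (zeta : C) : C := xget 0 [set z | strip dl z /\ ga z = zeta].

Lemma ziK z : strip dl z -> zi (ga z) = z.
Proof.
move=> hz; have [hz' E] := @xgetPex _ (0 : C) [set w | strip dl w /\ ga w = ga z]
  (ex_intro _ z (conj hz erefl)).
exact: (cv_inj H hz' hz E).
Qed.

Lemma g1_neq0 z : strip dl z -> ga1 z != 0.
Proof.
move=> hz; have := cv_re H hz; apply: contraTneq => ->.
by rewrite /= -ltNge invr_gt0.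
Qed.

(** The condition on the abscissa is the one [below_in] asks for. Discs centred on the curve are
    used so that every point of their union [Udom] is joined to the curve by a radius. *)
Definition nice (a r : R) := forall zeta, cm (zeta - ga a%:C) < r ->
  -1 < Re zeta < 1 /\ exists2 z, good z & ga z = zeta.

Definition Udom : set (R * R) := [set p | exists a r : R,
  [/\ -1 < a < 1, cm (toC p - ga a%:C) < r & nice a r]].

Lemma nice_near (a : R) : -1 < a < 1 -> exists2 r : R, 0 < r & nice a r.
Proof.
move=> aI; have [r r0 Hr] := good_near aI.
have aI' : -1 <= a <= 1 by lra.
have sa := strip_real (cv_dl H) aI'.
have [|z zr|d d0 Hd] := @open_map _ ga ga1 a%:C r r0.
- move=> z /Hr[hz _]; split; [exact: cv_d1 H _ hz|exact: g1_neq0].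
- by have [hz _] := Hr z zr; exact: (cv_lb H sa hz).
exists (Num.min d (Num.min (1 - a) (1 + a))).
  by rewrite !lt_min d0 /=; apply/andP; split; lra.
move=> zeta; rewrite !lt_min => /andP[h1 /andP[h2 h3]]; split.
  rewrite (gam_real KW FW FE aI') in h2 h3; have := Re_le_cm (zeta - (a +i* Psi a)).
  rewrite cReB /= ler_norml.
  by move=> /andP[? ?]; apply/andP; split; lra.
by have [z zr E] := Hd _ h1; exists z => //; exact: Hr.
Qed.

Lemma Udom_open : open Udom.
Proof.
rewrite openE => p [a [r [aI pr na]]]; apply/nbhs_cm.
exists (r - cm (toC p - ga a%:C)) => [|p' h1]; first by rewrite subr_gt0.
exists a, r; split => //.
have -> : toC p' - ga a%:C = (toC p' - toC p) + (toC p - ga a%:C) by ring.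
by apply: (le_lt_trans (cmD _ _)); lra.
Qed.

Lemma Gamma_Udom : Gm `<=` Udom.
Proof.
move=> p [pI pE]; have [r r0 nr] := nice_near pI.
exists p.1, r; split => //.
rewrite (gam_real KW FW FE) -?pE; last by lra.
by rewrite (_ : _ - _ = 0) ?cm0// /toC subrr.
Qed.

Lemma Udom_zi p : Udom p -> [/\ -1 < p.1 < 1, good (zi (toC p)) & ga (zi (toC p)) = toC p].
Proof.
move=> [a [r [aI pr /(_ _ pr)[pI [z gz E]]]]].
have zE : zi (toC p) = z by rewrite -E ziK//; case: gz.
by rewrite zE.
Qed.

Lemma Udom_connected : connected Udom.
Proof.
have Gc : connected Gm.
  have M0 : 0 <= M by exact: M_ge0 H.
  rewrite (_ : Gm = (fun t => (t, Psi t)) @` `]-1, 1[%classic); last first.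
    apply/seteqP; split => [[x y] /= [xI /= ->]|p /= [t tI <-]]; last by rewrite in_itv in tI.
    by exists x => //; rewrite in_itv.
  apply: (@lip_connected _ _ _ (1 + M)); [exact/connected_intervalP/interval_is_interval|lra|].
  move=> s t; rewrite /= !in_itv /= => sI tI; rewrite toC_sub /=.
  apply: (le_trans (cm_RI _ _)); rewrite mulrDl mul1r lerD2l.
  by apply: (Psi_lip KW FW FE H); lra.
(* This is a radius from [p] to a chosen centre on the curve. The curve with one radius is
   connected, and all these sets share the curve. *)
pose seg (p : R * R) := if pselect (exists a, -1 < a < 1 /\ exists r, cm (toC p - ga a%:C) < r /\ nice a r)
  is left e then
    (fun s : R => ofC (ga (sval (cid e))%:C + s%:C * (toC p - ga (sval (cid e))%:C))) @` `[0, 1]%classic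
  else set0.
have segP p : Udom p -> exists a : R, [/\ -1 < a < 1, seg p p, seg p (ofC (ga a%:C)), seg p `<=` Udom &
    connected (seg p)].
  move=> [a0 [r0 [a0I pr0 na0]]]; rewrite /seg.
  case: pselect => [e|]; last by case; exists a0; split => //; exists r0.
  case: (cid e) => a /= [aI [r [pr na]]].
  exists a; split => //.
  - exists 1; first by rewrite /= in_itv /= ler01 lexx.
    by rewrite mul1r addrC subrK toCK.
  - exists 0; first by rewrite /= in_itv /= ler01 lexx.
    by rewrite mul0r addr0.
  - move=> _ [s sI <-]; exists a, r; split => //; rewrite ofCK addrAC subrr add0r cmM cmR.
    move: sI; rewrite /= in_itv /= => /andP[s0 s1]; rewrite ger0_norm//.
    by apply: le_lt_trans pr; rewrite ler_piMl ?cm_ge0.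
  - apply: (@lip_connected _ _ _ (cm (toC p - ga a%:C))); [exact: segment_connected|exact: cm_ge0|].
    move=> s t _ _; rewrite !ofCK.
    rewrite (_ : _ - _ = (s - t)%:C * (toC p - ga a%:C)); last by rewrite cRD cRN; ring.
    by rewrite cmM cmR mulrC.
have E : Udom = \bigcup_(p in Udom) (Gm `|` seg p).
  apply/seteqP; split => [p Up|x [p Up [Gx|sx]]].
  - by have [a [_ sp _ _ _]] := segP p Up; exists p => //; right.
  - exact: Gamma_Udom.
  - by have [a [_ _ _ sub _]] := segP p Up; exact: sub.
rewrite E; apply: bigcup_connected.
  exists (0, Psi 0) => p Up; left; split => //=; apply/andP; split; lra.
move=> p Up; have [a [aI _ sa _ cs]] := segP p Up; apply: connectedU => //.
exists (ofC (ga a%:C)); split => //.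
by rewrite (gam_real KW FW FE); [split|lra].
Qed.

Local Notation A := (Udom `\` S).

Lemma A_zi p : A p <-> Udom p /\ 0 < Im (zi (toC p)).
Proof.
split=> [[Up nS]|[Up z0]]; split => //; have [pI [hz _] E] := Udom_zi Up.
- rewrite ltNge; apply/negP => z0; apply: nS.
  rewrite -(toCK p) -E; apply: (below_in KW FW FE H hz) => //.
  by rewrite E.
- by rewrite -(toCK p) -E; exact: (above_notin KW FW FE H hz z0).
Qed.

Lemma zi_lip p (t : R) : Udom p -> -1 <= t <= 1 -> cm (zi (toC p) - t%:C) <= 2 * cm (toC p - ga t%:C).
Proof.
move=> Up tI; have [pI [hz _] E] := Udom_zi Up.
have := cv_lb H (strip_real (cv_dl H) tI) hz; rewrite E; lra.
Qed.

(** The lower bound [cv_lb] makes the inverse Lipschitz with constant two, so the first-order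
    expansion of [ga] can be solved for the parameter. The [e / 4] pays for this factor two and for
    [1 / |ga1| <= 2]. *)
Lemma zi_cd p : Udom p -> cd zi (toC p) (ga1 (zi (toC p)))^-1.
Proof.
move=> Up; have [_ [hz _] E] := Udom_zi Up; set z := zi (toC p) in hz E *.
have g0 := g1_neq0 hz; have g2 := cv_re H hz.
have g3 : 2^-1 <= cm (ga1 z).
  by apply: (le_trans g2); apply: (le_trans (ler_norm _)); exact: Re_le_cm.
move=> e e0; have [d d0 Hd] := cv_d1 H hz (ltac:(lra) : 0 < e / 4).
have [r r0 Hr] := open_cm Udom_open Up.
exists (Num.min r (d / 2)); first by rewrite lt_min r0; lra.
move=> x; rewrite lt_min => /andP[xr xd].
have Up' : Udom (ofC (toC p + x)).
  by apply: Hr; rewrite ofCK addrAC subrr add0r.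
have := Udom_zi Up'; rewrite ofCK -/z; set z' := zi (toC p + x) => -[_ [hz' _] E'].
have lz := cv_lb H hz hz'; rewrite E E' addrAC subrr add0r in lz.
have := Hd (z' - z) ltac:(lra); rewrite [z + _]addrC subrK E' E [toC p + x - _]addrAC subrr add0r => hE.
have -> : z' - z - (ga1 z)^-1 * x = - ((ga1 z)^-1 * (x - ga1 z * (z' - z))) by field.
rewrite cmN cmM cmV.
have iv : (cm (ga1 z))^-1 <= 2 by rewrite -[leRHS]invrK lef_pV2 ?posrE ?invr_gt0//; lra.
have iv0 : 0 <= (cm (ga1 z))^-1 by rewrite invr_ge0 cm_ge0.
have b : e / 4 * cm (z' - z) <= e / 4 * (2 * cm x) by rewrite ler_wpM2l//; lra.
apply: (@le_trans _ _ (2 * (e / 4 * (2 * cm x)))); last lra.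
by apply: ler_pM => //; [exact: cm_ge0|exact: le_trans b].
Qed.

Definition kf p : R := Re (dext 0 Hf (zi (toC p))) + Tp ga q (zi (toC p)).
(** With the value [g p.1] off [A] the Dirichlet condition holds by definition, and the work lies in
    continuity up to the curve. *)
Definition uf p : R := if p \in A then kf p else g p.1.
Definition phi z := dext 1 Hf z + tau z.
(** Division by [gamma'] carries the conjugate gradient [phi] from the parameter plane to the plane
    of the curve. *)
Definition fz z := phi z * (ga1 z)^-1.
Definition fz1 z := (dext 2 Hf z + tau1 z) * (ga1 z)^-1 + phi z * (- ga2 z / ga1 z ^+ 2).

Lemma A_open : open A.
Proof. by apply: openI; [exact: Udom_open|apply: closed_openC; exact: closed_closure]. Qed.

Lemma uf_hol p : A p -> [/\ gd (uC uf) (toC p) (fz (zi (toC p))),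
  cd (fun w => fz (zi w)) (toC p) (fz1 (zi (toC p)) * (ga1 (zi (toC p)))^-1) &
  ccont (fun w => fz1 (zi w) * (ga1 (zi w))^-1) (toC p)].
Proof.
move=> Ap; have [Up z0] := (A_zi p).1 Ap; have zc := zi_cd Up.
have [_ [hz [d0 d1 c2]] _] := Udom_zi Up; set z := zi (toC p) in z0 zc hz d0 d1 c2 *.
have zn : Im z != 0 by rewrite gt_eqF.
have g0 := g1_neq0 hz; have cg := cv_d2 H hz.
have cp : cd phi z (dext 2 Hf z + tau1 z) by apply: cdD => //; exact: (tau_cd H D).
split.
- apply: (@gd_proj _ A _ (fun w => Re (dext 0 Hf (zi w)) + Tp ga q (zi w))).
  + exact: A_open.
  + exact: Ap.
  + by move=> p' Ap'; rewrite /uf mem_set.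
  + apply: (@gd_comp _ (fun z => Re (dext 0 Hf z) + Tp ga q z) zi _ _ _ zc).
    by apply: gdD; [exact: cd_gdRe|exact: (Tp_gd H D)].
- by apply: (cd_comp zc); exact: cdM cp (cdV g0 cg).
- have cz := cd_cont zc.
  have cV : ccont (fun w => (ga1 w)^-1) z by apply: contV => //; exact: cd_cont cg.
  apply: (@cont_comp _ (fun w => fz1 w * (ga1 w)^-1) zi) => //.
  apply: contM => //; apply: contD; apply: contM => //.
  + by apply: contD => //; exact: (tau1_cont H D).
  + exact: cd_cont cp.
  + have -> : (fun w => - ga2 w / ga1 w ^+ 2) = (fun w => - ga2 w * ((ga1 w)^-1 * (ga1 w)^-1)).
      by apply/funext => w; rewrite -invfM expr2.
    apply: contM; last exact: contM.
    by apply: contN; exact: cd_cont (cv_d3 H hz).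
Qed.

Lemma lim_uplim (k : R * R -> R) (K : C -> R) (t l : R) : -1 < t < 1 ->
  (forall p, A p -> k p = K (zi (toC p))) -> uplim (fun z => (K z)%:C) t%:C l%:C ->
  k p @[p --> within A (nbhs (t, Psi t))] --> l.
Proof.
move=> tI kE Kl; apply/withinP => e /Kl[d d0 Hd]; exists (d / 2); first by rewrite divr_gt0.
move=> p Ap pd; have [Up z0] := (A_zi p).1 Ap.
have tI' : -1 <= t <= 1 by lra.
have := zi_lip Up tI'; rewrite (gam_real KW FW FE tI') => zl.
by have := Hd _ (ltac:(lra)) z0; rewrite -cRN -cRD cmR kE.
Qed.

Lemma fz_uplim t : -1 < t < 1 -> exists l : R,
  uplim fz t%:C ((l +i* (- q t)) / (1 +i* derive1 Psi t)).
Proof.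
move=> tI; have [l Hl] := tau_lim H D tI.
have tI' : -1 <= t <= 1 by lra.
have oI : open (`]-1, 1[%classic : set R) by exact: interval_open.
have aI' : `]-1, 1[%classic t by rewrite /= in_itv.
have [_ iH] := dext1_real oI HA aI'.
have st := strip_real (cv_dl H) tI'.
have [r r0 Hr] := good_near tI.
have [_ [_ d1 _]] := Hr t%:C ltac:(by rewrite subrr cm0).
have [v v0 Hv] : exists2 v : C, Im v = 0 & uplim (dext 1 Hf) t%:C v.
  by exists (dext 1 Hf t%:C); [exact: iH|exact: uplim_cont (cd_cont d1)].
exists (Re v + l).
have cV : ccont (fun w => (ga1 w)^-1) t%:C.
  by apply: contV; [exact: g1_neq0|exact: cd_cont (cv_d2 H st)].
have := uplimM (uplimD Hv Hl) (uplim_cont cV).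
rewrite (gam1_real oW KW FW FE tI).
have -> : v + (l +i* (- q t)) = (Re v + l) +i* (- q t).
  by apply: c_eqP; rewrite !cE //= v0 add0r.
exact.
Qed.

Lemma uplim_pr (Fz : C -> C) (pr : C -> R) z m : (forall a b, `|pr a - pr b| <= cm (a - b)) ->
  uplim Fz z m -> uplim (fun w => (pr (Fz w))%:C) z (pr m)%:C.
Proof.
move=> lip H0 e /H0[d d0 Hd]; exists d => // w wd w0; rewrite -cRN -cRD cmR.
by apply: le_lt_trans (lip _ _) (Hd w wd w0).
Qed.

(** Multiplying the limit [m = a - i b] by [1 + i Psi'] undoes the division in [fz]. The derivative
    of the extension of [Hf] is real on the axis, so the imaginary part is that of [tau], namely
    [- q t]. *)
Lemma partial_limits t : -1 < t < 1 -> exists a b : R, [/\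
  partial1 uf p @[p --> within A (nbhs (t, Psi t))] --> a,
  partial2 uf p @[p --> within A (nbhs (t, Psi t))] --> b & b - a * derive1 Psi t = q t].
Proof.
move=> tI; have [l Hl] := fz_uplim tI.
set m := _ / _ in Hl; exists (Re m), (- Im m); split.
- apply: (lim_uplim (K := fun z => Re (fz z)) tI); last exact: uplim_pr (@Re_lip R) Hl.
  by move=> p /(hol_partials uf_hol)[].
- apply: (lim_uplim (K := fun z => - Im (fz z)) tI); last exact: (uplim_pr (@NIm_lip R) Hl).
  by move=> p /(hol_partials uf_hol)[].
have n0 : (1 +i* derive1 Psi t : C) != 0 by rewrite eq_complex /= oner_eq0.
have E : m * (1 +i* derive1 Psi t) = l +i* (- q t) by rewrite /m divfK.
have : Im (m * (1 +i* derive1 Psi t)) = - q t by rewrite E.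
rewrite cImM /= mulr1 => E2; lra.
Qed.
End Backward.

Section BackwardSolution.
Context {R : realType}.
Local Notation C := R[i].
Implicit Types (z w l : C) (p : R * R).
Context (W : set R) (Psi F g h : R -> R) (dl M Q L : R).
Variables (oW : open W) (KW : `[-1, 1] `<=` W) (FW : real_analytic_on W F).
Variable FE : {in `[-1, 1]%classic, F =1 Psi}.
Variable H : curve_data (gam F 0) (gam F 1) (gam F 2) (gam F 3) dl M.
Variable D : density (qd F h) Q L.
Local Notation S := (closure (subgraph Psi)).
Local Notation Hf := (H_fun Psi g h).
Local Notation Gm := (graph_curve Psi).
Hypothesis HA : real_analytic_on `]-1, 1[ Hf.
Local Notation U := (Udom Psi F g h dl).
Local Notation A := (U `\` S).
Local Notation u := (uf Psi F g h dl).

(** The boundary values [Hf t] and [Tb t] add up to [g t] by [H_funE]. *)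
Lemma u_limit t : -1 < t < 1 -> u p @[p --> within A (nbhs (t, Psi t))] --> g t.
Proof.
move=> tI; apply: (lim_uplim KW FW FE H (K := fun z => Re (dext 0 Hf z) + Tp (gam F 0) (qd F h) z) tI).
  by move=> p Ap; rewrite /uf mem_set.
have [r r0 Hr] := good_near H HA tI.
have [_ [d0 _ _]] := Hr t%:C ltac:(by rewrite subrr cm0).
have tI' : `]-1, 1[%classic t by rewrite /= in_itv.
have h0 := uplim_pr (@Re_lip R) (uplim_cont (cd_cont d0)).
rewrite (dext0_real HA tI') in h0.
have := uplimD h0 (Tp_lim H D tI); rewrite -cRD.
rewrite [Re _]/= (H_funE g oW KW FW FE H D tI) subrK.
by apply: uplim_ext ltr01 _ => z _ _; rewrite -cRD.
Qed.

Lemma Gm_notin p : Gm p -> ~ A p.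
Proof. by move=> /Gamma_closure Sp [_]; apply. Qed.

Lemma Gm_near p : Gm p -> forall d : R, 0 < d -> exists2 p', A p' & cm (toC p' - toC p) < d.
Proof.
case: p => x y [/= xI ->]; apply: (A_near KW FW FE H _ _ xI); first exact: Udom_open.
exact: (Gamma_Udom KW FW FE H HA).
Qed.

Lemma backward_solution : exists (U : set (R * R)) (u : R * R -> R),
     [/\ open U, connected U, Gm `<=` U,
         C2_on (U `\` S) u /\ C1_up_to (U `\` S) Gm u
       & cauchy_solution Psi g h U u].
Proof.
have hol p (Ap : A p) := uf_hol KW FW FE H D Ap.
have oA : open A by exact: A_open.
have C2 := hol_C2 oA hol; have [C1 C11 C12] := C2; have [c0 _ c1 c2] := C1.
have GP p : Gm p -> p = (p.1, Psi p.1) by case: p => x y [/= _ ->].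
have plim := partial_limits oW KW FW FE H D HA.
(* The function is its own gluing to [g p.1], so [glue_continuous] applies to [u] itself. *)
have uE p : (if p \in A then u p else g p.1) = u p by rewrite /uf; case: (p \in A).
exists U, u; split.
- exact: Udom_open.
- exact: (Udom_connected KW FW FE H HA).
- exact: (Gamma_Udom KW FW FE H HA).
- split=> //; split => //.
  + have := @glue_continuous _ A Gm u (fun p => g p.1) oA Gm_notin c0 Gm_near.
    rewrite (funext uE); apply => p Gp; rewrite (GP p Gp); apply: u_limit.
    by case: Gp.
  + apply: (@glue_extends _ A Gm (partial1 u)
      (fun p => xget 0 [set l : R | partial1 u q @[q --> within A (nbhs p)] --> l]) oA Gm_notin c1 Gm_near).
    move=> p Gp; apply: (@xgetPex _ (0 : R) [set l : R | partial1 u q @[q --> within A (nbhs p)] --> l]).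
    have [a [b [ha _ _]]] := plim p.1 Gp.1.
    by exists a; rewrite (GP p Gp).
  + apply: (@glue_extends _ A Gm (partial2 u)
      (fun p => xget 0 [set l : R | partial2 u q @[q --> within A (nbhs p)] --> l]) oA Gm_notin c2 Gm_near).
    move=> p Gp; apply: (@xgetPex _ (0 : R) [set l : R | partial2 u q @[q --> within A (nbhs p)] --> l]).
    have [a [b [_ hb _]]] := plim p.1 Gp.1.
    by exists b; rewrite (GP p Gp).
- split.
  + exact: hol_laplacian oA hol.
  + by move=> x xI; rewrite -uE memNset//; apply: Gm_notin; split.
  + move=> x xI; have [a [b [ha hb E]]] := plim x xI.
    have Gx : Gm (x, Psi x) by split.
    rewrite (normal_derivativeE (boundary_valueE (Gm_near Gx) ha) (boundary_valueE (Gm_near Gx) hb)).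
    by rewrite E (qdE h oW KW FW FE xI) mulfK// gt_eqF// sqrt_pos.
Qed.
End BackwardSolution.

Theorem theorem2p1 (R : realType) (Psi g h : R -> R)
    (Psi_analytic : has_analytic_extension `[-1, 1] Psi)
    (g_C1 : C1_itvcc (-1) 1 g) (h_C1 : C1_itvcc (-1) 1 h) :
  (exists (U : set (R * R)) (u : R * R -> R),
     [/\ open U, connected U, graph_curve Psi `<=` U,
         C2_on (U `\` closure (subgraph Psi)) u
           /\ C1_up_to (U `\` closure (subgraph Psi)) (graph_curve Psi) u
       & cauchy_solution Psi g h U u])
  <-> real_analytic_on `]-1, 1[ (H_fun Psi g h).
Proof.
have [W [F [oW KW FE FW]]] := Psi_analytic.
have [dl [M H]] := curve_exists oW KW FW.
have [Q [L D]] := qd_density H h_C1.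
split.
- move=> [U [u [oU _ GU [C2u C1u] sol]]].
  exact: (H_fun_analytic oW KW FW FE H D oU GU C2u C1u sol).
- exact: (backward_solution oW KW FW FE H D).
Qed.
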